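(* Let $Q$ be a $2\times2$ $\pi$-periodic matrix function on $\mathbb{R}$, integrable on $[0,\pi)$, of canonical form $Q=\left(\begin{array}{cc} p & s\\ s & -p\end{array}\right)$ with $p,s$ real valued. For $\lambda\in\mathbb{C}$ let $\mathbb{Y}(z)=\mathbb{Y}(z,\lambda)$ be the $2\times2$ matrix solution of $JY'+QY=\lambda Y$ with $\mathbb{Y}(0)=\mathbb{I}$, and let $\Delta(\lambda)=\mathrm{Tr}\,\mathbb{Y}(\pi,\lambda)$. Then $\Delta-2$ has only double zeros if and only if $\mathbb{Y}(\pi,\lambda)=\big(\sigma_2\mathbb{Y}(\frac{\pi}{2},\lambda)\big)^2$ for all $\lambda\in\mathbb{C}$.
   Context: $J=\left(\begin{array}{cc}0&1\\-1&0\end{array}\right)$, $\sigma_2=\left(\begin{array}{cc}0&i\\-i&0\end{array}\right)=iJ$, and $\mathbb{I}$ is the $2\times2$ identity matrix. Solutions are locally absolutely continuous in $z\in\mathbb{R}$ with the equation holding a.e. ''$f$ has only double zeros'' means that every zero of the entire function $f$ of $\lambda$ has multiplicity exactly $2$. *)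

(* Defs.v *)
From HB Require Import structures.
From mathcomp Require Import all_boot all_order all_algebra.
From mathcomp Require Import all_classical all_reals all_analysis.
From mathcomp Require Import complex.

Set Implicit Arguments.
Unset Strict Implicit.
Unset Printing Implicit Defensive.

Import Order.TTheory GRing.Theory Num.Theory.
Import numFieldNormedType.Exports.

Local Open Scope classical_set_scope.
Local Open Scope complex_scope.
Local Open Scope ring_scope.

Definition mx2 (K : Type) (a b c d : K) : 'M[K]_2 :=
  \matrix_(i < 2, j < 2)
    if i == 0 then (if j == 0 then a else b) else (if j == 0 then c else d).

Definition Jmx (R : realType) : 'M[R[i]]_2 := mx2 0 1 (- 1) 0.

Definition sigma2 (R : realType) : 'M[R[i]]_2 := mx2 0 'i%C (- 'i%C) 0.

Definition Dirac_canonical_form (R : realType) (Q : R -> 'M[R[i]]_2) (p s : R -> R) :=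
  forall z, Q z = mx2 (p z)%:C (s z)%:C (s z)%:C (- (p z)%:C).

(* Integrability refers to the completed measure because measurability for
   [lebesgue_measure] means Borel measurability. *)
Definition Lebesgue_integrable (R : realType) (D : set R) (f : R -> R) :=
  (@completed_lebesgue_measure R).-integrable D (EFin \o f).

(* The [I k] are the end points of finitely many non-overlapping subintervals
   of [a, b]. *)
Definition absolutely_continuous (R : realType) (a b : R) (f : R -> R) :=
  forall e : R, 0 < e -> exists2 d : R, 0 < d &
    forall (n : nat) (I : 'I_n -> R * R),
      (forall k, a <= (I k).1 /\ (I k).1 <= (I k).2 /\ (I k).2 <= b) ->
      (forall k l, k != l -> (I k).2 <= (I l).1 \/ (I l).2 <= (I k).1) ->
      \sum_(k < n) ((I k).2 - (I k).1) < d ->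
      \sum_(k < n) `|f (I k).2 - f (I k).1| < e.

Definition locally_absolutely_continuous (R : realType) (f : R -> R) :=
  forall a b : R, absolutely_continuous a b f.

Definition mx_locally_absolutely_continuous (R : realType)
    (Y : R -> 'M[R[i]]_2) :=
  forall i j : 'I_2,
    locally_absolutely_continuous (fun t => complex.Re (Y t i j)) /\
    locally_absolutely_continuous (fun t => complex.Im (Y t i j)).

Definition mx_is_derive (R : realType) (Y : R -> 'M[R[i]]_2) (z : R)
    (D : 'M[R[i]]_2) :=
  forall i j : 'I_2,
    is_derive z (1 : R) (fun t => complex.Re (Y t i j) : R^o) (complex.Re (D i j)) /\
    is_derive z (1 : R) (fun t => complex.Im (Y t i j) : R^o) (complex.Im (D i j)).

Definition Dirac_solution (R : realType) (Q : R -> 'M[R[i]]_2) (lambda : R[i])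
    (Y : R -> 'M[R[i]]_2) :=
  mx_locally_absolutely_continuous Y /\
  {ae (@lebesgue_measure R), forall z : R, exists2 D : 'M[R[i]]_2,
     mx_is_derive Y z D & Jmx R *m D + Q z *m Y z = lambda *: Y z}.

(* The target R[i]^o makes [derive1n] the iterated complex derivative. *)
Definition zero_multiplicity (R : realType) (f : R[i] -> R[i]^o) (a : R[i])
    (m : nat) :=
  (forall k, (k < m)%N -> derive1n k f a = 0) /\ derive1n m f a != 0.

Definition only_double_zeros (R : realType) (f : R[i] -> R[i]) :=
  forall a, f a = 0 -> zero_multiplicity f a 2.

(* Main.v *)
(** Write [f = Delta - 2], and let [Z] be the transfer matrix from [pi / 2] to [pi], so
    that [Y pi = Z Y(pi / 2)]. As [sigma2 A sigma2] is the inverse transpose of a matrix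
    [A] of determinant 1, the identity to prove says that [Z] is the inverse transpose of
    [Y(pi / 2)].

    Self-adjointness makes the zeros of [f] real. At such a zero [Y^T Y] is real with
    positive definite integral [G] over [0, pi]; hence the zero is multiple exactly when
    [Y pi = 1], and then [f = - det G w^2 + O(w^3)]. If the identity holds, then
    [M = sigma2 Y(pi / 2)] has determinant -1, [f = (tr M)^2] and, by Cayley-Hamilton,
    [Y pi = M^2 = 1] at every zero of [f].

    Conversely, if all zeros are double, then [Z = Y(pi / 2)^-1] at the zeros of [f].
    So the differences of the diagonal entries of [Z] and of the inverse transpose, as
    well as [u = Z01 + Y01] and [v = Z10 + Y10], vanish there. For large [lambda] the
    matrices [Z] and [Y(pi / 2)] are asymptotic to the rotation by [lambda pi / 2], so
    that [f] is asymptotic to [- 4 sin(lambda pi / 2)^2] on suitable large squares. When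
    [F] is [e^2] for [e] one of the two differences or [u + v], or when [F = u^2 + f],
    the quotient [F / f] is entire and tends to 0 on these squares; the maximum principle
    yields [F = 0]. The determinant relation then gives [u (Y10 - Y01 + u) = 0], whence
    [u = Y01 - Y10] and the claim. *)

Require Import Defs.
From HB Require Import structures.
From mathcomp Require Import all_boot all_order all_algebra.
From mathcomp Require Import all_classical all_reals all_analysis.
From mathcomp Require Import measurable_realfun complex.
From mathcomp Require Import ring lra.

Set Implicit Arguments.
Unset Strict Implicit.
Unset Printing Implicit Defensive.

Import Order.TTheory GRing.Theory Num.Theory.
Import numFieldNormedType.Exports.

Local Open Scope classical_set_scope.
Local Open Scope complex_scope.
Local Open Scope ring_scope.

(** * Absolutely continuous functions *)

(** As [Q] is only integrable, the differential equation holds almost everywhere. Products such as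
    the Wronskian of two solutions, from which [Q] drops out, have continuous derivatives; the power
    series in the spectral parameter is built from them. Holomorphy enters only as Taylor expansions
    with remainder, which pass to quotients at double zeros and suffice for the maximum principle.
    The asymptotics replace [Q] by an L1-close differentiable matrix and remove the latter to first
    order in 1 / lambda. The differences are squared because they are only known to vanish to first
    order where [f] vanishes to second order. They are small compared with the growth of sin(lambda
    pi / 2), so their squares are small compared with [f]. In contrast, [u] is asymptotic to - 2
    sin(lambda pi / 2), so that [u^2] is as large as [f] and only its sum with [f] is small; for the
    same reason [v] is replaced by [u + v]. At the end [u^2 = - f] shows that the zeros of [u] are
    among those of [f], hence isolated, and the second factor vanishes there by continuity. *)

Lemma is_derive_local_approx (R : realType) (f : R -> R) (x d e : R) :
  0 < e -> is_derive x (1 : R) (f : R -> R^o) d ->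
  exists2 r, 0 < r & forall y, `|y - x| < r ->
    `|f y - f x - d * (y - x)| <= e * `|y - x|.
Proof.
move=> e0 [/cvg_ex[/= l fl] fd].
have ld : l = d by rewrite -fd; apply/esym/cvg_lim.
move: fl; rewrite ld => /cvgrPdist_le/(_ _ e0)[/= r r0 fr].
exists r => // y yr; have [->|yx] := eqVneq y x.
  by rewrite !subrr mulr0 subr0 normr0 mulr0.
have := fr (y - x); rewrite /= sub0r normrN yr subr_eq0 yx => /(_ isT isT).
rewrite [(y - x) *: _]mulr1 subrK => fxy.
have yx0 : y - x != 0 by rewrite subr_eq0.
have -> : f y - f x - d * (y - x) = - (y - x) * (d - (y - x)^-1 * (f y - f x)).
  by field.
by rewrite normrM normrN mulrC ler_wpM2r.
Qed.

(** The supremum of the points reachable from [a] is reachable by the local hypothesis at it, and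
    the same hypothesis would lead beyond it if it were below [b]. *)
Lemma cousin (R : realType) (a b : R) (P : R -> R -> Prop) : a <= b ->
  (forall c d e, a <= c -> c <= d -> d <= e -> e <= b ->
     P c d -> P d e -> P c e) ->
  (forall x, a <= x <= b -> exists2 r, 0 < r & forall c d,
     a <= c -> c <= x -> x <= d -> d <= b -> d - c < r -> P c d) ->
  P a b.
Proof.
move=> ab Padd Ploc.
pose S := [set x | a <= x <= b /\ P a x].
have Sa : S a.
  split; first by rewrite lexx.
  have [|r r0 Pr] := Ploc a; first by rewrite lexx.
  by apply: Pr; rewrite // subrr.
have Sb : ubound S b by move=> x [/andP[]].
have hS : has_sup S by split; [exists a|exists b].
have leS x : S x -> x <= sup S by apply: ub_le_sup; exists b.
have as_ : a <= sup S by exact: leS.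
have sb : sup S <= b by apply: ge_sup => //; exists a.
have [|r r0 Pr] := Ploc (sup S); first by rewrite as_.
have r20 : 0 < r / 2 by rewrite divr_gt0.
have [x [/andP[ax xb] Px] xs] := sup_adherent r20 hS.
have xS : x <= sup S by apply: leS; split; rewrite ?ax.
have Ps : P a (sup S).
  by apply: (Padd a x) => //; apply: Pr => //; lra.
have [sb'|] := ltP (sup S) b; last by move=> bs; have <- : sup S = b by lra.
pose d := Num.min b (sup S + r / 2).
have sd : sup S < d by rewrite /d lt_min sb' ltrDl r20.
have db : d <= b by rewrite /d ge_min lexx.
have dr : d <= sup S + r / 2 by rewrite /d ge_min lexx orbT.
have : d <= sup S.
  apply: leS; split; first by rewrite db (le_trans as_ (ltW sd)).
  apply: (Padd a (sup S)) => //; first exact: ltW.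
  by apply: Pr => //; [exact: ltW|lra].
by rewrite leNgt sd.
Qed.

(** Lists replace indexed families because the additivity step of Cousin's lemma concatenates
    collections of intervals. *)
Lemma ac_list (R : realType) (a b e : R) (f : R -> R) :
  absolutely_continuous a b f -> 0 < e ->
  exists2 d : R, 0 < d & forall s : seq (R * R),
    (forall x, x \in s -> [/\ a <= x.1, x.1 <= x.2 & x.2 <= b]) ->
    pairwise (fun x y : R * R => x.2 <= y.1) s ->
    \sum_(x <- s) (x.2 - x.1) < d ->
    \sum_(x <- s) `|f x.2 - f x.1| < e.
Proof.
move=> fac /fac[d d0 fd]; exists d => // s sab ps sd.
rewrite !(big_nth (0, 0)) !big_mkord in sd *.
apply: (fd (size s) (fun k => nth (0, 0) s k)) => //.
- by move=> k; have [] := sab (nth (0,0) s k) (mem_nth _ (ltn_ord k)).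
- move=> k l kl; have /pairwiseP ps' := ps.
  have [lkl|lkl|/val_inj lkl] := ltngtP (nat_of_ord k) l.
  + by left; apply: (ps' (0,0)) => //; exact: ltn_ord.
  + by right; apply: (ps' (0,0)) => //; exact: ltn_ord.
  + by rewrite lkl eqxx in kl.
Qed.

(* Cousin's lemma cuts [a, b] into pieces: those in an open set of small measure
   around the exceptional null set are controlled by absolute continuity, the
   others by the derivative. *)
Lemma ac_le (R : realType) (a b : R) (f : R -> R) : a <= b ->
  absolutely_continuous a b f ->
  {ae (@lebesgue_measure R), forall z : R, a < z < b ->
     exists2 d, is_derive z (1 : R) (f : R -> R^o) d & d <= 0} ->
  f b <= f a.
Proof.
move=> ab fac [N [mN N0 fN]].
apply/ler_addgt0Pr => e0 e0gt.
(* In the denominator, [b - a] pays for the slope error on the pieces around good points, and 1 for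
   the total variation over the bad pieces. *)
pose e := e0 / (b - a + 1).
have ba1 : 0 < b - a + 1 by lra.
have e_gt0 : 0 < e by rewrite divr_gt0.
have [d d0 fd] := ac_list fac e_gt0.
(* The end points join the null set because the derivative is only controlled in the open
   interval. *)
pose N' := N `|` [set a; b].
have mN' : measurable (N' : set (measurableTypeR R)).
  by apply: measurableU => //; apply: measurableU => //; exact: measurable_set1.
have N'0 : lebesgue_measure (N' : set (measurableTypeR R)) = 0%E.
  apply/eqP; rewrite eq_le measure_ge0 andbT.
  apply: (le_trans (measureU2 _ _ _)) => //=.
    by apply: measurableU; exact: measurable_set1.
  rewrite [X in (X + _)%E]N0 add0e.
  apply: (le_trans (measureU2 _ _ _)); [exact: measurable_set1..|].
  by rewrite /= !lebesgue_measure_set1 adde0.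
have [|U [oU NU Ud]] := lebesgue_regularity_outer mN' _ d0; first by rewrite [ltLHS]N'0.
have mU : measurable (U : set (measurableTypeR R)) by exact: open_measurable.
have {}Ud : (lebesgue_measure (U : set (measurableTypeR R)) < d%:E)%E.
  have -> : U = N' `|` (U `\` N') by rewrite setDUK.
  apply: (le_lt_trans (measureU2 _ _ _)) => //=; first exact: measurableD.
  by rewrite [X in (X + _)%E]N'0 add0e.
(* [s] collects the pieces inside [U]. Bounding their length by the measure of [U] in []c, d]] makes
   the property additive and keeps the total below [d]. *)
pose P c d := exists s : seq (R * R),
  [/\ forall x, x \in s -> [/\ c <= x.1, x.1 <= x.2 & x.2 <= d],
      pairwise (fun x y : R * R => x.2 <= y.1) s,
      ((\sum_(x <- s) (x.2 - x.1))%:E <=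
         lebesgue_measure ((U `&` `]c, d]%classic) : set (measurableTypeR R)))%E &
      f d - f c <= e * (d - c) + \sum_(x <- s) `|f x.2 - f x.1|].
have : P a b.
  apply: cousin => //.
  - move=> c x y ac cx xy yb [s [s1 s2 s3 s4]] [t [t1 t2 t3 t4]].
    exists (s ++ t); split.
    + move=> z; rewrite mem_cat => /orP[/s1|/t1] [z1 z2 z3]; split => //; lra.
    + rewrite pairwise_cat s2 t2 !andbT; apply/allrelP => z w /s1[_ _ zx] /t1[xw _ _].
      exact: le_trans zx xw.
    + rewrite big_cat EFinD.
      have -> : U `&` `]c, y]%classic = (U `&` `]c, x]%classic) `|` (U `&` `]x, y]%classic).
        rewrite -setIUr; congr (_ `&` _).
        by apply/esym; rewrite -(@itv_bndbnd_setU _ _ _ (BRight x)) ?bnd_simp.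
      rewrite measureU; [exact: leeD|..].
      * by apply: measurableI => //; exact: measurable_itv.
      * by apply: measurableI => //; exact: measurable_itv.
      * apply/seteqP; split=> // z [[_ /=]]; rewrite in_itv/= => /andP[_ zx] [_].
        by rewrite /= in_itv/= => /andP[xz _]; have := lt_le_trans xz zx; rewrite ltxx.
    + rewrite big_cat /=; lra.
  - move=> x /andP[ax xb].
    have [N'x|N'x] := pselect (N' x).
    + have := oU; rewrite openE => /(_ x (NU _ N'x)) [r /= r0 xU].
      exists r => // c y ac cx xy yb ycr.
      have cU z : c <= z <= y -> U z.
        by move=> /andP[cz zy]; apply: xU; rewrite /ball_ /= ltr_norml; lra.
      exists [:: (c, y)]; split.
      * by move=> z; rewrite inE => /eqP -> /=; split => //; lra.
      * by [].
      * rewrite big_seq1/=.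
        have -> : U `&` `]c, y]%classic = `]c, y]%classic.
          by rewrite setIidr// => z /=; rewrite in_itv/= => /andP[cz zy]; apply: cU; rewrite ltW.
        rewrite lebesgue_measure_itv/= lte_fin.
        by case: ltP => cy; rewrite -?EFinD// lee_fin; lra.
      * rewrite big_seq1/=.
        have := ler_norm (f y - f c).
        have : 0 <= e * (y - c) by apply: mulr_ge0; [exact: ltW|lra].
        lra.
    + have [Nx xa xb'] : [/\ ~ N x, x != a & x != b].
        split; first by move=> Nx; apply: N'x; left.
        * by apply/eqP => xa; apply: N'x; right; left.
        * by apply/eqP => xa; apply: N'x; right; right.
      have [z dz z0] : exists2 d, is_derive x (1 : R) (f : R -> R^o) d & d <= 0.
        have : ~ ~ (a < x < b -> exists2 d, is_derive x (1 : R) (f : R -> R^o) d & d <= 0).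
          by move=> H; apply: Nx; apply: fN.
        by move=> /contrapT; apply; rewrite !lt_neqAle xb' ax xb eq_sym xa.
      have [r r0 fr] := is_derive_local_approx e_gt0 dz.
      exists r => // c y ac cx xy yb ycr.
      exists [::]; split => //; first by rewrite big_nil.
      rewrite big_nil addr0.
      have : `|c - x| < r by rewrite ler0_norm ?subr_le0//; lra.
      move=> /fr; rewrite (ler0_norm (_ : c - x <= 0)) ?subr_le0//.
      have : `|y - x| < r by rewrite ger0_norm ?subr_ge0//; lra.
      move=> /fr; rewrite (ger0_norm (_ : 0 <= y - x)) ?subr_ge0//.
      rewrite !ler_norml => /andP[_ h1] /andP[h2 _].
      have : z * (y - x) <= 0 by rewrite mulr_le0_ge0 // subr_ge0.
      have : z * (x - c) <= 0 by rewrite mulr_le0_ge0 // subr_ge0.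
      lra.
move=> [s [s1 s2 s3 s4]].
have sd : \sum_(x <- s) (x.2 - x.1) < d.
  rewrite -lte_fin; apply: le_lt_trans s3 _; apply: le_lt_trans Ud.
  apply: le_measure; rewrite ?inE//.
  by apply: measurableI => //; exact: measurable_itv.
have := fd s s1 s2 sd.
have -> : e0 = e * (b - a + 1) by rewrite /e divfK ?gt_eqF.
lra.
Qed.

Definition rder (R : realType) (f : R -> R) (x d : R) :=
  is_derive x (1 : R) (f : R -> R^o) d.

Lemma rderP (R : realType) (f : R -> R) (x d : R) :
  rder f x d <-> forall e, 0 < e -> exists2 r, 0 < r & forall y, `|y - x| < r ->
    `|f y - f x - d * (y - x)| <= e * `|y - x|.
Proof.
split=> [fd e e0|fd]; first exact: is_derive_local_approx.
have fl : h^-1 *: ((f : R -> R^o) (h *: (1 : R) + x) - f x) @[h --> 0^'] --> (d : R^o).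
  apply/cvgrPdist_le => /= e e0; have [r r0 fr] := fd _ e0.
  exists r => //= h; rewrite /ball_/= sub0r normrN => hr h0.
  rewrite [h *: _]mulr1; have := fr (h + x); rewrite addrK => /(_ hr).
  have -> : d - h^-1 *: (f (h + x) - f x) = - h^-1 * (f (h + x) - f x - d * h).
    by rewrite /GRing.scale/=; field.
  rewrite normrM normrN normfV => fh.
  by rewrite ler_pdivrMl ?normr_gt0// [leRHS]mulrC.
apply: (DeriveDef (df := (d : R^o))); last exact: cvg_lim fl.
exact: (cvgP _ fl).
Qed.

Section rder_rules.
Variable R : realType.
Implicit Types (f g : R -> R) (x c : R).

Lemma rder_near f g x d e : 0 < e -> (forall y, `|y - x| < e -> f y = g y) ->
  rder f x d -> rder g x d.
Proof.
move=> e0 fg /rderP fd; apply/rderP => u u0; have [r r0 fr] := fd _ u0.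
exists (Num.min e r); first by rewrite lt_min e0.
move=> y; rewrite lt_min => /andP[ye yr].
by rewrite -!fg ?subrr ?normr0//; exact: fr.
Qed.

Lemma rder_ext f g x d : f =1 g -> rder f x d -> rder g x d.
Proof. by move=> /funext ->. Qed.

Lemma rder_cst c x : rder (fun=> c) x 0.
Proof. exact: is_derive_cst. Qed.

Lemma rder_id x : rder (fun t => t) x 1.
Proof. exact: is_derive_id. Qed.

Lemma rderD f g x a b : rder f x a -> rder g x b ->
  rder (fun t => f t + g t) x (a + b).
Proof. exact: is_deriveD. Qed.

Lemma rderN f x a : rder f x a -> rder (fun t => - f t) x (- a).
Proof. exact: is_deriveN. Qed.

Lemma rderB f g x a b : rder f x a -> rder g x b ->
  rder (fun t => f t - g t) x (a - b).
Proof. exact: is_deriveB. Qed.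

Lemma rderM f g x a b : rder f x a -> rder g x b ->
  rder (fun t => f t * g t) x (a * g x + f x * b).
Proof.
move=> fa gb; have /= := is_deriveM fa gb.
by rewrite /rder addrC [g x *: a]mulrC.
Qed.

Lemma rder_comp f g x a b : rder f (g x) a -> rder g x b ->
  rder (fun t => f (g t)) x (a * b).
Proof. exact: is_derive1_comp. Qed.

Lemma rder_continuous f x d : rder f x d -> {for x, continuous f}.
Proof.
by move=> [fd _]; apply: differentiable_continuous; exact/derivable1_diffP.
Qed.

Lemma rder_within f (a b : R) (df : R -> R) :
  (forall x, a <= x <= b -> rder f x (df x)) -> {within `[a, b], continuous f}.
Proof.
move=> fd; apply: derivable_within_continuous => x; rewrite in_itv/= => xab.
by have [] := fd x xab.
Qed.

Lemma rder_mvt f (df : R -> R) (a b : R) : a <= b ->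
  (forall x, a <= x <= b -> rder f x (df x)) ->
  exists2 c, a <= c <= b & f b - f a = df c * (b - a).
Proof.
move=> ab fd; have [x xab|c cab fc] := @MVT_segment _ f df a b ab _ (rder_within fd).
  by apply: fd; move: xab; rewrite in_itv/= => /andP[/ltW -> /ltW ->].
by exists c.
Qed.

Lemma rder_le f (df : R -> R) (a b : R) : a <= b ->
  (forall x, a <= x <= b -> rder f x (df x)) ->
  (forall x, a <= x <= b -> df x <= 0) -> f b <= f a.
Proof.
move=> ab fd dle; have [c cab fc] := rder_mvt ab fd.
by rewrite -subr_le0 fc mulr_le0_ge0 ?dle// subr_ge0.
Qed.

Lemma continuous_bounded_itv (g : R -> R) (a b : R) : continuous g ->
  exists2 M, 0 < M & forall x, a <= x <= b -> `|g x| <= M.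
Proof.
move=> gc.
have /compact_bounded[M [_ mrt]] : compact (g @` `[a, b]%classic).
  apply: continuous_compact; last exact: segment_compact.
  exact: continuous_subspaceT.
exists (`|M| + 1) => [|x xab]; first by rewrite ltr_pwDr.
apply: mrt; first by rewrite (le_lt_trans (ler_norm _))// ltrDl.
by exists x => //=; rewrite in_itv.
Qed.

Lemma rder_lipschitz f (df : R -> R) (a b M : R) :
  (forall x, a <= x <= b -> rder f x (df x)) ->
  (forall x, a <= x <= b -> `|df x| <= M) ->
  forall x y, a <= x -> x <= y -> y <= b -> `|f y - f x| <= M * (y - x).
Proof.
move=> fd dM x y ax xy yb.
have [z /andP[xz zy]|c /andP[xc cy] ->] := @rder_mvt f df x y xy.
  by apply: fd; rewrite (le_trans ax xz) (le_trans zy yb).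
rewrite normrM (@ger0_norm _ (y - x)) ?subr_ge0//.
by rewrite ler_wpM2r ?subr_ge0// dM// (le_trans ax xc) (le_trans cy yb).
Qed.

(** The closure rules for sums, products, exponentials and Lipschitz functions all reduce to this
    comparison of increments. *)
Lemma ac_dominated (a b M : R) (f h g : R -> R) :
  absolutely_continuous a b f -> absolutely_continuous a b h ->
  (forall x y, a <= x -> x <= y -> y <= b ->
     `|g y - g x| <= M * (`|f y - f x| + `|h y - h x|)) ->
  absolutely_continuous a b g.
Proof.
move=> fac hac gfh e e0.
pose M' := `|M| + 1.
have M'0 : 0 < M' by rewrite ltr_pwDr.
have e20 : 0 < e / (2 * M') by rewrite divr_gt0// mulr_gt0.
have [d1 d10 fd] := fac _ e20; have [d2 d20 hd] := hac _ e20.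
exists (Num.min d1 d2); first by rewrite lt_min d10.
move=> n I Iab Iov; rewrite lt_min => /andP[s1 s2].
apply: (@le_lt_trans _ _ (\sum_(k < n) M' * (`|f (I k).2 - f (I k).1| + `|h (I k).2 - h (I k).1|))).
  apply: ler_sum => k _; have [ak [kk kb]] := Iab k.
  apply: le_trans (gfh _ _ ak kk kb) _; rewrite ler_wpM2r ?addr_ge0//.
  by rewrite (le_trans (ler_norm _))// lerDl.
rewrite -mulr_sumr big_split/=.
have := fd n I Iab Iov s1; have := hd n I Iab Iov s2 => hh ff.
have -> : e = M' * (e / (2 * M') + e / (2 * M')) by field; rewrite gt_eqF.
by rewrite ltr_pM2l// ltrD.
Qed.

Lemma ac_id (a b : R) : absolutely_continuous a b (fun x : R => x).
Proof.
move=> e e0; exists e => // n I Iab _; apply: le_lt_trans.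
by apply: ler_sum => k _; have [_ [kk _]] := Iab k; rewrite ger0_norm ?subr_ge0.
Qed.

Lemma acD (a b : R) f g : absolutely_continuous a b f ->
  absolutely_continuous a b g -> absolutely_continuous a b (fun x => f x + g x).
Proof.
move=> fac gac; apply: (ac_dominated (M := 1) fac gac) => x y _ _ _.
by rewrite mul1r opprD addrACA ler_normD.
Qed.

Lemma ac_scale (a b c : R) f : absolutely_continuous a b f ->
  absolutely_continuous a b (fun x => c * f x).
Proof.
move=> fac; apply: (ac_dominated (M := `|c|) fac fac) => x y _ _ _.
by rewrite -mulrBr normrM ler_wpM2l// lerDl.
Qed.

Lemma acN (a b : R) f : absolutely_continuous a b f ->
  absolutely_continuous a b (fun x => - f x).
Proof.
move=> fac; have := ac_scale (- 1) fac.
by congr (absolutely_continuous _ _ _); apply/funext => x; rewrite mulN1r.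
Qed.

Lemma acB (a b : R) f g : absolutely_continuous a b f ->
  absolutely_continuous a b g -> absolutely_continuous a b (fun x => f x - g x).
Proof. by move=> fac gac; apply: acD => //; exact: acN. Qed.

Lemma ac_lipschitz (a b M : R) g :
  (forall x y, a <= x -> x <= y -> y <= b -> `|g y - g x| <= M * (y - x)) ->
  absolutely_continuous a b g.
Proof.
move=> gl; apply: (ac_dominated (M := `|M|) (@ac_id a b) (@ac_id a b)) => x y ax xy yb.
apply: le_trans (gl _ _ ax xy yb) _.
rewrite (@ger0_norm _ (y - x)) ?subr_ge0//; apply: (@le_trans _ _ (`|M| * (y - x))).
  by rewrite ler_wpM2r ?subr_ge0// ler_norm.
by rewrite ler_wpM2l// lerDl subr_ge0.
Qed.

Lemma ac_cst (a b c : R) : absolutely_continuous a b (fun=> c).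
Proof.
apply: (ac_lipschitz (M := 0)) => x y _ _ _.
by rewrite subrr normr0 mul0r.
Qed.

(** On intervals shorter than the [d] belonging to 1 the function varies by less than 1, and
    Cousin's lemma glues the local bounds. *)
Lemma ac_bounded (a b : R) f : absolutely_continuous a b f ->
  exists2 M, 0 < M & forall x, a <= x <= b -> `|f x| <= M.
Proof.
move=> fac; have [ab|ba] := leP a b; last first.
  by exists 1 => // x /andP[ax xb]; have := le_trans ax xb; rewrite leNgt ba.
have [d d0 fd] := fac 1 ltr01.
have fd1 x y : a <= x -> x <= y -> y <= b -> y - x < d -> `|f y - f x| < 1.
  move=> ax xy yb yx; have := fd 1%N (fun=> (x, y)); rewrite !big_ord1/=.
  by apply => // k l; rewrite !ord1.
pose P x y := exists2 M, 0 < M & forall z, x <= z <= y -> `|f z| <= M.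
apply: (@cousin _ a b P) => //.
  move=> x y z ax xy yz zb [M M0 fM] [N N0 fN].
  exists (M + N); first exact: addr_gt0.
  move=> u /andP[xu uz]; have [uy|yu] := leP u y.
    have := fM u; rewrite xu uy => /(_ isT); lra.
  have := fN u; rewrite (ltW yu) uz => /(_ isT); lra.
move=> x /andP[ax xb]; exists d => // y z ay yx xz zb zyd.
exists (`|f x| + 1); first by rewrite ltr_pwDr.
move=> u /andP[yu uz]; rewrite -lerBlDl.
have [ux|xu] := leP u x.
  have := fd1 u x; rewrite ux (le_trans ay yu) xb distrC.
  move=> /(_ isT isT isT ltac:(lra)); have := lerB_dist (f u) (f x); lra.
have := fd1 x u; rewrite ax (ltW xu) (le_trans uz zb).
move=> /(_ isT isT isT ltac:(lra)); have := lerB_dist (f u) (f x); lra.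
Qed.

Lemma acM (a b : R) f g : absolutely_continuous a b f ->
  absolutely_continuous a b g -> absolutely_continuous a b (fun x => f x * g x).
Proof.
move=> fac gac; have [M M0 fM] := ac_bounded fac; have [N N0 gN] := ac_bounded gac.
apply: (ac_dominated (M := M + N) fac gac) => x y ax xy yb.
have -> : f y * g y - f x * g x = (f y - f x) * g y + f x * (g y - g x) by ring.
apply: le_trans (ler_normD _ _) _; rewrite !normrM mulrDr.
have xab : a <= x <= b by rewrite ax (le_trans xy yb).
have yab : a <= y <= b by rewrite yb (le_trans ax xy).
rewrite lerD//.
  by rewrite mulrC ler_wpM2r// (le_trans (gN _ yab))// lerDr ltW.
by rewrite ler_wpM2r// (le_trans (fM _ xab))// lerDl ltW.
Qed.

Lemma ac_rder (a b M : R) f (df : R -> R) :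
  (forall x, a <= x <= b -> rder f x (df x)) ->
  (forall x, a <= x <= b -> `|df x| <= M) -> absolutely_continuous a b f.
Proof. by move=> fd dM; apply: ac_lipschitz; exact: rder_lipschitz fd dM. Qed.

Lemma ac_expR (a b : R) f : absolutely_continuous a b f ->
  absolutely_continuous a b (fun x => expR (f x)).
Proof.
move=> fac; have [M M0 fM] := ac_bounded fac.
have eL (u v : R) : - M <= u -> u <= v -> v <= M ->
    `|expR v - expR u| <= expR M * (v - u) :> R.
  apply: (@rder_lipschitz expR expR) => z; first by move=> _; exact: is_derive_expR.
  by move=> /andP[_ zM]; rewrite ger0_norm ?expR_ge0// ler_expR.
apply: (ac_dominated (M := expR M) fac fac) => x y ax xy yb.
have xab : a <= x <= b by rewrite ax (le_trans xy yb).
have yab : a <= y <= b by rewrite yb (le_trans ax xy).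
have /[1!ler_norml]/andP[x1 x2] := fM _ xab.
have /[1!ler_norml]/andP[y1 y2] := fM _ yab.
have [fxy|fyx] := leP (f x) (f y).
  apply: (le_trans (eL _ _ x1 fxy y2)).
  by rewrite ler_wpM2l ?expR_ge0// -[leLHS]addr0 lerD// ler_norm.
rewrite distrC; apply: (le_trans (eL _ _ y1 (ltW fyx) x2)).
by rewrite ler_wpM2l ?expR_ge0// -[leLHS]addr0 lerD// distrC ler_norm.
Qed.

End rder_rules.

Lemma primitive_exists (R : realType) (g : R -> R) : continuous g ->
  exists G : R -> R, G 0 = 0 /\ forall x, rder G x (g x).
Proof.
move=> gc; pose mu := @lebesgue_measure R.
have gi (a b : R) : mu.-integrable `[a, b] (EFin \o g).
  apply: continuous_compact_integrable; first exact: segment_compact.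
  exact: continuous_subspaceT.
pose I a x := \int[mu]_(t in `[a, x]) g t.
have Id a x : a < x -> rder (I a) x (g x).
  move=> ax; have [|d1 d2] := @continuous_FTC1_closed _ g a x (x + 1) _ (gi _ _) ax (gc x).
    by rewrite ltrDl.
  by apply: DeriveDef => //; rewrite -derive1E.
have Isub (a b x y : R) : a < b -> a < 0 -> b < 0 -> b < x -> b < y -> x <= y ->
    I a y - I a x = I b y - I b x.
  move=> ab a0 b0 bx by_ xy.
  have h (z : R) : x <= z <= y -> rder (fun t => I a t - I b t) z (g z - g z).
    move=> /andP[xz zy]; apply: rderB; apply: Id; lra.
  have [c _] := rder_mvt xy h; rewrite subrr mul0r => /eqP.
  by rewrite subr_eq0 => /eqP; lra.
(* Differentiation of the integral is available to the right of its base point only, so the base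
   point moves with [x]. By [Isub] the difference of two values does not depend on it. *)
pose G (x : R) := I (- `|x| - 1) x - I (- `|x| - 1) 0.
exists G; split=> [|x]; first by rewrite /G subrr.
pose a := - `|x| - 2.
have n0 : 0 <= `|x| by [].
have xa : a < x.
  by have := ler_norm (- x); rewrite normrN /a; lra.
apply: (@rder_near _ (fun t => I a t - I a 0) _ _ _ 1 ltr01); last first.
  by rewrite -[g x]subr0; apply: rderB; [exact: Id|exact: rder_cst].
move=> y yx; rewrite /G.
have yn : `|y| < `|x| + 1 by have := ler_normD (y - x) x; rewrite subrK; lra.
have y0 : 0 <= `|y| by [].
have ya : - `|y| - 1 < y by have := ler_norm (- y); rewrite normrN; lra.
have [y_ge0|y_lt0] := leP 0 y.
  by apply: Isub; rewrite /a; lra.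
apply: oppr_inj; rewrite !opprB.
by apply: Isub; rewrite /a; lra.
Qed.

Lemma ae_imply_lebesgue (R : realType) (P Q : R -> Prop) :
  (forall x, P x -> Q x) ->
  {ae (@lebesgue_measure R), forall x, P x} ->
  {ae (@lebesgue_measure R), forall x, Q x}.
Proof. by move=> PQ; apply: (@filterS _ _ (ae_filter_ringOfSetsType _)). Qed.

Lemma ae_and_lebesgue (R : realType) (P Q : R -> Prop) :
  {ae (@lebesgue_measure R), forall x, P x} ->
  {ae (@lebesgue_measure R), forall x, Q x} ->
  {ae (@lebesgue_measure R), forall x, P x /\ Q x}.
Proof. exact: (@filterI _ _ (ae_filter_ringOfSetsType _)). Qed.

(** The passage from almost everywhere to everywhere: [ac_le], applied to [f - G] and to its
    negative for a primitive [G] of [g], shows that [f - G] is constant. *)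
Lemma ac_ae_rder (R : realType) (f g : R -> R) :
  locally_absolutely_continuous f -> continuous g ->
  {ae (@lebesgue_measure R), forall z : R, rder f z (g z)} ->
  forall z, rder f z (g z).
Proof.
move=> fac gc fg; have [G [_ GE]] := primitive_exists gc.
suff fG (a b : R) : a <= b -> f b - G b = f a - G a.
  move=> z; apply: (@rder_ext _ (fun t => G t + (f 0 - G 0))); last first.
    by rewrite -[g z]addr0; apply: rderD => //; exact: rder_cst.
  by move=> t; have [t0|/ltW t0] := leP 0 t; [rewrite -(fG _ _ t0)|rewrite (fG _ _ t0)]; ring.
move=> ab.
have GA : absolutely_continuous a b G.
  have [M M0 gM] := continuous_bounded_itv a b gc.
  by apply: (ac_rder (M := M) (df := g)) => // x.
apply/eqP; rewrite eq_le; apply/andP; split.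
  apply: (ac_le (f := fun x => f x - G x)) => //; first exact: acB.
  apply: ae_imply_lebesgue fg => z fz _; exists 0 => //.
  by rewrite -(subrr (g z)); exact: rderB.
rewrite -lerN2; apply: (ac_le (f := fun x => - (f x - G x))) => //.
  by apply: acN; exact: acB.
apply: ae_imply_lebesgue fg => z fz _; exists 0 => //.
by rewrite -oppr0 -(subrr (g z)); apply: rderN; exact: rderB.
Qed.

(** * Integrable functions *)

Definition caratheodory_R (R : realType) := caratheodory_type (@wlength R idfun)^*%mu.

(** A set of the completed algebra is the union of a Borel set and a subset of a Borel null set [F];
    without [F] only a Borel set is left. *)
Lemma completed_measurable_borel (R : realType) (A : set R) :
  measurable (A : set (caratheodory_R R)) ->
  exists F : set R, [/\ measurable (F : set (measurableTypeR R)),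
    lebesgue_measure (F : set (measurableTypeR R)) = 0%E &
    measurable (A `\` F : set (measurableTypeR R))].
Proof.
move=> mA.
have [X mX [M [F [mF F0 MF]] XA]] : completed_algebra_gen (@lebesgue_measure R) A.
  by rewrite -g_sigma_completed_algebra_genE completed_caratheodory_measurable.
exists F; split=> //.
rewrite -XA.
have -> : (X `|` M) `\` F = X `\` F.
  apply/seteqP; split=> z; last by move=> [Xz Fz]; split => //; left.
  by move=> [[Xz|/MF]] Fz.
exact: measurableD.
Qed.

(** Measurability needs only the superlevel sets at rational levels, so it suffices to discard the
    union of countably many null sets, one for each level. *)
Lemma completed_integrable_borel (R : realType) (D : set R) (p : R -> R) :
  measurable (D : set (measurableTypeR R)) -> Lebesgue_integrable D p ->
  exists F : set R, [/\ measurable (F : set (measurableTypeR R)),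
    lebesgue_measure (F : set (measurableTypeR R)) = 0%E &
    (@lebesgue_measure R).-integrable (D `\` F) (EFin \o p)].
Proof.
move=> mD /integrableP[/measurable_EFinP mp pfin].
pose q n : R := ratr (odflt 0 (unpickle n)).
pose A n : set R := D `&` p @^-1` `]q n, +oo[.
have mA n : measurable (A n : set (caratheodory_R R)).
  by apply: mp; [exact: sub_caratheodory|exact: measurable_itv].
pose F n := projT1 (cid (completed_measurable_borel (mA n))).
have FP n : [/\ measurable (F n : set (measurableTypeR R)),
    lebesgue_measure (F n : set (measurableTypeR R)) = 0%E &
    measurable (A n `\` F n : set (measurableTypeR R))].
  by rewrite /F; case: cid.
have mF : measurable (\bigcup_n F n : set (measurableTypeR R)).
  by apply: bigcupT_measurable => n; have [] := FP n.
have mE : measurable (D `\` \bigcup_n F n : set (measurableTypeR R)) by exact: measurableD.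
have mpE : measurable_fun (D `\` \bigcup_n F n : set (measurableTypeR R)) p.
  apply: (measurability _ (RGenOInfty.measurableE R)) => // _ [_ [r ->] <-].
  have -> : (D `\` \bigcup_n F n) `&` p @^-1` `]r, +oo[%classic =
      \bigcup_(n in [set n | r < q n]) ((A n `\` F n) `\` \bigcup_n F n).
    apply/seteqP; split=> z.
      move=> [[Dz Fz] /=]; rewrite in_itv/= andbT => rp.
      have [x] := rat_in_itvoo rp; rewrite in_itv/= => /andP[rx xp].
      exists (pickle x); first by rewrite /= /q pickleK.
      split=> //; split; last by move=> Fxz; apply: Fz; exists (pickle x).
      by split => //=; rewrite /q pickleK/= in_itv/= andbT.
    move=> [n /= rn [[[Dz /=]]]]; rewrite in_itv/= andbT => qp _ Fz.
    by split => //=; rewrite in_itv/= andbT (lt_trans rn qp).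
  apply: bigcup_measurable => n _; apply: measurableD => //.
  by have [] := FP n.
exists (\bigcup_n F n); split => //.
  apply: (proj1 (@negligibleP _ _ _ (@lebesgue_measure R) _ mF)). apply: negligible_bigcup => n.
  by have [mFn Fn0 _] := FP n; exists (F n); split.
apply/integrableP; split; first exact/measurable_EFinP.
apply: le_lt_trans pfin.
(* Lebesgue measure is the image of its completion under the identity, which is measurable towards
   the smaller Borel algebra; thus the finite integral carries over. *)
pose cm := @completed_lebesgue_measure R.
have mid : measurable_fun [set: caratheodory_R R] (fun x : caratheodory_R R => x : measurableTypeR R).
  by move=> _ B mB; rewrite setTI; exact: sub_caratheodory.
have := ge0_integral_pushforward mid cm mE (f := abse \o (EFin \o p)).
have mabs : measurable_fun (D `\` \bigcup_n F n : set (measurableTypeR R)) (abse \o (EFin \o p)).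
  by apply: measurableT_comp => //; exact/measurable_EFinP.
move=> /(_ mabs) h.
have {}h := h (fun _ _ => abse_ge0 _).
rewrite [leLHS](h : _ = _).
apply: ge0_subset_integral => //.
- exact: sub_caratheodory.
- exact: sub_caratheodory.
- apply: (@measurableT_comp _ _ _ _ _ _ abse) => //.
  by apply: (@measurableT_comp _ _ _ _ _ _ (@EFin R)).
- by move=> x _; exact: abse_ge0.
- exact: subDsetl.
Qed.

Lemma Rintegral_EFin (R : realType) (A : set R) (f : R -> R) :
  measurable (A : set (measurableTypeR R)) ->
  (@lebesgue_measure R).-integrable A (EFin \o f) ->
  (\int[@lebesgue_measure R]_(x in A) f x)%:E =
  (\int[@lebesgue_measure R]_(x in A) (f x)%:E)%E.
Proof. by move=> mA fi; rewrite /Rintegral fineK//; exact: integrable_fin_num. Qed.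

(** [V] is the integral from minus infinity. Its absolute continuity is that of the integral as a
    function of the set, applied to unions of half-open intervals; its derivative is Lebesgue
    differentiation. *)
Lemma integral_ac (R : realType) (f : R -> R) :
  (@lebesgue_measure R).-integrable setT (EFin \o f) -> (forall x, 0 <= f x) ->
  exists V : R -> R, [/\ forall a b, absolutely_continuous a b V,
    {ae (@lebesgue_measure R), forall x : R, rder V x (f x)} &
    forall x y, x <= y -> V y - V x = \int[@lebesgue_measure R]_(t in `]x, y]) f t].
Proof.
move=> fi f0; pose mu := @lebesgue_measure R.
have fiS (A : set R) : measurable (A : set (measurableTypeR R)) -> mu.-integrable A (EFin \o f).
  by move=> mA; exact: integrableS fi.
pose V x := \int[mu]_(t in `]-oo, x]) f t.
have VB x y : x <= y -> V y - V x = \int[mu]_(t in `]x, y]) f t.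
  by move=> xy; apply: Rintegral_itvB => //; exact: fiS.
exists V; split=> //.
- move=> a b e e0; have [d [d0 fd]] := integral_normr_continuous fi e0.
  exists d => // n I Iab Iov sd.
  pose A (k : 'I_n) : set R := `](I k).1, (I k).2]%classic.
  have mA k : measurable (A k : set (measurableTypeR R)) by exact: measurable_itv.
  have tA : trivIset [set: 'I_n] A.
    apply/trivIsetP => k l _ _ kl; apply/seteqP; split=> // z [].
    rewrite /A /= !in_itv/= => /andP[k1 k2] /andP[l1 l2].
    by have [kl'|kl'] := Iov _ _ kl; lra.
  pose D := \big[setU/set0]_(k < n) A k.
  have mD : measurable (D : set (measurableTypeR R)) by exact: bigsetU_measurable.
  have muD : (mu D < d%:E)%E.
    rewrite [ltLHS](@measure_semi_additive_ord _ _ _ mu n A mA tA mD).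
    rewrite (eq_bigr (fun k => ((I k).2 - (I k).1)%:E)).
      by rewrite sumEFin lte_fin.
    move=> k _; rewrite /A [LHS]lebesgue_measure_itv/= lte_fin.
    have [_ [kk _]] := Iab k.
    by case: ltP => // kk'; congr (_%:E); lra.
  have := fd D mD muD.
  under eq_Rintegral do rewrite ger0_norm//.
  rewrite -!lte_fin Rintegral_EFin//; last exact: fiS.
  rewrite [ltLHS](@ge0_integral_bigsetU _ _ _ mu _ A (EFin \o f) (index_enum 'I_n) mA).
  - apply: le_lt_trans; rewrite -sumEFin; apply: lee_sum => k _.
    have [_ [kk _]] := Iab k.
    rewrite ger0_norm VB//; last by apply: Rintegral_ge0.
    by rewrite Rintegral_EFin//; exact: fiS.
  - exact: index_enum_uniq.
  - by apply: sub_trivIset tA.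
  - by have /integrableP[] := fiS D mD.
  - by move=> x _; rewrite lee_fin.
- have := @FTC1Ny R f (fun y => fiS _ (measurable_itv _)).
  move=> /(_ (open_integrable_locally openT fi)).
  apply: ae_imply_lebesgue => x [d1 d2]; apply: DeriveDef => //.
  by rewrite -derive1E.
Qed.

(** [h] is the Steklov mean of [g] over [[x, x + r]], where [r] comes from uniform continuity,
    itself an application of Cousin's lemma. *)
Lemma rder_steklov (R : realType) (g : R -> R) (e : R) (b : R) :
  continuous g -> 0 < e -> 0 <= b ->
  exists h dh : R -> R, [/\ forall x, rder h x (dh x), continuous dh &
    forall x, 0 <= x <= b -> `|g x - h x| <= e].
Proof.
move=> gc e0 b0; have [G [_ GE]] := primitive_exists gc.
have [r r0 gr] : exists2 r, 0 < r & forall x y, 0 <= x <= b -> x <= y -> y <= x + r ->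
    `|g x - g y| <= e.
  apply: (@cousin _ 0 b (fun c d => exists2 r, 0 < r &
      forall x y, c <= x <= d -> x <= y -> y <= x + r -> `|g x - g y| <= e)) => //.
    move=> x y z _ xy yz _ [r1 r10 g1] [r2 r20 g2].
    exists (Num.min r1 r2); first by rewrite lt_min r10.
    move=> u v /andP[xu uz] uv vr.
    have vr1 : v <= u + r1 by rewrite (le_trans vr)// lerD2l ge_min lexx.
    have vr2 : v <= u + r2 by rewrite (le_trans vr)// lerD2l ge_min lexx orbT.
    have [uy|/ltW yu] := leP u y; first by apply: g1; rewrite ?xu.
    by apply: g2; rewrite ?yu.
  move=> x _; have /cvgrPdist_le /(_ (e / 2)) := gc x.
  rewrite divr_gt0// => /(_ isT) [r /= r0 gr].
  exists (r / 2); first by rewrite divr_gt0.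
  move=> c d _ cx xd _ dc; exists (r / 2); first by rewrite divr_gt0.
  move=> u v /andP[cu ud] uv vu.
  have gu := gr u; have gv := gr v; rewrite /ball_/= in gu gv.
  have -> : g u - g v = (g x - g v) - (g x - g u) by ring.
  apply: le_trans (ler_normB _ _) _; rewrite [leRHS](splitr e) lerD//.
    by apply: gv; rewrite ltr_norml; lra.
  by apply: gu; rewrite ltr_norml; lra.
exists (fun x => r^-1 * (G (x + r) - G x)), (fun x => r^-1 * (g (x + r) - g x)).
split.
- move=> x.
  have Gr : rder (fun t => G (t + r)) x (g (x + r)).
    rewrite -[g (x + r)]mulr1; apply: (@rder_comp _ G (fun t => t + r)) => //.
    by rewrite -[1]addr0; apply: rderD; [exact: rder_id|exact: rder_cst].
  have := rderM (rder_cst r^-1 x) (rderB Gr (GE x)).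
  by rewrite mul0r add0r.
- move=> x; apply: cvgM; first exact: cvg_cst.
  apply: cvgB; last exact: gc.
  apply: (@continuous_comp _ _ _ (fun t => t + r) g); last exact: gc.
  by apply: cvgD; [exact: cvg_id|exact: cvg_cst].
- move=> x xb.
  have [|c /andP[xc cr] ->] := @rder_mvt R G g x (x + r) _ (fun x _ => GE x).
    by rewrite lerDl ltW.
  have -> : r^-1 * (g c * (x + r - x)) = g c by field; rewrite gt_eqF.
  exact: gr.
Qed.

(** The L1 error is recorded through [V], the indefinite integral of [|p - h|], because the later
    Gronwall argument needs an absolutely continuous weight with a derivative almost everywhere. *)
Lemma l1_approx (R : realType) (p : R -> R) (b e : R) : 0 < b ->
  Lebesgue_integrable `[0, b[ p -> 0 < e ->
  exists h dh V : R -> R, [/\ forall x, rder h x (dh x), continuous dh,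
    forall x y, absolutely_continuous x y V, V b - V 0 <= e &
    {ae (@lebesgue_measure R), forall x : R, 0 < x < b -> exists2 v, rder V x v &
      `|p x - h x| <= v}].
Proof.
move=> b0 pL e0; pose mu := @lebesgue_measure R.
have [F [mF F0 pF]] := completed_integrable_borel (measurable_itv _) pL.
pose E := `[0, b[%classic `\` F.
have mE : measurable (E : set (measurableTypeR R)) by exact: measurableD.
have muE : (mu E <= b%:E)%E.
  have <- : mu `[0, b[%classic = b%:E.
    by rewrite [LHS]lebesgue_measure_itv/= lte_fin b0 -EFinB subr0.
  by apply: le_measure; rewrite ?inE//; exact: subDsetl.
have [|g [gc gi]] := approximation_continuous_integrable mE _ pF.
  by apply: le_lt_trans muE _; rewrite ltry.
move=> /fine_cvgP[_ /cvgrPdist_lt /(_ (e / 2))].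
rewrite divr_gt0// => /(_ isT)[N _ /(_ N (leqnn N))].
rewrite /= sub0r normrN => gN.
(* A uniform error [e / (2 * b)] integrates to at most [e / 2] over an interval of length [b]; the
   other half of [e] is the L1 distance from [p] to [g N]. *)
have [|h [dh [hd dhc gh]]] := @rder_steklov R (g N) (e / (2 * b)) b (gc N) _ (ltW b0).
  by rewrite divr_gt0// mulr_gt0.
pose f (x : R) : R := if x \in E then `|p x - h x| else 0.
have hc : continuous h by move=> x; exact: rder_continuous (hd x).
have hi : mu.-integrable E (EFin \o h).
  apply: (@integrableS _ _ _ mu `[0, b]%classic) => //.
    by move=> x [/=]; rewrite !in_itv/= => /andP[-> /ltW ->].
  apply: continuous_compact_integrable; first exact: segment_compact.
  exact: continuous_subspaceT.
have phi : mu.-integrable E (EFin \o (fun x => `|p x - h x|)).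
  have := integrable_abse (integrableB mE pF hi).
  by apply: eq_integrable => // x _ /=; rewrite -EFinB.
have fi : mu.-integrable setT (EFin \o f).
  have := (@integrable_mkcond _ _ _ mu E (EFin \o (fun x => `|p x - h x|)) mE).1 phi.
  by apply: eq_integrable => // x _ /=; rewrite /patch /f; case: ifP.
have f0 x : 0 <= f x by rewrite /f; case: ifP.
have [V [Vac Vd VB]] := integral_ac fi f0.
exists h, dh, V; split=> //; last first.
  have FN : {ae mu, forall x : R, ~ F x}.
    by exists F; split => // x /= /contrapT.
  have := ae_and_lebesgue FN Vd; apply: ae_imply_lebesgue => x [Fx Vx] /andP[x0 xb].
  exists (f x) => //; rewrite /f mem_set//; split => //=.
  by rewrite in_itv/= ltW.
rewrite VB ?(ltW b0)// -lee_fin Rintegral_EFin//; last exact: integrableS fi.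
have mabs (A : set R) : measurable (A : set (measurableTypeR R)) -> measurable_fun A (EFin \o f).
  by move=> mA; have /integrableP[] := integrableS measurableT mA (@subsetT _ A) fi.
apply: (@le_trans _ _ (\int[mu]_(x in setT) (f x)%:E)%E).
  apply: ge0_subset_integral => //; first exact: mabs.
  by move=> x _; rewrite lee_fin.
rewrite (_ : \int[mu]_(x in setT) (f x)%:E = \int[mu]_(x in E) `|p x - h x|%:E)%E; last first.
  rewrite [RHS]integral_mkcond; apply: eq_integral => x _.
  by rewrite patchE /f; case: ifP.
have pg : mu.-integrable E (EFin \o (fun x => `|p x - g N x|)).
  have := integrable_abse (integrableB mE pF (gi N)).
  by apply: eq_integrable => // x _ /=; rewrite -EFinB.
have fmu : (mu E < +oo)%E by apply: le_lt_trans muE _; rewrite ltry.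
have ci : mu.-integrable E (EFin \o cst (e / (2 * b))).
  apply: measurable_bounded_integrable => //.
  by exists `|e / (2 * b)|; split; rewrite ?num_real// => M eM x _ /=; exact: ltW.
apply: (@le_trans _ _ (\int[mu]_(x in E) (`|p x - g N x|%:E + (e / (2 * b))%:E))%E).
  apply: le_integral => //.
    by have := integrableD mE pg ci.
  move=> x; rewrite inE => -[/=]; rewrite in_itv/= => /andP[x0 xb] _.
  rewrite lee_fin; have := gh x; rewrite x0 (ltW xb) => /(_ isT).
  have -> : p x - h x = (p x - g N x) + (g N x - h x) by ring.
  by have := ler_normD (p x - g N x) (g N x - h x); lra.
rewrite (integralD mE pg ci).
rewrite [X in (_ + X <= _)%E](_ : _ = (e / (2 * b))%:E * mu E)%E; last first.
  by rewrite -integral_cst.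
have e_split : e = e / 2 + e / (2 * b) * b by field; rewrite gt_eqF.
rewrite [leRHS](_ : _ = (e / 2)%:E + (e / (2 * b) * b)%:E)%E; last first.
  by rewrite -EFinD -e_split.
rewrite leeD//; last first.
  rewrite [leRHS]EFinM; apply: lee_pmul => //; rewrite lee_fin.
  by apply/ltW/divr_gt0 => //; exact: mulr_gt0.
have := integrable_fin_num mE pg => /fineK <-.
by rewrite lee_fin; apply: ltW; apply: le_lt_trans gN; exact: ler_norm.
Qed.

(** * Complex-valued functions and matrices of a real variable *)

(** The modulus as an element of [R]; the norm of [R[i]] takes its values in [R[i]]. *)
Local Notation nC := ComplexField.Normc.normc.

Section complex_basics.
Variable R : realType.
Implicit Types x y : R[i].

Lemma ReD x y : complex.Re (x + y) = complex.Re x + complex.Re y.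
Proof. by case: x; case: y. Qed.
Lemma ImD x y : complex.Im (x + y) = complex.Im x + complex.Im y.
Proof. by case: x; case: y. Qed.
Lemma ReN x : complex.Re (- x) = - complex.Re x.
Proof. by case: x. Qed.
Lemma ImN x : complex.Im (- x) = - complex.Im x.
Proof. by case: x. Qed.
Lemma ReM x y : complex.Re (x * y) =
  complex.Re x * complex.Re y - complex.Im x * complex.Im y.
Proof. by case: x; case: y. Qed.
Lemma ImM x y : complex.Im (x * y) =
  complex.Re x * complex.Im y + complex.Im x * complex.Re y.
Proof. by case: x; case: y. Qed.
Lemma ReJ x : complex.Re (conjc x) = complex.Re x.
Proof. by case: x. Qed.
Lemma ImJ x : complex.Im (conjc x) = - complex.Im x.
Proof. by case: x. Qed.

Definition ReImE := (ReD, ImD, ReN, ImN, ReM, ImM, ReJ, ImJ).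

Lemma complexP x y : complex.Re x = complex.Re y -> complex.Im x = complex.Im y ->
  x = y.
Proof. by case: x; case: y => a b c d /= -> ->. Qed.

Lemma normrC x : `|x| = (nC x)%:C.
Proof. by []. Qed.

Lemma nC_ge0 x : 0 <= nC x.
Proof. by case: x => a b; rewrite /= sqrtr_ge0. Qed.

Lemma nC_eq0 x : (nC x == 0) = (x == 0).
Proof.
apply/eqP/eqP => [/ComplexField.Normc.eq0_normc //|->].
exact: ComplexField.Normc.normc0.
Qed.

Lemma nC_gt0 x : (0 < nC x) = (x != 0).
Proof. by rewrite lt_neqAle nC_ge0 andbT eq_sym nC_eq0. Qed.

Lemma nC0 : nC (0 : R[i]) = 0. Proof. exact: ComplexField.Normc.normc0. Qed.
Lemma nC1 : nC (1 : R[i]) = 1. Proof. exact: ComplexField.Normc.normc1. Qed.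

Lemma nCM x y : nC (x * y) = nC x * nC y. Proof. exact: ComplexField.Normc.normcM. Qed.
Lemma nCV x : nC x^-1 = (nC x)^-1. Proof. exact: ComplexField.Normc.normcV. Qed.

Lemma nCX x n : nC (x ^+ n) = nC x ^+ n.
Proof.
elim: n => [|n IH]; first by rewrite !expr0 nC1.
by rewrite !exprS nCM IH.
Qed.

Lemma nCD x y : nC (x + y) <= nC x + nC y. Proof. exact: le_normcD. Qed.
Lemma nCN x : nC (- x) = nC x. Proof. exact: normcN. Qed.

Lemma nCB x y : nC (x - y) <= nC x + nC y.
Proof. by rewrite -[nC y]nCN; exact: nCD. Qed.

Lemma nC_dist x y : nC x - nC y <= nC (x - y).
Proof. by rewrite lerBlDr -{1}[x](subrK y) nCD. Qed.

Lemma nC_sqr x : nC x ^+ 2 = complex.Re x ^+ 2 + complex.Im x ^+ 2.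
Proof. by case: x => a b /=; rewrite sqr_sqrtr// addr_ge0// sqr_ge0. Qed.

Lemma nCJ x : nC (conjc x) = nC x.
Proof. by case: x => a b /=; rewrite sqrrN. Qed.

Lemma nC_real (r : R) : nC (r%:C) = `|r|.
Proof. by rewrite /= expr0n addr0 sqrtr_sqr. Qed.

Lemma nC_Re x : `|complex.Re x| <= nC x.
Proof.
by rewrite -(@ler_pXn2r _ 2) ?nnegrE ?nC_ge0// nC_sqr real_normK ?num_real// lerDl sqr_ge0.
Qed.

Lemma nC_Im x : `|complex.Im x| <= nC x.
Proof.
by rewrite -(@ler_pXn2r _ 2) ?nnegrE ?nC_ge0// nC_sqr real_normK ?num_real// lerDr sqr_ge0.
Qed.

Lemma nC_le x : nC x <= `|complex.Re x| + `|complex.Im x|.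
Proof.
rewrite -(@ler_pXn2r _ 2) ?nnegrE ?nC_ge0 ?addr_ge0// nC_sqr.
rewrite sqrrD !real_normK ?num_real//.
have := mulr_ge0 (normr_ge0 (complex.Re x)) (normr_ge0 (complex.Im x)); lra.
Qed.

Lemma nC_sum (I : Type) (r : seq I) (F : I -> R[i]) :
  nC (\sum_(i <- r) F i) <= \sum_(i <- r) nC (F i).
Proof.
elim: r => [|a r IH]; first by rewrite !big_nil nC0.
by rewrite !big_cons (le_trans (nCD _ _))// lerD2l.
Qed.

End complex_basics.

Definition cder (R : realType) (f : R -> R[i]) (x : R) (d : R[i]) :=
  rder (fun t => complex.Re (f t)) x (complex.Re d) /\
  rder (fun t => complex.Im (f t)) x (complex.Im d).

Definition cac (R : realType) (f : R -> R[i]) :=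
  locally_absolutely_continuous (fun t => complex.Re (f t)) /\
  locally_absolutely_continuous (fun t => complex.Im (f t)).

Definition ccont (R : realType) (f : R -> R[i]) :=
  continuous (fun t => complex.Re (f t)) /\ continuous (fun t => complex.Im (f t)).

Lemma ac_continuous (R : realType) (f : R -> R) :
  locally_absolutely_continuous f -> continuous f.
Proof.
move=> fac x; apply/cvgrPdist_lt => /= e e0.
have [d d0 fd] := fac (x - 1) (x + 1) e e0.
have fd1 u v : x - 1 <= u -> u <= v -> v <= x + 1 -> v - u < d -> `|f v - f u| < e.
  move=> ax xy yb yx; have := fd 1%N (fun=> (u, v)); rewrite !big_ord1/=.
  by apply => // k l; rewrite !ord1.
exists (Num.min 1 d); first by rewrite /= lt_min ltr01.
move=> y /=; rewrite lt_min => /andP[]; have [xy|/ltW yx] := leP x y.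
  rewrite distrC ger0_norm ?subr_ge0// => h1 h2.
  by rewrite distrC; apply: fd1 => //; lra.
by rewrite ger0_norm ?subr_ge0// => h1 h2; apply: fd1 => //; lra.
Qed.

Section cder_rules.
Variable R : realType.
Implicit Types (f g : R -> R[i]) (x : R) (c a b : R[i]).

Lemma cder_cst c x : cder (fun=> c) x 0.
Proof. by split; exact: rder_cst. Qed.

Lemma cderD f g x a b : cder f x a -> cder g x b ->
  cder (fun t => f t + g t) x (a + b).
Proof.
move=> [f1 f2] [g1 g2]; split; rewrite !ReImE.
  by apply: rder_ext (rderD f1 g1) => t; rewrite ReImE.
by apply: rder_ext (rderD f2 g2) => t; rewrite ReImE.
Qed.

Lemma cderN f x a : cder f x a -> cder (fun t => - f t) x (- a).
Proof.
move=> [f1 f2]; split; rewrite !ReImE.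
  by apply: rder_ext (rderN f1) => t; rewrite ReImE.
by apply: rder_ext (rderN f2) => t; rewrite ReImE.
Qed.

Lemma cderB f g x a b : cder f x a -> cder g x b ->
  cder (fun t => f t - g t) x (a - b).
Proof. by move=> fa gb; apply: cderD => //; exact: cderN. Qed.

Lemma cderM f g x a b : cder f x a -> cder g x b ->
  cder (fun t => f t * g t) x (a * g x + f x * b).
Proof.
move=> [f1 f2] [g1 g2]; split; rewrite !ReImE.
  apply: (@rder_ext _ (fun t => complex.Re (f t) * complex.Re (g t) - complex.Im (f t) * complex.Im (g t))).
    by move=> t; rewrite ReImE.
  have := rderB (rderM f1 g1) (rderM f2 g2).
  by congr rder; ring.
apply: (@rder_ext _ (fun t => complex.Re (f t) * complex.Im (g t) + complex.Im (f t) * complex.Re (g t))).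
  by move=> t; rewrite ReImE.
have := rderD (rderM f1 g2) (rderM f2 g1).
by congr rder; ring.
Qed.

Lemma cderZ c f x a : cder f x a -> cder (fun t => c * f t) x (c * a).
Proof. by move=> fa; have := cderM (cder_cst c x) fa; rewrite mul0r add0r. Qed.

Lemma cder_conj f x a : cder f x a -> cder (fun t => conjc (f t)) x (conjc a).
Proof.
move=> [f1 f2]; split; rewrite !ReImE.
  by apply: rder_ext f1 => t; rewrite ReImE.
by apply: rder_ext (rderN f2) => t; rewrite ReImE.
Qed.

Lemma cder_sum (I : Type) (r : seq I) (F : I -> R -> R[i]) (D : I -> R[i]) x :
  (forall i, cder (F i) x (D i)) ->
  cder (fun t => \sum_(i <- r) F i t) x (\sum_(i <- r) D i).
Proof.
move=> FD; elim: r => [|i r IH].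
  rewrite big_nil; have -> : (fun t => \sum_(i <- [::]) F i t) = (fun=> 0).
    by apply/funext => t; rewrite big_nil.
  exact: cder_cst.
rewrite big_cons.
have -> : (fun t => \sum_(j <- i :: r) F j t) = (fun t => F i t + \sum_(j <- r) F j t).
  by apply/funext => t; rewrite big_cons.
exact: cderD.
Qed.

Lemma cac_cst c : cac (fun=> c).
Proof. by split=> a b; exact: ac_cst. Qed.

Lemma cacD f g : cac f -> cac g -> cac (fun t => f t + g t).
Proof.
move=> [f1 f2] [g1 g2]; split=> a b.
  by under eq_fun do rewrite ReImE; exact: (acD (f1 a b) (g1 a b)).
by under eq_fun do rewrite ReImE; exact: (acD (f2 a b) (g2 a b)).
Qed.

Lemma cacM f g : cac f -> cac g -> cac (fun t => f t * g t).
Proof.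
move=> [f1 f2] [g1 g2]; split=> a b.
  under eq_fun do rewrite ReImE.
  exact: (acB (acM (f1 a b) (g1 a b)) (acM (f2 a b) (g2 a b))).
under eq_fun do rewrite ReImE.
exact: (acD (acM (f1 a b) (g2 a b)) (acM (f2 a b) (g1 a b))).
Qed.

Lemma cac_conj f : cac f -> cac (fun t => conjc (f t)).
Proof.
move=> [f1 f2]; split=> a b.
  by under eq_fun do rewrite ReImE; exact: f1.
by under eq_fun do rewrite ReImE; exact: (acN (f2 a b)).
Qed.

Lemma cac_sum (I : Type) (r : seq I) (F : I -> R -> R[i]) :
  (forall i, cac (F i)) -> cac (fun t => \sum_(i <- r) F i t).
Proof.
move=> FD; elim: r => [|i r IH].
  have -> : (fun t => \sum_(i <- [::]) F i t) = (fun=> 0).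
    by apply/funext => t; rewrite big_nil.
  exact: cac_cst.
have -> : (fun t => \sum_(j <- i :: r) F j t) = (fun t => F i t + \sum_(j <- r) F j t).
  by apply/funext => t; rewrite big_cons.
exact: cacD.
Qed.

Lemma ccont_cst c : ccont (fun _ : R => c).
Proof. by split=> t; exact: cvg_cst. Qed.

Lemma ccontD f g : ccont f -> ccont g -> ccont (fun t => f t + g t).
Proof.
move=> [f1 f2] [g1 g2]; split=> t.
  by under eq_fun do rewrite ReImE; apply: cvgD; [exact: f1|exact: g1].
by under eq_fun do rewrite ReImE; apply: cvgD; [exact: f2|exact: g2].
Qed.

Lemma ccontM f g : ccont f -> ccont g -> ccont (fun t => f t * g t).
Proof.
move=> [f1 f2] [g1 g2]; split=> t.
  under eq_fun do rewrite ReImE; apply: cvgB; apply: cvgM;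
    [exact: f1|exact: g1|exact: f2|exact: g2].
under eq_fun do rewrite ReImE; apply: cvgD; apply: cvgM;
  [exact: f1|exact: g2|exact: f2|exact: g1].
Qed.

Lemma ccont_sum (I : Type) (r : seq I) (F : I -> R -> R[i]) :
  (forall i, ccont (F i)) -> ccont (fun t => \sum_(i <- r) F i t).
Proof.
move=> FD; elim: r => [|i r IH].
  have -> : (fun t => \sum_(i <- [::]) F i t) = (fun=> 0).
    by apply/funext => t; rewrite big_nil.
  exact: ccont_cst.
have -> : (fun t => \sum_(j <- i :: r) F j t) = (fun t => F i t + \sum_(j <- r) F j t).
  by apply/funext => t; rewrite big_cons.
exact: ccontD.
Qed.

Lemma cac_ccont f : cac f -> ccont f.
Proof. by move=> [f1 f2]; split; exact: ac_continuous. Qed.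

Lemma rder0_cst (f : R -> R) : (forall x, rder f x 0) -> forall x, f x = f 0.
Proof.
move=> fd x; apply/eqP; rewrite -subr_eq0; apply/eqP.
have [x0|/ltW x0] := leP 0 x.
  by have [c _ ->] := rder_mvt x0 (fun x _ => fd x); rewrite mul0r.
apply: oppr_inj; rewrite opprB oppr0.
by have [c _ ->] := rder_mvt x0 (fun x _ => fd x); rewrite mul0r.
Qed.

Lemma cder0_cst f : (forall x, cder f x 0) -> forall x, f x = f 0.
Proof.
move=> fd x; apply: complexP.
  by apply: (rder0_cst (f := fun t => complex.Re (f t))) => y; case: (fd y).
by apply: (rder0_cst (f := fun t => complex.Im (f t))) => y; case: (fd y).
Qed.

Lemma cder_ccont f (df : R -> R[i]) : (forall x, cder f x (df x)) -> ccont f.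
Proof.
by move=> fd; split=> x; have [f1 f2] := fd x; [exact: rder_continuous f1|exact: rder_continuous f2].
Qed.

End cder_rules.

Definition mder (R : realType) (n : nat) (Y : R -> 'M[R[i]]_n) (z : R) (D : 'M[R[i]]_n) :=
  forall i j, cder (fun t => Y t i j) z (D i j).
Definition mac (R : realType) (n : nat) (Y : R -> 'M[R[i]]_n) :=
  forall i j, cac (fun t => Y t i j).
Definition mcont (R : realType) (n : nat) (Y : R -> 'M[R[i]]_n) :=
  forall i j, ccont (fun t => Y t i j).

Section mder_rules.
Variables (R : realType) (n : nat).
Implicit Types (Y Z : R -> 'M[R[i]]_n) (A B D : 'M[R[i]]_n).

Lemma mder_ext Y Z z D : Y =1 Z -> mder Y z D -> mder Z z D.
Proof. by move=> /funext ->. Qed.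

Lemma mder_cst A z : mder (fun=> A) z 0.
Proof. by move=> i j; rewrite mxE; exact: cder_cst. Qed.

Lemma mderD Y Z z A B : mder Y z A -> mder Z z B ->
  mder (fun t => Y t + Z t) z (A + B).
Proof.
move=> YA ZB i j; rewrite mxE; under eq_fun do rewrite mxE.
by apply: cderD; [exact: YA|exact: ZB].
Qed.

Lemma mderN Y z A : mder Y z A -> mder (fun t => - Y t) z (- A).
Proof.
move=> YA i j; rewrite mxE; under eq_fun do rewrite mxE.
by apply: cderN; exact: YA.
Qed.

Lemma mderB Y Z z A B : mder Y z A -> mder Z z B ->
  mder (fun t => Y t - Z t) z (A - B).
Proof. by move=> YA ZB; apply: mderD => //; exact: mderN. Qed.

Lemma mderM Y Z z A B : mder Y z A -> mder Z z B ->
  mder (fun t => Y t *m Z t) z (A *m Z z + Y z *m B).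
Proof.
move=> YA ZB i j; rewrite !mxE -big_split/=; under eq_fun do rewrite mxE.
by apply: cder_sum => k; apply: cderM; [exact: YA|exact: ZB].
Qed.

Lemma mderMl A Y z D : mder Y z D -> mder (fun t => A *m Y t) z (A *m D).
Proof. by move=> YD; have := mderM (mder_cst A z) YD; rewrite mul0mx add0r. Qed.

Lemma mderMr A Y z D : mder Y z D -> mder (fun t => Y t *m A) z (D *m A).
Proof. by move=> YD; have := mderM YD (mder_cst A z); rewrite mulmx0 addr0. Qed.

Lemma mderZ (c : R[i]) Y z D : mder Y z D -> mder (fun t => c *: Y t) z (c *: D).
Proof.
move=> YA i j; rewrite mxE; under eq_fun do rewrite mxE.
by apply: cderZ; exact: YA.
Qed.

Lemma mder_tr Y z D : mder Y z D -> mder (fun t => (Y t)^T) z D^T.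
Proof. by move=> YA i j; rewrite mxE; under eq_fun do rewrite mxE; exact: YA. Qed.

Lemma mder_conj Y z D : mder Y z D ->
  mder (fun t => map_mx conjc (Y t)) z (map_mx conjc D).
Proof.
move=> YA i j; rewrite mxE; under eq_fun do rewrite mxE.
by apply: cder_conj; exact: YA.
Qed.

Lemma mac_cst A : mac (fun _ : R => A).
Proof. by move=> i j; exact: cac_cst. Qed.

Lemma macM Y Z : mac Y -> mac Z -> mac (fun t => Y t *m Z t).
Proof.
move=> YA ZB i j; under eq_fun do rewrite mxE.
by apply: cac_sum => k; apply: cacM; [exact: YA|exact: ZB].
Qed.

Lemma mac_tr Y : mac Y -> mac (fun t => (Y t)^T).
Proof. by move=> YA i j; under eq_fun do rewrite mxE; exact: YA. Qed.

Lemma mac_conj Y : mac Y -> mac (fun t => map_mx conjc (Y t)).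
Proof. by move=> YA i j; under eq_fun do rewrite mxE; apply: cac_conj; exact: YA. Qed.

Lemma mcont_cst A : mcont (fun _ : R => A).
Proof. by move=> i j; exact: ccont_cst. Qed.

Lemma mcontM Y Z : mcont Y -> mcont Z -> mcont (fun t => Y t *m Z t).
Proof.
move=> YA ZB i j; under eq_fun do rewrite mxE.
by apply: ccont_sum => k; apply: ccontM; [exact: YA|exact: ZB].
Qed.

Lemma mcontZ (c : R[i]) Y : mcont Y -> mcont (fun t => c *: Y t).
Proof.
move=> YA i j; under eq_fun do rewrite mxE.
by apply: ccontM; [exact: ccont_cst|exact: YA].
Qed.

Lemma mcont_tr Y : mcont Y -> mcont (fun t => (Y t)^T).
Proof. by move=> YA i j; under eq_fun do rewrite mxE; exact: YA. Qed.

Lemma mac_mcont Y : mac Y -> mcont Y.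
Proof. by move=> YA i j; exact: cac_ccont. Qed.

Lemma mder_mcont Y (D : R -> 'M[R[i]]_n) : (forall z, mder Y z (D z)) -> mcont Y.
Proof.
by move=> YD i j; apply: (@cder_ccont R _ (fun z => D z i j)) => z; exact: YD.
Qed.

Lemma mder_mac Y (D : R -> 'M[R[i]]_n) : (forall z, mder Y z (D z)) -> mcont D ->
  mac Y.
Proof.
move=> YD Dc i j; split=> x y.
  have [M _ DM] := continuous_bounded_itv x y (Dc i j).1.
  apply: (ac_rder (M := M) (df := fun t => complex.Re (D t i j))) => // t _.
  by have [] := YD t i j.
have [M _ DM] := continuous_bounded_itv x y (Dc i j).2.
apply: (ac_rder (M := M) (df := fun t => complex.Im (D t i j))) => // t _.
by have [] := YD t i j.
Qed.

Lemma mac_ae_mder Y (D : R -> 'M[R[i]]_n) : mac Y -> mcont D ->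
  {ae (@lebesgue_measure R), forall z : R, mder Y z (D z)} ->
  forall z, mder Y z (D z).
Proof.
move=> YA DC YD z i j; have [Y1 Y2] := YA i j; have [D1 D2] := DC i j.
split.
  by apply: (ac_ae_rder Y1 D1); apply: ae_imply_lebesgue YD => x /(_ i j)[].
by apply: (ac_ae_rder Y2 D2); apply: ae_imply_lebesgue YD => x /(_ i j)[].
Qed.

Lemma mder0_cst Y : (forall z, mder Y z 0) -> forall z, Y z = Y 0.
Proof.
move=> Y0 z; apply/matrixP => i j; apply: (cder0_cst (f := fun t => Y t i j)) => x.
by have := Y0 x i j; rewrite mxE.
Qed.

Lemma mprimitive_exists Y : mcont Y ->
  exists P : R -> 'M[R[i]]_n, P 0 = 0 /\ forall z, mder P z (Y z).
Proof.
move=> Yc.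
have F1 ij : {G : R -> R | G 0 = 0 /\ forall x, rder G x (complex.Re (Y x ij.1 ij.2))}.
  by apply: cid; apply: primitive_exists; have [] := Yc ij.1 ij.2.
have F2 ij : {G : R -> R | G 0 = 0 /\ forall x, rder G x (complex.Im (Y x ij.1 ij.2))}.
  by apply: cid; apply: primitive_exists; have [] := Yc ij.1 ij.2.
exists (fun z => \matrix_(i, j) (sval (F1 (i, j)) z +i* sval (F2 (i, j)) z)%C).
split=> [|z i j].
  apply/matrixP => i j; rewrite !mxE.
  by case: (F1 _) => /= f [-> _]; case: (F2 _) => /= g [-> _].
split; under eq_fun do rewrite mxE /=.
  by case: (F1 _) => /= f [_].
by case: (F2 _) => /= f [_].
Qed.

End mder_rules.

(** * Two-by-two matrices by entries *)

Section mx2_lemmas.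
Variable K : comNzRingType.
Implicit Types (a b c d : K) (A B : 'M[K]_2).

Lemma big_ord2 (V : nmodType) (F : 'I_2 -> V) : \sum_(i < 2) F i = F 0 + F 1.
Proof. by rewrite big_ord_recl big_ord1; congr (_ + F _); exact: val_inj. Qed.

Lemma ord2_ind (P : 'I_2 -> Prop) : P 0 -> P 1 -> forall i, P i.
Proof.
move=> P0 P1 [[|[|//]] i2].
  by rewrite (_ : Ordinal i2 = 0)//; exact: val_inj.
by rewrite (_ : Ordinal i2 = 1)//; exact: val_inj.
Qed.

Lemma mx2E A : A = mx2 (A 0 0) (A 0 1) (A 1 0) (A 1 1).
Proof.
apply/matrixP => i j; rewrite mxE.
by move: i; apply: ord2_ind; move: j; apply: ord2_ind.
Qed.

Lemma mx2_00 a b c d : mx2 a b c d 0 0 = a. Proof. by rewrite mxE. Qed.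
Lemma mx2_01 a b c d : mx2 a b c d 0 1 = b. Proof. by rewrite mxE. Qed.
Lemma mx2_10 a b c d : mx2 a b c d 1 0 = c. Proof. by rewrite mxE. Qed.
Lemma mx2_11 a b c d : mx2 a b c d 1 1 = d. Proof. by rewrite mxE. Qed.
Definition mx2_ij := (mx2_00, mx2_01, mx2_10, mx2_11).

Lemma mx2P A B : A 0 0 = B 0 0 -> A 0 1 = B 0 1 -> A 1 0 = B 1 0 -> A 1 1 = B 1 1 ->
  A = B.
Proof. by move=> h1 h2 h3 h4; rewrite (mx2E A) (mx2E B) h1 h2 h3 h4. Qed.

Lemma mul2E A B i j : (A *m B) i j = A i 0 * B 0 j + A i 1 * B 1 j.
Proof. by rewrite mxE big_ord2. Qed.

Lemma one2E : ((1%:M : 'M[K]_2) 0 0 = 1) * ((1%:M : 'M[K]_2) 0 1 = 0) *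
  ((1%:M : 'M[K]_2) 1 0 = 0) * ((1%:M : 'M[K]_2) 1 1 = 1).
Proof. by rewrite !mxE. Qed.

Lemma tr2E A : \tr A = A 0 0 + A 1 1.
Proof. by rewrite /mxtrace big_ord2. Qed.

End mx2_lemmas.

(** * Matrix norms and energy estimates *)

Section matrix_norms.
Variables (R : realType) (n : nat).
Implicit Types (A B X Y : 'M[R[i]]_n).

(** [mnorm] is submultiplicative and measures coefficients. Solutions are measured by the squared
    Frobenius norm [fro2], which is differentiable; its derivative is twice the real inner product
    [ip] with the derivative of the matrix. *)
Definition mnorm A : R := \sum_i \sum_j nC (A i j).
Definition fro2 A : R := \sum_i \sum_j nC (A i j) ^+ 2.
Definition ip A B : R := \sum_i \sum_j
  (complex.Re (A i j) * complex.Re (B i j) + complex.Im (A i j) * complex.Im (B i j)).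

Lemma mnorm_ge0 A : 0 <= mnorm A.
Proof. by apply: sumr_ge0 => i _; apply: sumr_ge0 => j _; exact: nC_ge0. Qed.

Lemma fro2_ge0 A : 0 <= fro2 A.
Proof. by apply: sumr_ge0 => i _; apply: sumr_ge0 => j _; exact: sqr_ge0. Qed.

Lemma fro2_entry A i j : nC (A i j) ^+ 2 <= fro2 A.
Proof.
rewrite /fro2 (bigD1 i)//= (bigD1 j)//= -addrA lerDl addr_ge0//.
  by apply: sumr_ge0 => k _; exact: sqr_ge0.
by apply: sumr_ge0 => k _; apply: sumr_ge0 => l _; exact: sqr_ge0.
Qed.

Lemma mnorm_entry A i j : nC (A i j) <= mnorm A.
Proof.
rewrite /mnorm (bigD1 i)//= (bigD1 j)//= -addrA lerDl addr_ge0//.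
  by apply: sumr_ge0 => k _; exact: nC_ge0.
by apply: sumr_ge0 => k _; apply: sumr_ge0 => l _; exact: nC_ge0.
Qed.

Lemma fro2_0 : fro2 0 = 0.
Proof. by apply: big1 => i _; apply: big1 => j _; rewrite mxE nC0 expr0n. Qed.

Lemma fro2N A : fro2 (- A) = fro2 A.
Proof. by apply: eq_bigr => i _; apply: eq_bigr => j _; rewrite mxE nCN. Qed.

Lemma fro2_eq0 A : fro2 A = 0 -> A = 0.
Proof.
move=> A0; apply/matrixP => i j; rewrite mxE.
apply/eqP; rewrite -nC_eq0 -sqrf_eq0 eq_le sqr_ge0 andbT.
by rewrite -A0; exact: fro2_entry.
Qed.

Lemma mnormD A B : mnorm (A + B) <= mnorm A + mnorm B.
Proof.
rewrite /mnorm -big_split/=; apply: ler_sum => i _.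
by rewrite -big_split/=; apply: ler_sum => j _; rewrite mxE nCD.
Qed.

Lemma mnormN A : mnorm (- A) = mnorm A.
Proof. by apply: eq_bigr => i _; apply: eq_bigr => j _; rewrite mxE nCN. Qed.

Lemma mnormB A B : mnorm (A - B) <= mnorm A + mnorm B.
Proof. by rewrite -[mnorm B]mnormN; exact: mnormD. Qed.

Lemma mnormZ (c : R[i]) A : mnorm (c *: A) = nC c * mnorm A.
Proof.
rewrite mulr_sumr; apply: eq_bigr => i _; rewrite mulr_sumr.
by apply: eq_bigr => j _; rewrite mxE nCM.
Qed.

Lemma mnorm_tr A : mnorm A^T = mnorm A.
Proof.
rewrite /mnorm exchange_big/=; apply: eq_bigr => i _.
by apply: eq_bigr => j _; rewrite mxE.
Qed.

Lemma mnormM A B : mnorm (A *m B) <= mnorm A * mnorm B.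
Proof.
apply: (@le_trans _ _ (\sum_i \sum_j \sum_k nC (A i k) * nC (B k j))).
  apply: ler_sum => i _; apply: ler_sum => j _; rewrite mxE.
  by apply: le_trans (nC_sum _ _) _; apply: ler_sum => k _; rewrite nCM.
rewrite /mnorm mulr_suml; apply: ler_sum => i _.
rewrite exchange_big/= mulr_suml; apply: ler_sum => k _.
rewrite -mulr_sumr; apply: ler_wpM2l; first exact: nC_ge0.
rewrite [leRHS](bigD1 k)//= lerDl; apply: sumr_ge0 => l _.
by apply: sumr_ge0 => m _; exact: nC_ge0.
Qed.

Lemma fro2_mnorm A : fro2 A <= mnorm A ^+ 2.
Proof.
rewrite expr2 {1}/mnorm mulr_suml; apply: ler_sum => i _.
rewrite mulr_suml; apply: ler_sum => j _; rewrite expr2.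
by apply: ler_wpM2l; [exact: nC_ge0|exact: mnorm_entry].
Qed.

Lemma ipD X A B : ip X (A + B) = ip X A + ip X B.
Proof.
rewrite /ip -big_split/=; apply: eq_bigr => i _; rewrite -big_split/=.
by apply: eq_bigr => j _; rewrite mxE !ReImE; ring.
Qed.

Lemma rder_fro2 (Y : R -> 'M[R[i]]_n) z D : mder Y z D ->
  rder (fun t => fro2 (Y t)) z (2 * ip (Y z) D).
Proof.
move=> YD; rewrite mulr_sumr.
have rder_sum (I : Type) (r : seq I) (F : I -> R -> R) (d : I -> R) :
    (forall i, rder (F i) z (d i)) ->
    rder (fun t => \sum_(i <- r) F i t) z (\sum_(i <- r) d i).
  move=> Fd; elim: r => [|i r IH].
    rewrite big_nil; apply: (rder_ext _ (rder_cst 0 z)) => t.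
    by rewrite big_nil.
  rewrite big_cons; apply: (rder_ext _ (rderD (Fd i) IH)) => t.
  by rewrite big_cons.
apply: (rder_sum) => i; rewrite mulr_sumr; apply: (rder_sum) => j.
have [h1 h2] := YD i j.
apply: (rder_ext (f := fun t => complex.Re (Y t i j) * complex.Re (Y t i j) +
    complex.Im (Y t i j) * complex.Im (Y t i j))).
  by move=> t; rewrite nC_sqr !expr2.
have := rderD (rderM h1 h1) (rderM h2 h2).
by congr rder; ring.
Qed.

(** Entrywise [x y <= (x^2 + y^2) / 2]. The right side is linear in [fro2], as Gronwall's inequality
    requires. *)
Lemma ip_mulmx X A Y : `|ip X (A *m Y)| <= mnorm A * ((fro2 X + fro2 Y) / 2).
Proof.
apply: (@le_trans _ _ (\sum_i \sum_j \sum_k nC (A i k) * ((nC (X i j) ^+ 2 + nC (Y k j) ^+ 2) / 2))).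
  apply: le_trans (ler_norm_sum _ _ _) _; apply: ler_sum => i _.
  apply: le_trans (ler_norm_sum _ _ _) _; apply: ler_sum => j _.
  set w := (A *m Y) i j.
  have -> : complex.Re (X i j) * complex.Re w + complex.Im (X i j) * complex.Im w =
      complex.Re (conjc (X i j) * w) by rewrite !ReImE; ring.
  apply: le_trans (nC_Re _) _; rewrite nCM nCJ /w mxE.
  apply: (@le_trans _ _ (nC (X i j) * \sum_k nC (A i k) * nC (Y k j))).
    apply: ler_wpM2l; first exact: nC_ge0.
    by apply: le_trans (nC_sum _ _) _; apply: ler_sum => k _; rewrite nCM.
  rewrite mulr_sumr; apply: ler_sum => k _.
  rewrite mulrCA; apply: ler_wpM2l; first exact: nC_ge0.
  by have := sqr_ge0 (nC (X i j) - nC (Y k j)); rewrite sqrrB; lra.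
rewrite /mnorm mulr_suml; apply: ler_sum => i _.
rewrite exchange_big/= mulr_suml; apply: ler_sum => k _.
rewrite -mulr_sumr; apply: ler_wpM2l; first exact: nC_ge0.
rewrite -mulr_suml ler_wpM2r ?invr_ge0// big_split/= lerD//.
  rewrite [leRHS](bigD1 i)//= lerDl; apply: sumr_ge0 => l _.
  by apply: sumr_ge0 => m _; exact: sqr_ge0.
rewrite [leRHS](bigD1 k)//= lerDl; apply: sumr_ge0 => l _.
by apply: sumr_ge0 => m _; exact: sqr_ge0.
Qed.

End matrix_norms.

(** * Wronskian identities for the Dirac system *)

Section dirac.
Variable R : realType.
Notation C := R[i].
Notation J := (Jmx R).

Lemma J2 : J *m J = - 1%:M.
Proof. by apply: mx2P; rewrite mul2E !mx2_ij !mxE/=; ring. Qed.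

Lemma JT : J^T = - J.
Proof. by apply: mx2P; rewrite !mxE/= ?opprK ?oppr0. Qed.

Lemma mnorm_J : mnorm J = 2.
Proof. by rewrite /mnorm !big_ord2 !mx2_ij nC0 nCN nC1; ring. Qed.

Lemma fro2_1 : fro2 (1%:M : 'M[C]_2) = 2.
Proof. by rewrite /fro2 !big_ord2 !one2E nC0 nC1; ring. Qed.

Lemma mnorm_sqr (A : 'M[C]_2) : mnorm A ^+ 2 <= 4 * fro2 A.
Proof.
rewrite /mnorm /fro2 !big_ord2.
set a := nC _; set b := nC _; set c := nC _; set d := nC _.
have := sqr_ge0 (a - b); have := sqr_ge0 (a - c); have := sqr_ge0 (a - d).
have := sqr_ge0 (b - c); have := sqr_ge0 (b - d); have := sqr_ge0 (c - d).
rewrite !expr2; lra.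
Qed.

Lemma fro2M (A B : 'M[C]_2) : fro2 (A *m B) <= 16 * (fro2 A * fro2 B).
Proof.
apply: (le_trans (fro2_mnorm _)).
apply: (@le_trans _ _ ((mnorm A * mnorm B) ^+ 2)).
  by rewrite ler_pXn2r ?nnegrE ?mulr_ge0 ?mnorm_ge0// mnormM.
rewrite exprMn; apply: (@le_trans _ _ ((4 * fro2 A) * (4 * fro2 B))).
  by apply: ler_pM; rewrite ?sqr_ge0// mnorm_sqr.
by have -> : 4 * fro2 A * (4 * fro2 B) = 16 * (fro2 A * fro2 B) by ring.
Qed.

(* [X^* J X] has purely imaginary trace, so only [Im lambda] matters. *)
Lemma ip_J (lambda : C) (X : 'M[C]_2) :
  `|ip X (- (lambda *: (J *m X)))| <= `|complex.Im lambda| * fro2 X.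
Proof.
rewrite /ip /fro2 !big_ord2 !mxE !big_ord2 !mx2_ij !nC_sqr !ReImE/=.
set a := complex.Re (X 0 0); set b := complex.Im (X 0 0).
set c := complex.Re (X 0 1); set d := complex.Im (X 0 1).
set e := complex.Re (X 1 0); set f := complex.Im (X 1 0).
set g := complex.Re (X 1 1); set h := complex.Im (X 1 1).
set u := complex.Re lambda; set v := complex.Im lambda.
rewrite [X in `|X|](_ : _ = v * (2 * (a * f - b * e) + 2 * (c * h - d * g))); last by ring.
rewrite normrM; apply: ler_wpM2l => //.
rewrite ler_norml; apply/andP; split.
  have := sqr_ge0 (a + f); have := sqr_ge0 (b - e).
  have := sqr_ge0 (c + h); have := sqr_ge0 (d - g).
  rewrite !expr2; lra.
have := sqr_ge0 (a - f); have := sqr_ge0 (b + e).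
have := sqr_ge0 (c - h); have := sqr_ge0 (d + g).
rewrite !expr2; lra.
Qed.

Variables (Q : R -> 'M[C]_2) (p s : R -> R).
Hypothesis Q_canonical : Dirac_canonical_form Q p s.

Lemma Q_sym z : (Q z)^T = Q z.
Proof. by rewrite Q_canonical; apply: mx2P; rewrite !mxE. Qed.

Lemma Q_real z : map_mx conjc (Q z) = Q z.
Proof.
rewrite Q_canonical; apply: mx2P; rewrite !mxE/= ?oppr0//.
by apply: complexP; rewrite /= ?oppr0.
Qed.

Lemma dirac_ode (lambda : C) z (Y D : 'M[C]_2) :
  J *m D + Q z *m Y = lambda *: Y -> D = J *m (Q z *m Y - lambda *: Y).
Proof.
by move=> <-; rewrite opprD addrCA subrr addr0 mulmxN mulmxA J2 mulNmx mul1mx opprK.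
Qed.

Lemma dirac_ae (lambda : C) Y : Dirac_solution Q lambda Y ->
  {ae (@lebesgue_measure R), forall z : R,
     mder Y z (J *m (Q z *m Y z - lambda *: Y z))}.
Proof.
by move=> [_]; apply: ae_imply_lebesgue => z [D YD /dirac_ode <-].
Qed.

(** The two terms with [Q] cancel by its symmetry. What remains is continuous, so that the identity
    holds at every [z] and not just almost everywhere. *)
Lemma wronskian (l1 l2 : C) Y1 Y2 : Dirac_solution Q l1 Y1 -> Dirac_solution Q l2 Y2 ->
  forall z, mder (fun t => (Y1 t)^T *m (J *m Y2 t)) z ((l2 - l1) *: ((Y1 z)^T *m Y2 z)).
Proof.
move=> S1 S2.
have Y1ac : mac Y1 by case: S1.
have Y2ac : mac Y2 by case: S2.
apply: mac_ae_mder.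
- by apply: macM; [exact: mac_tr|apply: macM => //; exact: mac_cst].
- by apply: mcontZ; apply: mcontM; [apply: mcont_tr|]; exact: mac_mcont.
- have := ae_and_lebesgue (dirac_ae S1) (dirac_ae S2).
  apply: ae_imply_lebesgue => z [D1 D2].
  have := mderM (mder_tr D1) (mderMl J D2).
  congr mder.
  have Jmx_mulK (X : 'M[C]_2) : J *m (J *m X) = - X by rewrite mulmxA J2 mulNmx mul1mx.
  rewrite trmx_mul JT mulmxN mulNmx -mulmxA !Jmx_mulK !mulmxN opprK.
  rewrite linearB/= trmx_mul Q_sym linearZ/=.
  rewrite mulmxBl mulmxBr mulmxA -scalemxAl -scalemxAr scalerBl.
  by rewrite opprB addrC addrA subrK.
Qed.

Lemma dirac_conj (l : C) Y : Dirac_solution Q l Y ->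
  Dirac_solution Q (conjc l) (fun t => map_mx conjc (Y t)).
Proof.
move=> [Yac YD]; split; first exact: (mac_conj Yac).
apply: ae_imply_lebesgue YD => z [D YD E].
exists (map_mx conjc D); first exact: (mder_conj YD).
have Jc : map_mx conjc J = J.
  by apply: mx2P; rewrite !mxE/= ?oppr0//; apply: complexP; rewrite /= ?oppr0.
by rewrite -{1}Jc -{1}(Q_real z) -!map_mxM -map_mxD E map_mxZ.
Qed.

Lemma dirac_symp (l : C) Y : Dirac_solution Q l Y -> Y 0 = 1%:M ->
  forall z, (Y z)^T *m (J *m Y z) = J.
Proof.
move=> S Y0 z; have := mder0_cst (Y := fun t => (Y t)^T *m (J *m Y t)) _ z.
rewrite Y0 trmx1 mul1mx mulmx1; apply => t.
by have := wronskian S S t; rewrite subrr scale0r.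
Qed.

(** For real [l] the conjugate of [Y] solves the same equation, so its Wronskian with [Y] is
    constantly [J], like that of [Y] with itself. Cancelling the invertible factor [J Y] identifies
    [Y] with its conjugate. *)
Lemma dirac_symp_conj (l : C) Y : Dirac_solution Q l Y -> Y 0 = 1%:M ->
  complex.Im l = 0 -> forall z, map_mx conjc (Y z) = Y z.
Proof.
move=> S Y0 l0 z; have lJ : conjc l = l by apply: complexP; rewrite !ReImE ?l0 ?oppr0.
have := mder0_cst (Y := fun t => (map_mx conjc (Y t))^T *m (J *m Y t)) _ z.
have oneJ : map_mx conjc (1%:M : 'M[C]_2) = 1%:M by rewrite map_scalar_mx rmorph1.
rewrite Y0 oneJ trmx1 mul1mx mulmx1.
have h t : mder (fun t => (map_mx conjc (Y t))^T *m (J *m Y t)) t 0.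
  by have := wronskian (dirac_conj S) S t; rewrite lJ subrr scale0r.
move=> /(_ h); rewrite -{2}(dirac_symp S Y0 z) => E.
have YJY := dirac_symp S Y0 z.
have inv : (J *m Y z) *m (- (J *m (Y z)^T)) = 1%:M.
  apply: mulmx1C; rewrite mulNmx -mulmxA YJY J2 opprK//.
have := congr1 (mulmx^~ (- (J *m (Y z)^T))) E.
rewrite -[in LHS]mulmxA -[in RHS]mulmxA inv !mulmx1.
by move=> /(congr1 trmx); rewrite !trmxK.
Qed.

Lemma symp_det (A : 'M[C]_2) : A^T *m (J *m A) = J ->
  A 0 0 * A 1 1 - A 0 1 * A 1 0 = 1.
Proof.
move=> /matrixP /(_ 0 1); rewrite !mul2E !mx2_ij ![A^T _ _]mxE => <-; ring.
Qed.

End dirac.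

(** * Analytic dependence on the spectral parameter *)

(** As [1 <= al], the derivative of [m] is at most [al * (m + be)]; hence [m + be] times
    [exp (- al x)] does not increase. *)
Lemma gronwall (R : realType) (m dm : R -> R) (b al be : R) :
  1 <= al -> 0 <= be ->
  (forall x, 0 <= x <= b -> rder m x (dm x)) ->
  (forall x, 0 <= x <= b -> dm x <= al * m x + be) ->
  forall z, 0 <= z <= b -> m z <= (m 0 + be) * expR (al * z).
Proof.
move=> al1 be0 md dmle z /andP[z0 zb].
pose g t := (m t + be) * expR (- (al * t)).
have xb x : 0 <= x <= z -> 0 <= x <= b.
  by move=> /andP[-> xz]; rewrite (le_trans xz zb).
have gd x : 0 <= x <= z ->
    rder g x ((dm x + 0) * expR (- (al * x)) +
              (m x + be) * (expR (- (al * x)) * (- (0 * x + al * 1)))).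
  move=> /xb xz; apply: rderM.
    by apply: rderD; [exact: md|exact: rder_cst].
  apply: (@rder_comp _ expR (fun t => - (al * t))).
    exact: is_derive_expR.
  by apply: rderN; apply: rderM; [exact: rder_cst|exact: rder_id].
have : g z <= g 0.
  apply: rder_le gd _ => // x /xb xz; have := dmle x xz.
  have -> : (dm x + 0) * expR (- (al * x)) + (m x + be) * (expR (- (al * x)) * - (0 * x + al * 1)) =
      expR (- (al * x)) * (dm x - al * m x - al * be) by ring.
  move=> h; apply: mulr_ge0_le0; first exact: expR_ge0.
  have : 0 <= (al - 1) * be by rewrite mulr_ge0// subr_ge0.
  lra.
rewrite /g mulr0 oppr0 expR0 mulr1 expRN ler_pdivrMr ?expR_gt0// => h.
by apply: le_trans h; rewrite lerDl.
Qed.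

Lemma mcont_bounded (R : realType) (n : nat) (Y : R -> 'M[R[i]]_n) (b : R) : mcont Y ->
  exists2 M, 1 <= M & forall z, 0 <= z <= b -> mnorm (Y z) <= M.
Proof.
move=> Yc.
have H i j : {M : R | 0 <= M & forall z, 0 <= z <= b -> nC (Y z i j) <= M}.
  apply: cid2; have [h1 h2] := Yc i j.
  have [M1 M10 h1M] := continuous_bounded_itv 0 b h1.
  have [M2 M20 h2M] := continuous_bounded_itv 0 b h2.
  exists (M1 + M2); first by rewrite addr_ge0// ltW.
  by move=> z zb; apply: (le_trans (nC_le _)); apply: lerD; [exact: h1M|exact: h2M].
exists (1 + \sum_i \sum_j s2val (H i j)).
  by rewrite lerDl; apply: sumr_ge0 => i _; apply: sumr_ge0 => j _; case: (H i j).
move=> z zb; apply: (@le_trans _ _ (\sum_i \sum_j s2val (H i j))); last by rewrite lerDr.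
by apply: ler_sum => i _; apply: ler_sum => j _; case: (H i j) => /= M _; exact.
Qed.

(** Total, with default value [Y], so that the recursion for [Cmx] can be written before the
    continuity of its terms is proved. *)
Definition mprim (R : realType) (n : nat) (Y : R -> 'M[R[i]]_n) : R -> 'M[R[i]]_n :=
  if pselect (mcont Y) is left Yc then sval (cid (mprimitive_exists Yc)) else Y.

Lemma mprimP (R : realType) (n : nat) (Y : R -> 'M[R[i]]_n) : mcont Y ->
  mprim Y 0 = 0 /\ forall z, mder (mprim Y) z (Y z).
Proof. by move=> Yc; rewrite /mprim; case: pselect => // Yc'; case: cid. Qed.

Section taylor.
Variable R : realType.
Notation C := R[i].
Notation J := (Jmx R).
Variables (Q : R -> 'M[C]_2) (p s : R -> R).
Hypothesis Q_canonical : Dirac_canonical_form Q p s.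
Variable Y : C -> R -> 'M[C]_2.
Hypothesis Y_solution : forall l, Dirac_solution Q l (Y l).
Hypothesis Y_initial : forall l, Y l 0 = 1%:M.

Lemma Jmx_mulK (X : 'M[C]_2) : J *m (J *m X) = - X.
Proof. by rewrite mulmxA J2 mulNmx mul1mx. Qed.

(* [Wmx a l] is [(Y a)^-1 * Y l]. It solves the canonical system
   [W' = - (l - a) Kmx a W], whose coefficient is continuous although [Q] is only
   integrable. *)
Definition Kmx a z : 'M[C]_2 := J *m ((Y a z)^T *m Y a z).

Definition Wmx a l z : 'M[C]_2 := - (J *m ((Y a z)^T *m (J *m Y l z))).

(* [Y (a + w) = Y a * sum_k (- w)^k Cmx a k]. *)
Fixpoint Cmx a k : R -> 'M[C]_2 :=
  if k is k'.+1 then mprim (fun z => Kmx a z *m Cmx a k' z) else fun=> 1%:M.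

Lemma Y_mcont l : mcont (Y l).
Proof. by apply: mac_mcont; case: (Y_solution l). Qed.

Lemma Kmx_mcont a : mcont (Kmx a).
Proof.
apply: mcontM; first exact: mcont_cst.
by apply: mcontM; [apply: mcont_tr|]; exact: Y_mcont.
Qed.

Lemma Cmx_mcont a k : mcont (Cmx a k).
Proof.
elim: k => [|k IH] /=; first exact: mcont_cst.
have [_ h] : _ /\ forall z, _ := mprimP (mcontM (Kmx_mcont a) IH).
exact: mder_mcont h.
Qed.

Lemma CmxS a k : Cmx a k.+1 0 = 0 /\
  forall z, mder (Cmx a k.+1) z (Kmx a z *m Cmx a k z).
Proof. exact: mprimP (mcontM (Kmx_mcont a) (Cmx_mcont a k)). Qed.

Lemma Y_inv l z : Y l z *m (- (J *m ((Y l z)^T *m J))) = 1%:M.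
Proof.
apply: mulmx1C; rewrite mulNmx -!mulmxA (dirac_symp Q_canonical (Y_solution l))//.
by rewrite J2 opprK.
Qed.

Lemma WmxE a l z : Y l z = Y a z *m Wmx a l z.
Proof.
by rewrite /Wmx -[LHS]mul1mx -(Y_inv a z) -!mulmxA mulNmx -!mulmxA.
Qed.

Lemma Wmx0 a l : Wmx a l 0 = 1%:M.
Proof. by rewrite /Wmx !Y_initial trmx1 mul1mx mulmx1 J2 opprK. Qed.

Lemma Wmx_der a l z : mder (Wmx a l) z (Kmx a z *m (- (l - a) *: Wmx a l z)).
Proof.
have := mderN (mderMl J (wronskian Q_canonical (Y_solution a) (Y_solution l) z)).
congr mder.
rewrite (WmxE a l z) /Kmx -!scalemxAr scaleNr.
by rewrite !mulmxA.
Qed.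

Lemma Wmx_bound b kap : 1 <= kap -> forall a l, nC (l - a) <= kap ->
  (forall z, 0 <= z <= b -> mnorm (Kmx a z) <= kap) ->
  forall z, 0 <= z <= b -> fro2 (Wmx a l z) <= 2 * expR ((2 * kap * kap) * b).
Proof.
move=> kap1 a l la Kb z zb.
have kap0 : 0 <= kap by lra.
rewrite [X in _ <= X * _](_ : 2 = fro2 (Wmx a l 0) + 0); last first.
  by rewrite Wmx0 fro2_1 addr0.
apply: (@le_trans _ _ ((fro2 (Wmx a l 0) + 0) * expR ((2 * kap * kap) * z))).
  apply: (@gronwall _ (fun t => fro2 (Wmx a l t))
    (fun t => 2 * ip (Wmx a l t) (Kmx a t *m (- (l - a) *: Wmx a l t))) b (2 * kap * kap) 0) => //.
  - by have := mulr_ge0 (_ : 0 <= kap - 1) (_ : 0 <= kap - 1); nra.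
  - by move=> x _; apply: rder_fro2; exact: Wmx_der.
  - move=> x xb; rewrite addr0 -scalemxAr scalemxAl.
    have := ip_mulmx (Wmx a l x) (- (l - a) *: Kmx a x) (Wmx a l x).
    rewrite mnormZ nCN (_ : (fro2 (Wmx a l x) + fro2 (Wmx a l x)) / 2 = fro2 (Wmx a l x)); last by field.
    move=> h.
    have h2 := le_trans (ler_norm _) h.
    have f0 := fro2_ge0 (Wmx a l x).
    apply: (@le_trans _ _ (2 * (nC (l - a) * mnorm (Kmx a x) * fro2 (Wmx a l x)))).
      by rewrite ler_pM2l.
    rewrite -!mulrA ler_pM2l// !mulrA ler_wpM2r//.
    by apply: ler_pM; rewrite ?nC_ge0 ?mnorm_ge0// Kb.
have /andP[z0 zb'] := zb.
apply: ler_wpM2l; first by rewrite addr0 fro2_ge0.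
by rewrite ler_expR ler_wpM2l// !mulr_ge0.
Qed.

(** Uniformity over the disc comes from the single base point 0: [Y a] is [Y 0] times [Wmx 0 a], and
    Gronwall's bound for the latter depends on [a] only through its modulus. *)
Lemma Kmx_bound (b rho : R) : 0 <= b -> exists2 kap, 1 <= kap & forall a, nC a <= rho ->
  (forall z, 0 <= z <= b -> mnorm (Kmx a z) <= kap) /\
  (forall z, 0 <= z <= b -> fro2 (Y a z) <= kap).
Proof.
move=> b0.
have [k1 k11 Kb] := mcont_bounded b (Kmx_mcont 0).
have [k2 k21 Yb] := mcont_bounded b (Y_mcont 0).
pose k3 := k1 + `|rho|.
have k31 : 1 <= k3 by rewrite /k3 (le_trans k11)// lerDl.
pose B := 16 * (k2 ^+ 2 * (2 * expR ((2 * k3 * k3) * b))).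
have B0 : 0 <= B.
  apply: mulr_ge0 => //; apply: mulr_ge0; first exact: sqr_ge0.
  by apply: mulr_ge0 => //; exact: expR_ge0.
have YB a : nC a <= rho -> forall z, 0 <= z <= b -> fro2 (Y a z) <= B.
  move=> ar z zb; rewrite (WmxE 0 a z); apply: (le_trans (fro2M _ _)).
  rewrite ler_pM2l//; apply: ler_pM; rewrite ?fro2_ge0//.
    apply: (le_trans (fro2_mnorm _)).
    by rewrite ler_pXn2r ?nnegrE ?mnorm_ge0 ?Yb//; lra.
  apply: Wmx_bound zb => //.
    by rewrite subr0 (le_trans ar)// (le_trans (ler_norm _))// /k3 lerDr; lra.
  by move=> t tb; rewrite (le_trans (Kb t tb))// /k3 lerDl.
exists (1 + 8 * B).
  by rewrite lerDl mulr_ge0.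
move=> a ar; split=> z zb; last first.
  by apply: (le_trans (YB a ar z zb)); lra.
apply: (le_trans (mnormM _ _)); rewrite mnorm_J.
apply: (@le_trans _ _ (2 * (4 * B))); last by lra.
rewrite ler_pM2l//; apply: (le_trans (mnormM _ _)); rewrite mnorm_tr -expr2.
by apply: (le_trans (mnorm_sqr _)); rewrite ler_pM2l// YB.
Qed.

(** The Taylor coefficient of order [k] of [Y] at the parameter [a], sign included. *)
Definition Amx a k z : 'M[C]_2 := (- 1) ^+ k *: (Y a z *m Cmx a k z).

Lemma Amx0 a z : Amx a 0 z = Y a z.
Proof. by rewrite /Amx expr0 scale1r mulmx1. Qed.

(** The remainder [r (m + 1)] of the series for [Wmx] vanishes at 0, and its derivative is [- w]
    times [Kmx] times [r m]; so Gronwall's inequality gains one factor [w] at each order. The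
    constant is uniform over a disc because the second derivative will be computed from expansions
    at moving centres. *)
Lemma Y_taylor (b rho : R) (n : nat) : 0 <= b ->
  exists2 M, 0 < M & forall a w z, nC a <= rho -> nC w <= 1 -> 0 <= z <= b ->
    forall i j, nC (Y (a + w) z i j - \sum_(k < n) w ^+ k * Amx a k z i j) <= M * nC w ^+ n.
Proof.
move=> b0; have [kap kap1 Hk] := Kmx_bound rho b0.
have kap0 : 0 <= kap by lra.
pose r a w m z := Wmx a (a + w) z - \sum_(k < m) (- w) ^+ k *: Cmx a k z.
have rb m : exists2 M, 0 < M & forall a w z, nC a <= rho -> nC w <= 1 -> 0 <= z <= b ->
    fro2 (r a w m z) <= M * nC w ^+ (2 * m).
  elim: m => [|m [M M0 IH]].
    exists (2 * expR ((2 * kap * kap) * b)); first by rewrite mulr_gt0// expR_gt0.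
    move=> a w z ar w1 zb; rewrite /r big_ord0 subr0 mulr1.
    apply: (@Wmx_bound b kap kap1 a (a + w)) => //; last by have [] := Hk a ar.
    by rewrite addrAC subrr add0r (le_trans w1).
  exists (kap * M * expR (kap * b)).
    by rewrite !mulr_gt0// ?expR_gt0//; lra.
  move=> a w z ar w1 zb; have [Kb _] := Hk a ar.
  have rd x : mder (r a w m.+1) x (Kmx a x *m (- w *: r a w m x)).
    have sd k : mder (fun t => \sum_(j < k) (- w) ^+ j.+1 *: Cmx a j.+1 t) x
        (\sum_(j < k) (- w) ^+ j.+1 *: (Kmx a x *m Cmx a j x)).
      elim: k => [|k IHk].
        rewrite big_ord0; apply: mder_ext (mder_cst 0 x) => t; by rewrite big_ord0.
      rewrite big_ord_recr/=; apply: (mder_ext (Y := fun t => \sum_(j < k) (- w) ^+ j.+1 *: Cmx a j.+1 t + (- w) ^+ k.+1 *: Cmx a k.+1 t)).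
        by move=> t; rewrite [RHS]big_ord_recr.
      by apply: mderD => //; apply: mderZ; have [_] := CmxS a k; exact.
    apply: (mder_ext (Y := fun t => Wmx a (a + w) t - (1%:M + \sum_(j < m) (- w) ^+ j.+1 *: Cmx a j.+1 t))).
      by move=> t; rewrite /r big_ord_recl/= scale1r.
    have := mderB (Wmx_der a (a + w) x) (mderD (mder_cst 1%:M x) (sd m)).
    congr mder; rewrite add0r addrAC subrr add0r.
    rewrite /r scalerBr mulmxBr; congr (_ - _).
    rewrite scaler_sumr mulmx_sumr; apply: eq_bigr => k _.
    by rewrite scalerA -exprS scalemxAr.
  have r0 : r a w m.+1 0 = 0.
    rewrite /r big_ord_recl/= scale1r Wmx0 big1 ?addr0 ?subrr// => k _.
    by rewrite [X in _ *: X](proj1 (CmxS a k)) scaler0.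
  apply: (@le_trans _ _ ((fro2 (r a w m.+1 0) + kap * M * nC w ^+ (2 * m.+1)) * expR (kap * z))).
    apply: (@gronwall _ (fun t => fro2 (r a w m.+1 t))
      (fun t => 2 * ip (r a w m.+1 t) (Kmx a t *m (- w *: r a w m t))) b kap (kap * M * nC w ^+ (2 * m.+1))) => //.
    - by rewrite !mulr_ge0// ?exprn_ge0 ?nC_ge0// ltW.
    - by move=> x _; exact: rder_fro2.
    - move=> x xb.
      have h := le_trans (ler_norm _) (ip_mulmx (r a w m.+1 x) (Kmx a x) (- w *: r a w m x)).
      have fw : fro2 (- w *: r a w m x) = nC w ^+ 2 * fro2 (r a w m x).
        rewrite /fro2 mulr_sumr; apply: eq_bigr => i _; rewrite mulr_sumr.
        by apply: eq_bigr => j _; rewrite mxE nCM nCN exprMn.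
      have h1 := IH a w x ar w1 xb.
      have h2 : fro2 (- w *: r a w m x) <= M * nC w ^+ (2 * m.+1).
        rewrite fw mulnS exprD mulrCA ler_wpM2l ?sqr_ge0//.
      have f0 := fro2_ge0 (r a w m.+1 x).
      have f1 := fro2_ge0 (- w *: r a w m x).
      apply: (@le_trans _ _ (2 * (kap * ((fro2 (r a w m.+1 x) + fro2 (- w *: r a w m x)) / 2)))).
        rewrite ler_pM2l//; apply: (le_trans h); apply: ler_wpM2r; last exact: Kb.
        by rewrite divr_ge0// addr_ge0.
      have : kap * fro2 (- w *: r a w m x) <= kap * (M * nC w ^+ (2 * m.+1)).
        by rewrite ler_wpM2l.
      rewrite mulrA; lra.
  rewrite r0 fro2_0 add0r mulrAC; apply: ler_wpM2r; first by rewrite exprn_ge0 ?nC_ge0.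
  apply: ler_wpM2l; first by rewrite mulr_ge0 // ltW.
  by rewrite ler_expR ler_wpM2l//; case/andP: zb.
have [M M0 rM] := rb n.
exists (Num.sqrt (16 * (kap * M))).
  by rewrite sqrtr_gt0 !mulr_gt0//; lra.
move=> a w z ar w1 zb i j; have [_ Yb] := Hk a ar.
have -> : Y (a + w) z i j - \sum_(k < n) w ^+ k * Amx a k z i j = (Y a z *m r a w n z) i j.
  rewrite /r mulmxBr -WmxE [RHS]mxE [X in _ = _ + X]mxE; congr (_ - _).
  rewrite mulmx_sumr summxE; apply: eq_bigr => k _.
  by rewrite -scalemxAr /Amx !mxE mulrA -exprMn mulrN1.
rewrite -(@ler_pXn2r _ 2) ?nnegrE ?nC_ge0 ?mulr_ge0 ?sqrtr_ge0 ?exprn_ge0 ?nC_ge0//.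
apply: (le_trans (fro2_entry _ _ _)); apply: (le_trans (fro2M _ _)).
rewrite exprMn sqr_sqrtr; last by rewrite !mulr_ge0// ltW.
rewrite -!mulrA ler_pM2l//; apply: ler_pM; rewrite ?fro2_ge0 ?Yb//.
by rewrite -exprM mulnC; exact: rM.
Qed.

End taylor.

(** * Asymptotics for large spectral parameter *)

(** The weight [exp (- 2 nu (t - a))] removes the exponential growth, which the forcing term shares;
    then [fro2 X] so weighted, plus [M], all times [exp (- V)], has a nonpositive derivative almost
    everywhere. *)
Lemma ac_gronwall (R : realType) (n : nat) (a b nu M : R) (X : R -> 'M[R[i]]_n)
    (V : R -> R) : a <= b -> 0 <= M -> mac X -> absolutely_continuous a b V ->
  {ae (@lebesgue_measure R), forall t : R, a < t < b ->
     exists D v, [/\ mder X t D, rder V t v &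
       2 * ip (X t) D <= 2 * nu * fro2 (X t) + v * (fro2 (X t) + M * expR (2 * nu * (t - a)))]} ->
  fro2 (X b) <= ((fro2 (X a) + M) * expR (V b - V a) - M) * expR (2 * nu * (b - a)).
Proof.
move=> ab M0 Xac Vac XV.
pose E t := expR (- (2 * nu * (t - a))).
pose F t := (fro2 (X t) * E t + M) * expR (- V t).
have Ed t : rder E t (- (2 * nu) * E t).
  rewrite [X in rder _ _ X]mulrC; apply: (@rder_comp R expR (fun t => - (2 * nu * (t - a)))).
    exact: is_derive_expR.
  have := rderN (rderM (rder_cst (2 * nu) t) (rderB (rder_id t) (rder_cst a t))).
  by congr rder; ring.
have Eac : absolutely_continuous a b E.
  apply: ac_expR; apply: acN; apply: ac_scale.
  by apply: acB; [exact: ac_id|exact: ac_cst].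
have fac : absolutely_continuous a b (fun t => fro2 (X t)).
  have ac_sum (I : Type) (r : seq I) (G : I -> R -> R) :
      (forall i, absolutely_continuous a b (G i)) ->
      absolutely_continuous a b (fun t => \sum_(i <- r) G i t).
    move=> Gac; elim: r => [|i r IH].
      by under eq_fun do rewrite big_nil; exact: ac_cst.
    by under eq_fun do rewrite big_cons; exact: (acD (Gac i) IH).
  apply: (ac_sum) => i; apply: (ac_sum) => j; have [h1 h2] := Xac i j.
  under eq_fun do rewrite nC_sqr !expr2.
  exact: (acD (acM (h1 a b) (h1 a b)) (acM (h2 a b) (h2 a b))).
have : F b <= F a.
  apply: ac_le => //.
    apply: acM; last by apply: ac_expR; exact: acN.
    by apply: acD; [exact: acM|exact: ac_cst].
  apply: ae_imply_lebesgue XV => t h tab; have [D [v [XD Vv ineq]]] := h tab.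
  have Vd : rder (fun t => expR (- V t)) t (- v * expR (- V t)).
    rewrite [X in rder _ _ X]mulrC; apply: (@rder_comp R expR (fun t => - V t)) => //.
      exact: is_derive_expR.
    exact: rderN.
  have Fd := rderM (rderD (rderM (rder_fro2 XD) (Ed t)) (rder_cst M t)) Vd.
  eexists; first exact: Fd.
  rewrite [X in X <= 0](_ : _ = expR (- V t) * E t * (2 * ip (X t) D - 2 * nu * fro2 (X t) -
      v * (fro2 (X t) + M * (E t)^-1))); last first.
    by field; rewrite gt_eqF// expR_gt0.
  apply: mulr_ge0_le0; first by rewrite mulr_ge0// expR_ge0.
  by rewrite /E expRN invrK; lra.
rewrite /F /E subrr mulr0 oppr0 expR0 mulr1.
rewrite (expRN (V b)) ler_pdivrMr ?expR_gt0// -[_ * expR (- V a) * _]mulrA -expRD [- V a + _]addrC => h.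
have e0 := expR_gt0 (2 * nu * (b - a)).
by rewrite -ler_pdivrMr// -expRN lerBrDr.
Qed.

(** * Complex trigonometric functions and the unperturbed solution *)

Section complex_trig.
Variable R : realType.
Notation C := R[i].
Notation J := (Jmx R).

Definition ch (y : R) : R := (expR y + expR (- y)) / 2.
Definition sh (y : R) : R := (expR y - expR (- y)) / 2.

Definition ccos (w : C) : C :=
  (cos (complex.Re w) * ch (complex.Im w) +i* - (sin (complex.Re w) * sh (complex.Im w)))%C.
Definition csin (w : C) : C :=
  (sin (complex.Re w) * ch (complex.Im w) +i* (cos (complex.Re w) * sh (complex.Im w)))%C.
(** This is [exp (- w J)], so that [rot (l * t)] solves the system with [Q = 0]. *)
Definition rot (w : C) : 'M[C]_2 := mx2 (ccos w) (- csin w) (csin w) (ccos w).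

Lemma ch_sh y : ch y ^+ 2 - sh y ^+ 2 = 1.
Proof.
rewrite /ch /sh; have e1 : expR y * expR (- y) = 1 by rewrite -expRD subrr expR0.
by rewrite -[RHS]e1; field.
Qed.

Lemma rder_expRN (y : R) : rder (fun t => expR (- t)) y (- expR (- y)).
Proof.
rewrite -mulrN1; apply: (@rder_comp R expR (fun t => - t)).
  exact: is_derive_expR.
exact: rderN (rder_id y).
Qed.

Lemma rder_ch (y : R) : rder ch y (sh y).
Proof.
have := rderM (rderD (is_derive_expR y) (rder_expRN y)) (rder_cst (2^-1) y).
by rewrite mulr0 addr0.
Qed.

Lemma rder_sh (y : R) : rder sh y (ch y).
Proof.
have := rderM (rderB (is_derive_expR y) (rder_expRN y)) (rder_cst (2^-1) y).
by rewrite mulr0 addr0 opprK.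
Qed.

Lemma ccos_csin w : ccos w ^+ 2 + csin w ^+ 2 = 1.
Proof.
have h1 := ch_sh (complex.Im w); have h2 := cos2Dsin2 (complex.Re w).
apply: complexP; rewrite !expr2 !ReImE /=.
  set c := cos _ in h2 *; set s := sin _ in h2 *; set u := ch _ in h1 *; set v := sh _ in h1 *.
  rewrite [LHS](_ : _ = (c ^+ 2 + s ^+ 2) * (u ^+ 2 - v ^+ 2)); last by ring.
  by rewrite h1 h2 mulr1.
ring.
Qed.

Lemma nC_csin w : nC (csin w) ^+ 2 = sin (complex.Re w) ^+ 2 + sh (complex.Im w) ^+ 2.
Proof.
have h1 := ch_sh (complex.Im w); have h2 := cos2Dsin2 (complex.Re w).
rewrite nC_sqr /csin /=.
set c := cos _ in h2 *; set s := sin _ in h2 *; set u := ch _ in h1 *; set v := sh _ in h1 *.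
rewrite [LHS](_ : _ = s ^+ 2 * (u ^+ 2 - v ^+ 2) + (c ^+ 2 + s ^+ 2) * v ^+ 2); last by ring.
by rewrite h1 h2 mulr1 mul1r.
Qed.

Lemma nC_ccos w : nC (ccos w) ^+ 2 = cos (complex.Re w) ^+ 2 + sh (complex.Im w) ^+ 2.
Proof.
have h1 := ch_sh (complex.Im w); have h2 := cos2Dsin2 (complex.Re w).
rewrite nC_sqr /ccos /=.
set c := cos _ in h2 *; set s := sin _ in h2 *; set u := ch _ in h1 *; set v := sh _ in h1 *.
rewrite [LHS](_ : _ = c ^+ 2 * (u ^+ 2 - v ^+ 2) + (c ^+ 2 + s ^+ 2) * v ^+ 2); last by ring.
by rewrite h1 h2 mulr1 mul1r.
Qed.

Lemma ch_le y : ch y <= expR `|y|.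
Proof.
have h1 : expR y <= expR `|y| by rewrite ler_expR ler_norm.
have h2 : expR (- y) <= expR `|y| by rewrite ler_expR -normrN ler_norm.
by rewrite /ch; lra.
Qed.

Lemma ch_gt0 y : 0 < ch y.
Proof. by rewrite divr_gt0// addr_gt0// expR_gt0. Qed.

Lemma sh_sqr_le y : sh y ^+ 2 + 1 <= expR (2 * `|y|).
Proof.
have -> : sh y ^+ 2 + 1 = ch y ^+ 2 by have := ch_sh y; lra.
have -> : expR (2 * `|y|) = expR `|y| ^+ 2 by rewrite -expRM_natl.
by rewrite ler_pXn2r ?nnegrE ?expR_ge0 ?ch_le// ltW// ch_gt0.
Qed.

Lemma nC_csin_le w : nC (csin w) ^+ 2 <= expR (2 * `|complex.Im w|).
Proof.
rewrite nC_csin; apply: le_trans (sh_sqr_le _); rewrite addrC lerD2l.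
by have := cos2Dsin2 (complex.Re w); have := sqr_ge0 (cos (complex.Re w)); lra.
Qed.

Lemma nC_ccos_le w : nC (ccos w) ^+ 2 <= expR (2 * `|complex.Im w|).
Proof.
rewrite nC_ccos; apply: le_trans (sh_sqr_le _); rewrite addrC lerD2l.
by have := cos2Dsin2 (complex.Re w); have := sqr_ge0 (sin (complex.Re w)); lra.
Qed.

Lemma fro2_rot w : fro2 (rot w) <= 4 * expR (2 * `|complex.Im w|).
Proof.
rewrite /fro2 !big_ord2 !mx2_ij nCN.
by have := nC_csin_le w; have := nC_ccos_le w; lra.
Qed.

Lemma rot0 : rot 0 = 1%:M.
Proof.
have c0 : ccos 0 = 1.
  by apply: complexP; rewrite /= ?cos0 ?sin0 /ch ?oppr0 ?expR0 ?mul0r ?oppr0// mul1r; field.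
have s0 : csin 0 = 0.
  by apply: complexP; rewrite /= ?cos0 ?sin0 /sh ?oppr0 ?expR0 ?mul0r ?subrr ?mul0r ?mulr0.
by rewrite /rot c0 s0; apply: mx2P; rewrite !mx2_ij !one2E// oppr0.
Qed.

Lemma cder_trig (l : C) (a t : R) :
  cder (fun t => ccos (l * (t - a)%:C)) t (- (l * csin (l * (t - a)%:C))) /\
  cder (fun t => csin (l * (t - a)%:C)) t (l * ccos (l * (t - a)%:C)).
Proof.
set u := complex.Re l; set v := complex.Im l.
have E x : l * (x - a)%:C = (u * (x - a) +i* (v * (x - a)))%C.
  by apply: complexP; rewrite !ReImE /= /u /v; ring.
have lin c : rder (fun t => c * (t - a)) t c.
  have := rderM (rder_cst c t) (rderB (rder_id t) (rder_cst a t)).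
  by congr rder; ring.
have dc := @rder_comp R cos (fun t => u * (t - a)) t _ _ (is_derive_cos _) (lin u).
have ds := @rder_comp R sin (fun t => u * (t - a)) t _ _ (is_derive_sin _) (lin u).
have dch := @rder_comp R ch (fun t => v * (t - a)) t _ _ (rder_ch _) (lin v).
have dsh := @rder_comp R sh (fun t => v * (t - a)) t _ _ (rder_sh _) (lin v).
split; split; rewrite ?E !ReImE/=; under eq_fun do rewrite E /=.
- by have := rderM dc dch; congr rder; rewrite -/u -/v; ring.
- by have := rderN (rderM ds dsh); congr rder; rewrite -/u -/v; ring.
- by have := rderM ds dch; congr rder; rewrite -/u -/v; ring.
- by have := rderM dc dsh; congr rder; rewrite -/u -/v; ring.
Qed.

Lemma mder_rot (l : C) (a t : R) :
  mder (fun t => rot (l * (t - a)%:C)) t (- (l *: (J *m rot (l * (t - a)%:C)))).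
Proof.
have [dc ds] := cder_trig l a t.
move=> i j; move: i; apply: ord2_ind; move: j; apply: ord2_ind;
  under eq_fun do rewrite mx2_ij; rewrite !mxE big_ord2 !mx2_ij.
- by move: dc; congr cder; ring.
- by move: (cderN ds); congr cder; ring.
- by move: ds; congr cder; ring.
- by move: dc; congr cder; ring.
Qed.

Lemma mac_rot (l : C) (a : R) : mac (fun t => rot (l * (t - a)%:C)).
Proof.
pose D t : 'M[C]_2 := - (l *: (J *m rot (l * (t - a)%:C))).
have rc : mcont (fun t => rot (l * (t - a)%:C)) by apply: mder_mcont => t; exact: mder_rot.
have Dc : mcont D.
  have -> : D = (fun t => (- l) *: (J *m rot (l * (t - a)%:C))).
    by apply/funext => t; rewrite scaleNr.
  by apply: mcontZ; apply: mcontM => //; exact: mcont_cst.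
by apply: mder_mac Dc => t; exact: mder_rot.
Qed.

End complex_trig.

Lemma fro2D3 (R : realType) (n : nat) (A B D : 'M[R[i]]_n) :
  fro2 (A + B + D) <= 3 * (fro2 A + fro2 B + fro2 D).
Proof.
rewrite /fro2 -!big_split/= mulr_sumr; apply: ler_sum => i _.
rewrite -!big_split/= mulr_sumr; apply: ler_sum => j _; rewrite !mxE.
set a := A i j; set b := B i j; set d := D i j.
apply: (@le_trans _ _ ((nC a + nC b + nC d) ^+ 2)).
  rewrite ler_pXn2r ?nnegrE ?addr_ge0 ?nC_ge0//.
  by apply: (le_trans (nCD _ _)); rewrite lerD2r nCD.
have := sqr_ge0 (nC a - nC b); have := sqr_ge0 (nC a - nC d).
by have := sqr_ge0 (nC b - nC d); rewrite !expr2; lra.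
Qed.

Lemma expR_sub1_le (R : realType) (x : R) : x <= 2^-1 -> expR x - 1 <= 2 * x \/ x < 0.
Proof.
move=> x2; have [x0|] := leP 0 x; [left|by right].
have := expR_ge1Dx (- x); rewrite expRN => h.
have e0 := expR_gt0 x.
have h1 : (1 - x) * expR x <= 1 by rewrite -ler_pdivlMr// div1r.
have h2 : expR x <= 2.
  by rewrite -(@ler_pM2l _ 2^-1)//; apply: (@le_trans _ _ ((1 - x) * expR x)); [rewrite ler_pM2r//; lra|lra].
have : x * expR x <= x * 2 by rewrite ler_wpM2l.
lra.
Qed.

(* The correction factor [1 - q1 / (2 l)] is chosen because [q1] anticommutes with
   [J]: it trades [q] for [q - q1] plus terms of order [1 / l]. *)
Lemma corrected_ode_identity (R : realType) (q q1 dq1 S U X0 : 'M[R[i]]_2) (l : R[i]) :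
  l != 0 -> q1 *m Jmx R = - (Jmx R *m q1) ->
  let J := Jmx R in let k := (2 * l)^-1 in
  (0 - k *: dq1) *m S + (1%:M - k *: q1) *m (J *m (q *m S - l *: S)) -
    (- (l *: (J *m U))) *m X0 =
  - (l *: (J *m ((1%:M - k *: q1) *m S - U *m X0))) +
    (J *m (q - q1) - k *: dq1 - k *: (q1 *m (J *m q))) *m S.
Proof.
move=> l0 q1J J k.
have q1JS : q1 *m (J *m S) = - (J *m (q1 *m S)).
  by rewrite !mulmxA q1J mulNmx.
rewrite !(mulmxBl, mulmxBr, mulmxDl, mulmxDr) !mul1mx !mul0mx !mulNmx.
do ?[rewrite -scalemxAl | rewrite -scalemxAr | rewrite mulmxN | rewrite mulNmx].
rewrite -!mulmxA q1JS.
move: (dq1 *m S) (J *m (q *m S)) (J *m S) (J *m (q1 *m S)) (q1 *m (J *m (q *m S))) (J *m (U *m X0)) => A1 A2 A3 A4 A5 A6.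
have -> : l = (2 * k)^-1 by rewrite /k; field.
have k0 : k != 0 by rewrite invr_neq0// mulf_neq0// pnatr_eq0.
by apply/matrixP => i j; rewrite !mxE; field.
Qed.

Section asymptotics.
Variable R : realType.
Notation C := R[i].
Notation J := (Jmx R).
Variables (Q : R -> 'M[C]_2) (p s : R -> R) (b : R).
Hypothesis Q_canonical : Dirac_canonical_form Q p s.
Hypothesis b_gt0 : 0 < b.
Hypothesis p_int : Lebesgue_integrable `[0, b[ p.
Hypothesis s_int : Lebesgue_integrable `[0, b[ s.

(** [V] stands for the indefinite integral of the norm of [Q - Q1]. Its increase is controlled by
    [e], whereas [H] may grow as [e] shrinks and is compensated by a large spectral parameter. *)
Definition approx (e : R) (Q1 dQ1 : R -> 'M[C]_2) (V : R -> R) (H : R) :=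
  [/\ 1 <= H, forall x, mder Q1 x (dQ1 x),
      forall x, 0 <= x <= b -> mnorm (Q1 x) <= H /\ mnorm (dQ1 x) <= H,
      forall x, Q1 x *m J = - (J *m Q1 x) &
      [/\ forall x y, absolutely_continuous x y V,
          forall x y, 0 <= x -> x <= y -> y <= b -> 0 <= V y - V x <= e, mac Q1 &
          {ae (@lebesgue_measure R), forall x : R, 0 < x < b ->
            exists2 v, rder V x v & mnorm (Q x - Q1 x) <= v}]].

Lemma Q_approx e : 0 < e -> exists Q1 dQ1 V H, approx e Q1 dQ1 V H.
Proof.
(* The errors of [p] and [s] each occur in two entries, so [V] is twice the sum of two functions,
   each of increase at most [e / 4]. *)
move=> e0; have e40 : 0 < e / 4 by rewrite divr_gt0.
have [h1 [dh1 [V1 [h1d dh1c V1ac V1e V1p]]]] := l1_approx b_gt0 p_int e40.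
have [h2 [dh2 [V2 [h2d dh2c V2ac V2e V2s]]]] := l1_approx b_gt0 s_int e40.
pose Q1 t : 'M[C]_2 := mx2 (h1 t)%:C (h2 t)%:C (h2 t)%:C (- (h1 t)%:C).
pose dQ1 t : 'M[C]_2 := mx2 (dh1 t)%:C (dh2 t)%:C (dh2 t)%:C (- (dh1 t)%:C).
pose V t := 2 * (V1 t + V2 t).
have Q1d x : mder Q1 x (dQ1 x).
  have r1 : cder (fun t => (h1 t)%:C) x (dh1 x)%:C.
    by split => /=; [exact: h1d|exact: rder_cst].
  have r2 : cder (fun t => (h2 t)%:C) x (dh2 x)%:C.
    by split => /=; [exact: h2d|exact: rder_cst].
  move=> i j; move: i; apply: ord2_ind; move: j; apply: ord2_ind;
    under eq_fun do rewrite mx2_ij; rewrite mx2_ij //.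
  exact: cderN.
have dQ1c : mcont dQ1.
  have c1 : ccont (fun t => (dh1 t)%:C) by split => //= t; exact: cvg_cst.
  have c2 : ccont (fun t => (dh2 t)%:C) by split => //= t; exact: cvg_cst.
  move=> i j; move: i; apply: ord2_ind; move: j; apply: ord2_ind; under eq_fun do rewrite mx2_ij; rewrite //.
  have := ccontM (ccont_cst (-1)) c1; congr ccont.
  by apply/funext => t; rewrite mulN1r.
have Q1c : mcont Q1 by exact: mder_mcont Q1d.
have [H1 H11 Q1H] := mcont_bounded b Q1c.
have [H2 H21 dQ1H] := mcont_bounded b dQ1c.
have Vac x y : absolutely_continuous x y V by apply: ac_scale; exact: acD.
have Vae : {ae (@lebesgue_measure R), forall x : R, 0 < x < b ->
            exists2 v, rder V x v & mnorm (Q x - Q1 x) <= v}.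
  have := ae_and_lebesgue V1p V2s; apply: ae_imply_lebesgue => x [P1 P2] xb.
  have [v1 V1v pv] := P1 xb; have [v2 V2v sv] := P2 xb.
  exists (2 * (v1 + v2)).
    have := rderM (rder_cst 2 x) (rderD V1v V2v).
    by rewrite mul0r add0r.
  have E : Q x - Q1 x = mx2 (p x - h1 x)%:C (s x - h2 x)%:C (s x - h2 x)%:C (- (p x - h1 x)%:C).
    rewrite Q_canonical; apply: mx2P; rewrite mxE [X in _ + X]mxE !mx2_ij rmorphB/=; ring.
  by rewrite E /mnorm !big_ord2 !mx2_ij nCN !nC_real; lra.
have Vmono x y : 0 <= x -> x <= y -> y <= b -> V x <= V y.
  move=> x0 xy yb; rewrite -lerN2; apply: (ac_le (f := fun t => - V t)) => //.
    exact: acN.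
  apply: ae_imply_lebesgue Vae => z h /andP[xz zy].
  have [|v Vv Qv] := h.
    by rewrite (le_lt_trans x0 xz) (lt_le_trans zy yb).
  exists (- v); first exact: rderN.
  by rewrite oppr_le0 (le_trans (mnorm_ge0 _) Qv).
exists Q1, dQ1, V, (H1 + H2); split => //.
- lra.
- by move=> x xb; have := Q1H x xb; have := dQ1H x xb; split; lra.
- by move=> x; apply: mx2P; rewrite mul2E [RHS]mxE mul2E !mx2_ij; ring.
split => //.
  move=> x y x0 xy yb; rewrite subr_ge0 Vmono//=.
  have xb : x <= b by exact: le_trans xy yb.
  have := Vmono 0 x (lexx _) x0 xb; have := Vmono y b (le_trans x0 xy) yb (lexx _).
  by rewrite /V in V1e V2e *; lra.
exact: mder_mac Q1d dQ1c.
Qed.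

Lemma dirac_ip (l : C) (S : 'M[C]_2) q nq : mnorm q <= nq ->
  2 * ip S (J *m (q *m S - l *: S)) <= 2 * `|complex.Im l| * fro2 S + 4 * nq * fro2 S.
Proof.
move=> qn; rewrite mulmxBr ipD mulmxA -scalemxAr.
have h1 := le_trans (ler_norm _) (ip_mulmx S (J *m q) S).
have h2 := le_trans (ler_norm _) (ip_J l S).
have h3 := mnormM J q; rewrite mnorm_J in h3.
have f0 := fro2_ge0 S.
have : mnorm (J *m q) * ((fro2 S + fro2 S) / 2) <= 2 * nq * fro2 S.
  rewrite (_ : (fro2 S + fro2 S) / 2 = fro2 S); last by field.
  by rewrite ler_wpM2r//; lra.
lra.
Qed.

(* The bound must not depend on the approximation used in [Dirac_asymp], whence
   the separate, fixed approximation. *)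
Lemma Dirac_crude : exists2 M, 0 < M & forall l a0 S t, 0 <= a0 -> a0 <= t -> t <= b ->
  Dirac_solution Q l S -> S a0 = 1%:M ->
  fro2 (S t) <= M * expR (2 * `|complex.Im l| * (t - a0)).
Proof.
have [Q1 [dQ1 [V [H [H1 Q1d Q1H Q1J [Vac Ve _ Vae]]]]]] := Q_approx ltr01.
exists (2 * expR (4 * (H * b + 1))); first by rewrite mulr_gt0// expR_gt0.
move=> l a0 S t a00 a0t tb DS Sa0.
pose U x := 4 * (H * x + V x).
have Uac : absolutely_continuous a0 t U.
  by apply: ac_scale; apply: acD => //; apply: ac_scale; exact: ac_id.
have Sac : mac S by case: DS.
have := @ac_gronwall R 2 a0 t `|complex.Im l| 0 S U a0t (lexx _) Sac Uac.
have -> : fro2 (S a0) = 2 by rewrite Sa0 fro2_1.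
rewrite addr0 subr0 => h; apply: le_trans (h _) _.
  have := ae_and_lebesgue Vae (dirac_ae DS).
  apply: ae_imply_lebesgue => x [P1 SD] /andP[ax xt].
  have xb : 0 < x < b by rewrite (le_lt_trans a00 ax) (lt_le_trans xt tb).
  have [v Vv Qv] := P1 xb.
  exists (J *m (Q x *m S x - l *: S x)), (4 * (H * 1 + v)); split=> //.
    have := rderM (rder_cst 4 x) (rderD (rderM (rder_cst H x) (rder_id x)) Vv).
    by congr rder; ring.
  rewrite mul0r addr0; have Qn : mnorm (Q x) <= H + v.
    rewrite -[Q x](subrK (Q1 x)) addrC; apply: (le_trans (mnormD _ _)).
    apply: lerD => //; apply: (Q1H x _).1.
    by case/andP: xb => /ltW -> /ltW ->.
  by have := dirac_ip l (S x) Qn; lra.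
apply: ler_wpM2r; first exact: expR_ge0.
rewrite ler_pM2l// ler_expR /U.
have /andP[_ Ve1] := Ve a0 t a00 a0t tb.
have : H * (t - a0) <= H * b by rewrite ler_wpM2l//; lra.
lra.
Qed.

(** [X] is the solution multiplied by the correction factor, and [D] is its deviation from the
    unperturbed evolution of [X a0]. Gronwall's inequality bounds [D] by [M] times
    [exp (VE b0 - VE a0) - 1], and undoing the correction costs terms of order 1 / l. The order of
    choices matters: [M], then [eta], then the approximation with its [H], and last the threshold
    for [l]. *)
Lemma Dirac_asymp e : 0 < e -> exists2 L, 0 < L & forall l a0 b0 S,
  L <= nC l -> 0 <= a0 -> a0 <= b0 -> b0 <= b -> Dirac_solution Q l S -> S a0 = 1%:M ->
  fro2 (S b0 - rot (l * (b0 - a0)%:C)) <= e * expR (2 * `|complex.Im l| * (b0 - a0)).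
Proof.
move=> e0; have [M M0 SM] := Dirac_crude.
(* Below 1/2 the exponential satisfies [exp x - 1 <= 2 x]. The 12 gives [fro2 D] the share [e / 6],
   which becomes [e / 2] through the factor 3 of [fro2D3]. *)
pose eta := Num.min 2^-1 (e / (12 * M)).
have eta0 : 0 < eta by rewrite /eta lt_min invr_gt0 ltr0n/= divr_gt0// mulr_gt0.
have eta2 : eta <= 2^-1 by rewrite /eta ge_min lexx.
have etaM : 12 * M * eta <= e.
  rewrite mulrC -ler_pdivlMr ?mulr_gt0//; by rewrite /eta ge_min lexx orbT.
have eta4 : 0 < eta / 4 by rewrite divr_gt0.
have [Q1 [dQ1 [V [H [H1 Q1d Q1H Q1J [Vac Ve Q1ac Vae]]]]]] := Q_approx eta4.
(* [T] bounds the part of [VE b0 - VE a0] that carries the factor [k], of order 1 / l. [N] collects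
   the constants of the two correction terms: 3 from [fro2D3], 16 from [fro2M], and [M] or 4 for the
   size of the solution or of [rot]. *)
pose T := (H + 2 * H ^+ 2) * b + 2 * H * (eta / 4).
pose N := (48 * M + 192) * H ^+ 2.
have H0 : 0 < H by lra.
have T0 : 0 < T.
  rewrite /T addr_gt0//; last by rewrite !mulr_gt0.
  by rewrite mulr_gt0// addr_gt0// mulr_gt0// exprn_gt0.
have N0 : 0 < N by rewrite /N mulr_gt0 ?exprn_gt0//; lra.
exists (1 + T / eta + N / e).
  by rewrite !addr_gt0// divr_gt0.
move=> l a0 b0 S Ll a00 ab0 b0b DS Sa0.
pose k := (nC (2 * l))^-1.
have T1 : 0 < T / eta by rewrite divr_gt0.
have N1 : 0 < N / e by rewrite divr_gt0.
have l0 : l != 0 by rewrite -nC_gt0; lra.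
have nl : nC (2 * l) = 2 * nC l.
  by rewrite nCM (_ : (2 : C) = (2 : R)%:C) ?nC_real ?ger0_norm// rmorphMn rmorph1.
have k0 : 0 < k by rewrite /k nl invr_gt0; lra.
have k1 : k <= 1 by rewrite /k nl invf_le1; lra.
have kT : k * T <= eta / 2.
  rewrite /k nl mulrC ler_pdivrMr; last by lra.
  have : eta * (T / eta) <= eta * nC l by rewrite ler_pM2l//; lra.
  rewrite mulrC divfK ?gt_eqF//; lra.
have kN : k * N <= e / 2.
  rewrite /k nl mulrC ler_pdivrMr; last by lra.
  have : e * (N / e) <= e * nC l by rewrite ler_pM2l//; lra.
  rewrite mulrC divfK ?gt_eqF//; lra.
pose kc := (2 * l)^-1 : C.
have kcn : nC kc = k by rewrite /kc nCV.
pose X t := (1%:M - kc *: Q1 t) *m S t.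
pose U t := rot (l * (t - a0)%:C).
pose D t := X t - U t *m X a0.
have Sac : mac S by case: DS.
have Dac : mac D.
  have macB (A B : R -> 'M[C]_2) : mac A -> mac B -> mac (fun t => A t - B t).
    move=> Aa Ba i j; under eq_fun do rewrite !mxE.
    have := cacD (Aa i j) (cacM (cac_cst (-1)) (Ba i j)).
    by congr cac; apply/funext => t; rewrite mulN1r.
  apply: (macB); last by apply: macM; [exact: mac_rot|exact: mac_cst].
  apply: macM => //; apply: (macB); first exact: mac_cst.
  by move=> i j; under eq_fun do rewrite mxE; apply: cacM; [exact: cac_cst|exact: Q1ac].
pose VE t := 2 * V t + k * ((H + 2 * H ^+ 2) * t + 2 * H * V t).
have VEac : absolutely_continuous a0 b0 VE.
  apply: acD; first exact: ac_scale.
  by apply: ac_scale; apply: acD; apply: ac_scale; [exact: ac_id|exact: Vac].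
have := @ac_gronwall R 2 a0 b0 `|complex.Im l| M D VE ab0 (ltW M0) Dac VEac.
have Da0 : D a0 = 0.
  by rewrite /D /U subrr mulr0 rot0 mul1mx subrr.
rewrite Da0 fro2_0 add0r => h.
have {}h : fro2 (D b0) <= (M * expR (VE b0 - VE a0) - M) * expR (2 * `|complex.Im l| * (b0 - a0)).
  apply: h; have := ae_and_lebesgue Vae (dirac_ae DS).
  apply: ae_imply_lebesgue => x [P1 SD] /andP[ax xb0].
  have xb : 0 < x < b by rewrite (le_lt_trans a00 ax) (lt_le_trans xb0 b0b).
  have xb' : 0 <= x <= b by case/andP: xb => /ltW -> /ltW ->.
  have [v Vv Qv] := P1 xb.
  have [HQ1 HdQ1] := Q1H x xb'.
  have v0 : 0 <= v by rewrite (le_trans (mnorm_ge0 _) Qv).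
  pose E := J *m (Q x - Q1 x) - kc *: dQ1 x - kc *: (Q1 x *m (J *m Q x)).
  pose g := 2 * v + k * (H + 2 * H ^+ 2 + 2 * H * v).
  exists (- (l *: (J *m D x)) + E *m S x), g; split.
  - have := mderB (mderM (mderB (mder_cst 1%:M x) (mderZ kc (Q1d x))) SD)
      (mderMr (X a0) (mder_rot l a0 x)).
    by rewrite (corrected_ode_identity _ _ _ _ _ l0 (Q1J x)).
  - have := rderD (rderM (rder_cst 2 x) Vv) (rderM (rder_cst k x) (rderD
      (rderM (rder_cst (H + 2 * H ^+ 2) x) (rder_id x)) (rderM (rder_cst (2 * H) x) Vv))).
    by congr rder; rewrite /g; ring.
  - have Qn : mnorm (Q x) <= H + v.
      rewrite -[Q x](subrK (Q1 x)) addrC; apply: (le_trans (mnormD _ _)).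
      exact: lerD.
    have En : mnorm E <= g.
      rewrite /E; apply: (le_trans (mnormB _ _)).
      apply: (le_trans (lerD (mnormB _ _) (lexx _))); rewrite !mnormZ kcn.
      have e1 : mnorm (J *m (Q x - Q1 x)) <= 2 * v.
        by apply: (le_trans (mnormM _ _)); rewrite mnorm_J ler_pM2l.
      have e2 : mnorm (Q1 x *m (J *m Q x)) <= H * (2 * (H + v)).
        apply: (le_trans (mnormM _ _)); apply: ler_pM; rewrite ?mnorm_ge0//.
        by apply: (le_trans (mnormM _ _)); rewrite mnorm_J ler_pM2l.
      have e3 : k * mnorm (dQ1 x) <= k * H by rewrite ler_pM2l.
      have e4 : k * mnorm (Q1 x *m (J *m Q x)) <= k * (H * (2 * (H + v))) by rewrite ler_pM2l.
      have -> : g = 2 * v + k * H + k * (H * (2 * (H + v))) by rewrite /g; ring.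
      lra.
    have Sx := SM l a0 S x a00 (ltW ax) (ltW (lt_le_trans xb0 b0b)) DS Sa0.
    rewrite ipD; have i1 := le_trans (ler_norm _) (ip_J l (D x)).
    have i2 := le_trans (ler_norm _) (ip_mulmx (D x) E (S x)).
    have i3 : mnorm E * ((fro2 (D x) + fro2 (S x)) / 2) <=
        g * ((fro2 (D x) + M * expR (2 * `|complex.Im l| * (x - a0))) / 2).
      apply: ler_pM => //; rewrite ?mnorm_ge0 ?divr_ge0 ?addr_ge0 ?fro2_ge0//.
      by rewrite ler_pM2r ?invr_gt0// lerD2l.
    lra.
have VEe : VE b0 - VE a0 <= eta.
  have /andP[dV0 dVe] := Ve a0 b0 a00 ab0 b0b.
  have -> : VE b0 - VE a0 = 2 * (V b0 - V a0) + k * ((H + 2 * H ^+ 2) * (b0 - a0) + 2 * H * (V b0 - V a0)).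
    by rewrite /VE; ring.
  have : k * ((H + 2 * H ^+ 2) * (b0 - a0) + 2 * H * (V b0 - V a0)) <= k * T.
    rewrite ler_pM2l// /T; apply: lerD.
      rewrite ler_wpM2l//; last by lra.
      by rewrite addr_ge0 ?mulr_ge0 ?exprn_ge0 ?ltW.
    by rewrite ler_wpM2l// mulr_ge0// ltW.
  lra.
have exp_eta : expR (VE b0 - VE a0) - 1 <= 2 * eta.
  apply: (@le_trans _ _ (expR eta - 1)); first by rewrite lerD2r ler_expR.
  by have [//|] := expR_sub1_le eta2; rewrite ltNge ltW.
set EE := expR (2 * `|complex.Im l| * (b0 - a0)) in h *.
have EE0 : 0 < EE by exact: expR_gt0.
have Dle : fro2 (D b0) <= e / 6 * EE.
  apply: (le_trans h); rewrite ler_pM2r//.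
  have : M * (expR (VE b0 - VE a0) - 1) <= M * (2 * eta) by rewrite ler_pM2l.
  lra.
have Bn t : 0 <= t <= b -> fro2 (kc *: Q1 t) <= (k * H) ^+ 2.
  move=> tb; apply: (le_trans (fro2_mnorm _)).
  have kH : 0 <= k * H by rewrite mulr_ge0// ltW.
  rewrite ler_pXn2r ?nnegrE ?mnorm_ge0//.
  by rewrite mnormZ kcn ler_pM2l//; have [] := Q1H t tb.
have b0_in : 0 <= b0 <= b by rewrite b0b (le_trans a00).
have a0_in : 0 <= a0 <= b by rewrite a00 (le_trans ab0).
have -> : S b0 - rot (l * (b0 - a0)%:C) =
    D b0 + (kc *: Q1 b0) *m S b0 + - (U b0 *m (kc *: Q1 a0)).
  rewrite /D /X Sa0 mulmx1 mulmxBl mul1mx mulmxBr mulmx1 -/(U b0).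
  move: ((kc *: Q1 b0) *m S b0) (U b0 *m (kc *: Q1 a0)) (U b0) => A1 A2 A3.
  by apply/matrixP => i j; rewrite !mxE; ring.
apply: (le_trans (fro2D3 _ _ _)).
rewrite fro2N.
have kH0 : 0 <= (k * H) ^+ 2 by exact: sqr_ge0.
have t1 : fro2 ((kc *: Q1 b0) *m S b0) <= 16 * ((k * H) ^+ 2 * (M * EE)).
  apply: (le_trans (fro2M _ _)); rewrite ler_pM2l//.
  apply: ler_pM; rewrite ?fro2_ge0 ?Bn//; exact: SM.
have t2 : fro2 (U b0 *m (kc *: Q1 a0)) <= 16 * ((4 * EE) * (k * H) ^+ 2).
  apply: (le_trans (fro2M _ _)); rewrite ler_pM2l//.
  apply: ler_pM; rewrite ?fro2_ge0 ?Bn//.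
  apply: (le_trans (fro2_rot _)); rewrite ler_pM2l// /EE ler_expR ReImE /= mulr0 add0r.
  by rewrite normrM (ger0_norm (_ : 0 <= b0 - a0)) ?subr_ge0// mulrA.
have kk : 3 * (16 * ((k * H) ^+ 2 * (M * EE)) + 16 * ((4 * EE) * (k * H) ^+ 2)) <= e / 2 * EE.
  rewrite [leLHS](_ : _ = k * (k * N) * EE); last by rewrite /N; ring.
  rewrite ler_pM2r//; apply: le_trans kN.
  by rewrite ler_piMl// mulr_ge0// ltW.
lra.
Qed.

End asymptotics.

(** * Expansions and maximum principle *)

Section complex_analysis.
Variable R : realType.
Notation C := R[i].
Implicit Types (f g h F : C -> C) (a w z : C) (M : R).

Lemma derive1_complex (f : C -> C^o) a (d : C) M : 0 <= M ->
  (forall w, nC w <= 2^-1 -> nC (f (a + w) - f a - d * w) <= M * nC w ^+ 2) ->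
  derive1 f a = d.
Proof.
move=> M0 fd; rewrite /derive1; apply/cvg_lim; first exact: norm_hausdorff.
apply/cvgrPdist_le => /= e; rewrite ltcE /= => /andP[/eqP ei e0].
have eE : e = (complex.Re e)%:C by apply: complexP => //=.
pose r := Num.min 2^-1 (complex.Re e / (M + 1)).
have r0 : 0 < r by rewrite lt_min invr_gt0 ltr0n divr_gt0// ltr_wpDl.
exists (r%:C); first by rewrite /= ltcR.
move=> w; rewrite /ball_/= sub0r normrN normrC ltcR => /ltW + w0.
rewrite le_min => /andP[w1 w2].
rewrite eE normrC lecR.
have -> : d - w^-1 *: (f (w + a) - f a) = - w^-1 * (f (a + w) - f a - d * w).
  by rewrite [w + a]addrC /GRing.scale/=; field.
rewrite nCM nCN nCV ler_pdivrMl ?nC_gt0//.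
apply: le_trans (fd w w1) _; rewrite expr2 mulrA mulrC ler_wpM2l ?nC_ge0//.
apply: (@le_trans _ _ ((M + 1) * (complex.Re e / (M + 1)))).
  apply: (@le_trans _ _ ((M + 1) * nC w)); first by rewrite ler_wpM2r ?nC_ge0// lerDl.
  by rewrite ler_wpM2l// addr_ge0.
by rewrite mulrC divfK// gt_eqF// ltr_wpDl.
Qed.

(* The symmetric difference quotient at [a + w] with step [w] itself expands
   [f (a + 2 w) - f a] around both [a + w] and [a]. *)
Lemma derive1n_complex (f : C -> C^o) (c1 c2 : C -> C) :
  (forall rho : R, exists2 M, 0 < M & forall a w, nC a <= rho -> nC w <= 1 ->
     nC (f (a + w) - (f a + c1 a * w + c2 a * w ^+ 2)) <= M * nC w ^+ 3) ->
  forall a, derive1n 1 f a = c1 a /\ derive1n 2 f a = 2 * c2 a.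
Proof.
move=> ft.
have d1 a : derive1 f a = c1 a.
  have [M M0 fM] := ft (nC a).
  apply: (@derive1_complex f a (c1 a) (M + nC (c2 a))).
    by rewrite addr_ge0 ?nC_ge0// ltW.
  move=> w w2; have w1 : nC w <= 1 by lra.
  have -> : f (a + w) - f a - c1 a * w =
    (f (a + w) - (f a + c1 a * w + c2 a * w ^+ 2)) + c2 a * w ^+ 2 by ring.
  apply: (le_trans (nCD _ _)); rewrite mulrDl nCM nCX lerD//.
  apply: (le_trans (fM a w (lexx _) w1)).
  by rewrite ler_pM2l// exprS ler_piMl// exprn_ge0// nC_ge0.
move=> a; split; first by rewrite derive1n1.
rewrite derive1nS derive1n1.
have -> : derive1 f = c1 by apply/funext.
have [M M0 fM] := ft (nC a + 1).
apply: (@derive1_complex c1 a (2 * c2 a) (5 * M)); first by rewrite mulr_ge0// ltW.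
move=> w w2; have w1 : nC w <= 1 by lra.
have [->|w0] := eqVneq w 0.
  by rewrite addr0 mulr0 subrr subr0 nC0 expr0n mulr0.
have n2w : nC (2 * w) = 2 * nC w.
  by rewrite mulr_natl mulr2n -(mulr2n w) normcMn mulr_natl.
have e1 := fM a (2 * w) _ _; have e2 := fM (a + w) w _ _; have e3 := fM (a + w) (- w) _ _.
have aw : nC (a + w) <= nC a + 1 by apply: (le_trans (nCD _ _)); rewrite lerD2l.
have {}e1 := e1 ltac:(by rewrite lerDl) ltac:(by rewrite n2w; lra).
have {}e2 := e2 aw w1.
have {}e3 := e3 aw ltac:(by rewrite nCN).
have E : 2 * w * (c1 (a + w) - c1 a - 2 * c2 a * w) =
  (f (a + 2 * w) - (f a + c1 a * (2 * w) + c2 a * (2 * w) ^+ 2)) -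
  (f (a + w + w) - (f (a + w) + c1 (a + w) * w + c2 (a + w) * w ^+ 2)) +
  (f (a + w + - w) - (f (a + w) + c1 (a + w) * (- w) + c2 (a + w) * (- w) ^+ 2)).
  by rewrite addrK (_ : a + w + w = a + 2 * w); ring.
have nw : 0 < nC w by rewrite nC_gt0.
rewrite -(@ler_pM2l _ (2 * nC w)); last by rewrite mulr_gt0.
rewrite -{1}n2w -nCM E; apply: (le_trans (nCD _ _)).
apply: (le_trans (lerD (nCB _ _) (lexx _))).
rewrite nCN in e3; rewrite n2w [X in _ <= _ * X]exprMn in e1.
have -> : 2 * nC w * (5 * M * nC w ^+ 2) = 10 * (M * nC w ^+ 3) by ring.
rewrite (_ : M * (2 ^+ 3 * nC w ^+ 3) = 8 * (M * nC w ^+ 3)) in e1; last by ring.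
lra.
Qed.

(** A Taylor expansion with remainder of order [n]. The degree of [P] is left free, so that products
    of expansions need no truncation. *)
Definition peano f a n (P : {poly C}) := exists2 M, 0 <= M &
  forall w, nC w <= 1 -> nC (f (a + w) - P.[w]) <= M * nC w ^+ n.

Lemma poly_bound (P : {poly C}) : exists2 B, 0 <= B & forall w, nC w <= 1 -> nC P.[w] <= B.
Proof.
exists (\sum_(i < size P) nC P`_i); first by apply: sumr_ge0 => i _; exact: nC_ge0.
move=> w w1; rewrite horner_coef; apply: (le_trans (nC_sum _ _)).
apply: ler_sum => i _; rewrite nCM nCX ler_piMr ?nC_ge0//.
by rewrite exprn_ile1 ?nC_ge0.
Qed.

Lemma peanoD f g a n P Q : peano f a n P -> peano g a n Q ->
  peano (fun z => f z + g z) a n (P + Q).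
Proof.
move=> [M M0 fM] [N N0 gN]; exists (M + N); first exact: addr_ge0.
move=> w w1; rewrite hornerD opprD addrACA mulrDl.
by apply: (le_trans (nCD _ _)); apply: lerD; [exact: fM|exact: gN].
Qed.

Lemma peano_cst (c : C) a n : peano (fun=> c) a n c%:P.
Proof. by exists 0 => // w _; rewrite hornerC subrr nC0 mul0r. Qed.

Lemma peanoM f g a n P Q : peano f a n P -> peano g a n Q ->
  peano (fun z => f z * g z) a n (P * Q).
Proof.
move=> [M M0 fM] [N N0 gN].
have [A A0 PA] := poly_bound P; have [B B0 QB] := poly_bound Q.
exists (M * (B + N) + A * N); first by rewrite addr_ge0 ?mulr_ge0// addr_ge0.
move=> w w1; rewrite hornerM.
have -> : f (a + w) * g (a + w) - P.[w] * Q.[w] =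
  (f (a + w) - P.[w]) * (Q.[w] + (g (a + w) - Q.[w])) + P.[w] * (g (a + w) - Q.[w]) by ring.
have wn : nC w ^+ n <= 1 by rewrite exprn_ile1 ?nC_ge0.
have wn0 : 0 <= nC w ^+ n by rewrite exprn_ge0 ?nC_ge0.
apply: (le_trans (nCD _ _)); rewrite !nCM mulrDl; apply: lerD.
  rewrite mulrAC; apply: ler_pM; rewrite ?nC_ge0//; first exact: fM.
  apply: (le_trans (nCD _ _)); apply: lerD; first exact: QB.
  by apply: (le_trans (gN w w1)); rewrite ler_piMr.
by rewrite -mulrA; apply: ler_pM; rewrite ?nC_ge0// ?PA// gN.
Qed.

Lemma peanoN f a n P : peano f a n P -> peano (fun z => - f z) a n (- P).
Proof.
move=> [M M0 fM]; exists M => // w w1.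
by rewrite hornerN -opprD nCN; exact: fM.
Qed.

Lemma peanoB f g a n P Q : peano f a n P -> peano g a n Q ->
  peano (fun z => f z - g z) a n (P - Q).
Proof. by move=> fP gQ; apply: peanoD => //; exact: peanoN. Qed.

Lemma peano_coef0 f a n P : peano f a n.+1 P -> P`_0 = f a.
Proof.
move=> [M M0 fM]; have := fM 0; rewrite nC0 addr0 expr0n mulr0 => /(_ ler01) h.
apply/eqP; rewrite eq_sym -subr_eq0 -nC_eq0 eq_le nC_ge0 andbT.
by rewrite -horner_coef0.
Qed.

(** Order 5 is what quotients call for: dividing by the square of [w] at a double zero must leave a
    remainder of order 3. *)
Lemma peano5 f a P : peano f a 5 P -> exists2 M, 0 <= M & forall w, nC w <= 1 ->
  nC (f (a + w) - (P`_0 + P`_1 * w + P`_2 * w ^+ 2 + P`_3 * w ^+ 3 + P`_4 * w ^+ 4))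
    <= M * nC w ^+ 5.
Proof.
move=> [M M0 fM]; have [B B0 DB] := poly_bound (drop_poly 5 P).
exists (M + B); first exact: addr_ge0.
move=> w w1.
have E : P.[w] = (P`_0 + P`_1 * w + P`_2 * w ^+ 2 + P`_3 * w ^+ 3 + P`_4 * w ^+ 4) +
    (drop_poly 5 P).[w] * w ^+ 5.
  rewrite -{1}(poly_take_drop 5 P) hornerD hornerM hornerXn; congr (_ + _).
  rewrite (horner_coef_wide _ (size_take_poly 5 P)) !big_ord_recr big_ord0/=.
  by rewrite !coef_take_poly /=; ring.
have -> : f (a + w) - (P`_0 + P`_1 * w + P`_2 * w ^+ 2 + P`_3 * w ^+ 3 + P`_4 * w ^+ 4) =
  (f (a + w) - P.[w]) + (drop_poly 5 P).[w] * w ^+ 5 by rewrite E; ring.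
apply: (le_trans (nCD _ _)); rewrite mulrDl nCM nCX; apply: lerD; first exact: fM.
by rewrite ler_wpM2r ?exprn_ge0 ?nC_ge0// DB.
Qed.

(** [h0], [h1], [h2] come from the division of power series, and [d] keeps the modulus of [f] above
    half that of [q0]. The estimates exclude [w = 0], where the functions may themselves be
    quotients by the square of [w]. *)
Lemma quot_expand (F f : C -> C) (p0 p1 p2 q0 q1 q2 : C) M : 0 <= M -> q0 != 0 ->
  (forall w, 0 < nC w <= 1 -> nC (F w - (p0 + p1 * w + p2 * w ^+ 2)) <= M * nC w ^+ 3) ->
  (forall w, 0 < nC w <= 1 -> nC (f w - (q0 + q1 * w + q2 * w ^+ 2)) <= M * nC w ^+ 3) ->
  exists (h1 h2 : C) (N d : R), [/\ 0 < d, 0 <= N & forall w, 0 < nC w <= d ->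
    f w != 0 /\ nC (F w / f w - (p0 / q0 + h1 * w + h2 * w ^+ 2)) <= N * nC w ^+ 3].
Proof.
move=> M0 q00 FP fq.
pose h0 := p0 / q0; pose h1 := (p1 - h0 * q1) / q0.
pose h2 := (p2 - h0 * q2 - h1 * q1) / q0.
pose A := nC q1 + nC q2 + M.
have nq0 : 0 < nC q0 by rewrite nC_gt0.
have A0 : 0 <= A by rewrite !addr_ge0// nC_ge0.
pose d := Num.min 1 (nC q0 / 2 / (A + 1)).
have d0 : 0 < d by rewrite lt_min ltr01/= !divr_gt0// ltr_wpDl.
pose B := M + (nC h0 + nC h1 + nC h2) * M + (nC (h1 * q2 + h2 * q1) + nC (h2 * q2)).
have B0 : 0 <= B by rewrite !addr_ge0 ?mulr_ge0 ?addr_ge0 ?nC_ge0.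
exists h1, h2, (B * (2 / nC q0)), d; split => //.
  by rewrite mulr_ge0// divr_ge0// ltW.
move=> w /andP[w0]; rewrite le_min => /andP[w1 wd].
have w01 : 0 < nC w <= 1 by rewrite w0 w1.
have le1 n : nC w ^+ n <= 1 by rewrite exprn_ile1 ?nC_ge0.
have wn0 n : 0 <= nC w ^+ n by rewrite exprn_ge0 ?nC_ge0.
have le_w n : nC w ^+ n.+1 <= nC w by rewrite exprS ler_piMr ?nC_ge0.
have fge : nC q0 / 2 <= nC (f w).
  have : nC q0 - nC (f w) <= A * nC w.
    apply: (le_trans (nC_dist _ _)).
    have -> : q0 - f w = - (f w - (q0 + q1 * w + q2 * w ^+ 2)) - (q1 * w + q2 * w ^+ 2) by ring.
    apply: (le_trans (nCB _ _)); rewrite nCN.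
    have h := fq w w01; have hh := nCD (q1 * w) (q2 * w ^+ 2).
    rewrite (nCM q1) (nCM q2) nCX in hh.
    have i1 : M * nC w ^+ 3 <= M * nC w by rewrite ler_wpM2l.
    have i2 : nC q2 * nC w ^+ 2 <= nC q2 * nC w by rewrite ler_wpM2l ?nC_ge0.
    by rewrite /A; lra.
  have : A * nC w <= nC q0 / 2.
    apply: (@le_trans _ _ ((A + 1) * nC w)); first by rewrite ler_wpM2r ?nC_ge0// lerDl.
    by rewrite mulrC -ler_pdivlMr// ltr_wpDl.
  lra.
have fw0 : f w != 0 by rewrite -nC_gt0 (lt_le_trans _ fge)// divr_gt0.
split => //.
have -> : F w / f w - (p0 / q0 + h1 * w + h2 * w ^+ 2) =
    (F w - (h0 + h1 * w + h2 * w ^+ 2) * f w) / f w.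
  by rewrite -/h0; field.
rewrite nCM nCV ler_pdivrMr ?nC_gt0//.
have E : F w - (h0 + h1 * w + h2 * w ^+ 2) * f w =
  (F w - (p0 + p1 * w + p2 * w ^+ 2)) -
  (h0 + h1 * w + h2 * w ^+ 2) * (f w - (q0 + q1 * w + q2 * w ^+ 2)) -
  ((h1 * q2 + h2 * q1) + (h2 * q2) * w) * w ^+ 3.
  by rewrite /h2 /h1 /h0; field.
have Hle : nC (h0 + h1 * w + h2 * w ^+ 2) <= nC h0 + nC h1 + nC h2.
  apply: (le_trans (nCD _ _)); apply: lerD; last by rewrite nCM nCX ler_piMr ?nC_ge0.
  by apply: (le_trans (nCD _ _)); apply: lerD => //; rewrite nCM ler_piMr ?nC_ge0.
have FB : nC (F w - (h0 + h1 * w + h2 * w ^+ 2) * f w) <= B * nC w ^+ 3.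
  rewrite E; apply: (le_trans (nCB _ _)).
  have -> : B * nC w ^+ 3 = M * nC w ^+ 3 + (nC h0 + nC h1 + nC h2) * (M * nC w ^+ 3) +
      (nC (h1 * q2 + h2 * q1) + nC (h2 * q2)) * nC w ^+ 3 by rewrite /B; ring.
  apply: lerD.
    apply: (le_trans (nCB _ _)); apply: lerD; first exact: FP.
    by rewrite nCM; apply: ler_pM; rewrite ?nC_ge0// fq.
  rewrite nCM nCX; apply: ler_wpM2r => //.
  apply: (le_trans (nCD _ _)); rewrite lerD2l nCM ler_piMr ?nC_ge0//.
apply: (le_trans FB).
have -> : B * (2 / nC q0) * nC w ^+ 3 * nC (f w) = B * nC w ^+ 3 * (nC (f w) * (2 / nC q0)) by ring.
apply: ler_peMr; first by apply: mulr_ge0.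
by rewrite mulrA ler_pdivlMr// mul1r; lra.
Qed.

(** The substitute for holomorphy in the maximum principle. The constant term is the value [h a], so
    continuity is included. *)
Definition expand2 h a := exists (h1 h2 : C) (N d : R), [/\ 0 < d, 0 <= N & forall w, nC w <= d ->
  nC (h (a + w) - (h a + h1 * w + h2 * w ^+ 2)) <= N * nC w ^+ 3].

Lemma expand2_cont h a : expand2 h a -> forall e, 0 < e ->
  exists2 d, 0 < d & forall w, nC w <= d -> nC (h (a + w) - h a) <= e.
Proof.
move=> [h1 [h2 [N [d [d0 N0 hd]]]]] e e0.
pose A := nC h1 + nC h2 + N + 1.
have A0 : 0 < A by rewrite /A ltr_wpDl// !addr_ge0 ?nC_ge0.
exists (Num.min (Num.min 1 d) (e / A)).
  by rewrite !lt_min ltr01 d0 divr_gt0.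
move=> w; rewrite !le_min => /andP[/andP[w1 wd] we].
have -> : h (a + w) - h a = (h (a + w) - (h a + h1 * w + h2 * w ^+ 2)) + (h1 * w + h2 * w ^+ 2) by ring.
have n0 := nC_ge0 w.
have le_w n : nC w ^+ n.+1 <= nC w by rewrite exprS ler_piMr// exprn_ile1.
apply: (le_trans (nCD _ _)).
have i1 := hd w wd; have i2 := nCD (h1 * w) (h2 * w ^+ 2); rewrite (nCM h1) (nCM h2) nCX in i2.
have i3 : N * nC w ^+ 3 <= N * nC w by rewrite ler_wpM2l.
have i4 : nC h2 * nC w ^+ 2 <= nC h2 * nC w by rewrite ler_wpM2l ?nC_ge0.
have : A * nC w <= e by rewrite mulrC -ler_pdivlMr.
by rewrite /A; lra.
Qed.

End complex_analysis.

(** * Maximum principle and vanishing of quotients *)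

Section max_principle.
Variable R : realType.
Notation C := R[i].
Implicit Types (f F h : C -> C) (a w z : C).

Lemma nC_sqr_lower (x y : C) : nC x ^+ 2 - 2 * nC x * nC y <= nC (x + y) ^+ 2.
Proof.
have E : nC (x + y) ^+ 2 = nC x ^+ 2 + 2 * complex.Re (x * conjc y) + nC y ^+ 2.
  by rewrite !nC_sqr !ReImE; ring.
have := nC_Re (x * conjc y); rewrite nCM nCJ ler_norml => /andP[h _].
by rewrite E; have := sqr_ge0 (nC y); lra.
Qed.

(* The mean of [|h|^2 + e |z|^2] over four points of a small circle exceeds its
   value at the centre, as [w] and [w ^+ 2] both average to [0]. *)
Lemma four_points h a (e : R) : expand2 h a -> 0 < e ->
  let U z := nC (h z) ^+ 2 + e * nC z ^+ 2 in
  exists2 r0, 0 < r0 & forall r : R, 0 < r <= r0 ->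
    4 * U a < U (a + (r +i* 0)%C) + U (a + (- r +i* 0)%C) +
              U (a + (0 +i* r)%C) + U (a + (0 +i* (- r))%C).
Proof.
move=> [h1 [h2 [N [d [d0 N0 hd]]]]] e0 U.
pose B := nC (h a) + nC h1 + nC h2.
have B0 : 0 <= B by rewrite !addr_ge0 ?nC_ge0.
have BN0 : 0 <= 2 * B * N by rewrite !mulr_ge0.
have BN1 : 0 < 2 * B * N + 1 by rewrite ltr_wpDl.
pose r0 := Num.min (Num.min 1 d) (e / (2 * B * N + 1)).
exists r0; first by rewrite !lt_min ltr01 d0 divr_gt0.
move=> r /andP[rgt]; rewrite !le_min => /andP[/andP[r1 rd] re].
pose pw w := h a + h1 * w + h2 * w ^+ 2.
have low w : nC w = r -> nC (pw w) ^+ 2 - 2 * B * N * r ^+ 3 <= nC (h (a + w)) ^+ 2.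
  move=> wr; have := hd w; rewrite wr => /(_ rd) hw.
  have := nC_sqr_lower (pw w) (h (a + w) - pw w); rewrite [pw w + _]addrC subrK => h3.
  apply: le_trans h3; rewrite lerD2l lerN2 -!mulrA ler_pM2l//.
  apply: ler_pM; rewrite ?nC_ge0//.
  apply: (le_trans (nCD _ _)); apply: lerD; last first.
    by rewrite nCM nCX wr ler_piMr ?nC_ge0// exprn_ile1// ltW.
  by apply: (le_trans (nCD _ _)); apply: lerD => //; rewrite nCM wr ler_piMr ?nC_ge0.
have nr : [/\ nC (r +i* 0)%C = r, nC (- r +i* 0)%C = r, nC (0 +i* r)%C = r & nC (0 +i* (- r))%C = r].
  by rewrite /= !expr0n/= !addr0 !add0r !sqrrN !sqrtr_sqr ger0_norm ?ltW.
case: nr => n1 n2 n3 n4.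
have l1 := low _ n1; have l2 := low _ n2; have l3 := low _ n3; have l4 := low _ n4.
have S1 : nC (pw (r +i* 0)%C) ^+ 2 + nC (pw (- r +i* 0)%C) ^+ 2 +
    nC (pw (0 +i* r)%C) ^+ 2 + nC (pw (0 +i* (- r))%C) ^+ 2 =
    4 * (nC (h a) ^+ 2 + nC h1 ^+ 2 * r ^+ 2 + nC h2 ^+ 2 * r ^+ 4).
  by rewrite /pw !expr2 -!expr2 !nC_sqr ![in LHS]expr2 !ReImE /=; ring.
have S2 : nC (a + (r +i* 0)%C) ^+ 2 + nC (a + (- r +i* 0)%C) ^+ 2 +
    nC (a + (0 +i* r)%C) ^+ 2 + nC (a + (0 +i* (- r))%C) ^+ 2 = 4 * (nC a ^+ 2 + r ^+ 2).
  by rewrite !nC_sqr !ReImE /=; ring.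
have p1 : 0 <= nC h1 ^+ 2 * r ^+ 2 by rewrite mulr_ge0 ?sqr_ge0.
have p2 : 0 <= nC h2 ^+ 2 * r ^+ 4 by rewrite mulr_ge0 ?sqr_ge0// exprn_ge0// ltW.
have r20 : 0 < r ^+ 2 by rewrite exprn_gt0.
have small : 2 * B * N * r ^+ 3 < e * r ^+ 2.
  rewrite exprS mulrA ltr_pM2r//.
  apply: (@lt_le_trans _ _ ((2 * B * N + 1) * r)); first by rewrite ltr_pM2r// ltrDl.
  by rewrite mulrC -ler_pdivlMr.
have S2e := congr1 (fun t => e * t) S2; rewrite /= !mulrDr in S2e.
rewrite /U !mulrDr; lra.
Qed.

Definition sq_bdry (L : R) z :=
  (`|complex.Re z| = L /\ `|complex.Im z| <= L) \/
  (`|complex.Im z| = L /\ `|complex.Re z| <= L).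

(** By [four_points], the function [|h|^2 + e' |z|^2] has no maximum inside the square, so its
    maximum over the compact square lies on the boundary. There [|z|^2 <= 2 L^2], which explains the
    choice of [e']. *)
Lemma max_principle h (L eta : R) : (forall a, expand2 h a) -> 0 < L -> 0 <= eta ->
  (forall z, sq_bdry L z -> nC (h z) <= eta) ->
  forall z, `|complex.Re z| <= L -> `|complex.Im z| <= L -> nC (h z) <= eta.
Proof.
move=> hE L0 eta0 hb z zr zi.
suff key e : 0 < e -> nC (h z) ^+ 2 <= eta ^+ 2 + e.
  rewrite -(@ler_pXn2r _ 2) ?nnegrE ?nC_ge0//.
  by apply/ler_addgt0Pr => e e0; exact: key.
move=> e0; pose e' := e / (2 * L ^+ 2).
have L20 : 0 < 2 * L ^+ 2 by rewrite mulr_gt0// exprn_gt0.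
have e'0 : 0 < e' by rewrite divr_gt0.
pose U z := nC (h z) ^+ 2 + e' * nC z ^+ 2.
pose A : set (R * R) := `[- L, L]%classic `*` `[- L, L]%classic.
have cA : compact A by apply: compact_setX; exact: segment_compact.
have contnc (k : C -> C) : (forall a, expand2 k a) ->
    continuous (fun xy : R * R => nC (k (xy.1 +i* xy.2)%C)).
  move=> kE [x y]; apply/cvgrPdist_le => /= t t0.
  have [d d0 kd] := expand2_cont (kE (x +i* y)%C) t0.
  have d20 : 0 < d / 2 by rewrite divr_gt0.
  exists (ball x (d / 2), ball y (d / 2)) => [|[x' y'] [/= bx by_]].
    by split; exact: nbhsx_ballx.
  rewrite /ball/= in bx by_.
  set w := ((x' - x) +i* (y' - y))%C.
  have -> : (x' +i* y')%C = (x +i* y)%C + w.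
    by apply: complexP; rewrite !ReImE /=; ring.
  have wd : nC w <= d.
    apply: (le_trans (nC_le _)) => /=; rewrite distrC in bx; rewrite distrC in by_.
    by lra.
  apply: (le_trans _ (kd w wd)).
  have i1 := nC_dist (k (x +i* y)%C) (k ((x +i* y)%C + w)).
  have i2 := nC_dist (k ((x +i* y)%C + w)) (k (x +i* y)%C).
  rewrite -(nCN (k (x +i* y)%C - _)) opprB in i1.
  by rewrite ler_norml; lra.
have idE a : expand2 (fun z => z) a.
  exists 1, 0, 0, 1; split => // w _.
  by rewrite mul1r mul0r addr0 subrr nC0 mul0r.
have Uc : {within A, continuous (fun xy : R * R => U (xy.1 +i* xy.2)%C)}.
  apply: continuous_subspaceT => xy; rewrite /U.
  under eq_fun do rewrite !expr2.
  apply: cvgD; first exact: (cvgM (contnc h hE xy) (contnc h hE xy)).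
  by apply: cvgM; [exact: cvg_cst|exact: (cvgM (contnc _ idE xy) (contnc _ idE xy))].
have [|[x0 y0] + Umax] := compact_EVT_max _ cA Uc.
  by exists (0, 0); split; rewrite /= in_itv/= lerNl oppr0 ltW.
rewrite inE => -[/=]; rewrite !in_itv/= => x0L y0L.
have {}Umax z' : `|complex.Re z'| <= L -> `|complex.Im z'| <= L -> U z' <= U (x0 +i* y0)%C.
  case: z' => x y /=; rewrite !ler_norml => xL yL.
  by apply: (Umax (x, y)); rewrite inE; split; rewrite /= in_itv/=.
have Uz : nC (h z) ^+ 2 <= U z by rewrite lerDl mulr_ge0 ?sqr_ge0// ltW.
apply: (le_trans Uz); apply: (le_trans (Umax _ zr zi)).
have [bd|/not_orP[nb1 nb2]] := pselect (sq_bdry L (x0 +i* y0)%C).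
  have hle : nC (h (x0 +i* y0)%C) ^+ 2 <= eta ^+ 2.
    by rewrite ler_pXn2r ?nnegrE ?nC_ge0// hb.
  have : nC (x0 +i* y0)%C ^+ 2 <= 2 * L ^+ 2.
    rewrite nC_sqr /= -(real_normK (num_real x0)) -(real_normK (num_real y0)).
    have i1 : `|x0| ^+ 2 <= L ^+ 2 by rewrite ler_pXn2r ?nnegrE ?(ltW L0)// ler_norml.
    have i2 : `|y0| ^+ 2 <= L ^+ 2 by rewrite ler_pXn2r ?nnegrE ?(ltW L0)// ler_norml.
    lra.
  rewrite -(ler_pM2l e'0) /e' divfK ?gt_eqF// => i3.
  by rewrite /U /e'; lra.
exfalso.
have xl : `|x0| < L.
  rewrite lt_neqAle ler_norml x0L andbT; apply/eqP => xL; apply: nb1.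
  by split => //=; rewrite ler_norml.
have yl : `|y0| < L.
  rewrite lt_neqAle ler_norml y0L andbT; apply/eqP => xL; apply: nb2.
  by split => //=; rewrite ler_norml.
have [r0 r00 Hr] := four_points (hE (x0 +i* y0)%C) e'0.
pose r := Num.min r0 (Num.min (L - `|x0|) (L - `|y0|)).
have rgt : 0 < r by rewrite !lt_min r00 !subr_gt0 xl.
have rr0 : r <= r0 by rewrite ge_min lexx.
have rx : r <= L - `|x0| by rewrite !ge_min lexx orbT.
have ry : r <= L - `|y0| by rewrite !ge_min lexx !orbT.
have := Hr r; rewrite rgt rr0 => /(_ isT).
have rn : `|r| = r by rewrite ger0_norm// ltW.
have nx (t : R) : `|x0 + t| <= `|x0| + `|t| by exact: ler_normD.
have ny (t : R) : `|y0 + t| <= `|y0| + `|t| by exact: ler_normD.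
have nnx := nx r; have nnx' := nx (- r); have nny := ny r; have nny' := ny (- r).
rewrite !normrN rn in nnx nnx' nny nny'.
have u1 : U ((x0 +i* y0)%C + (r +i* 0)%C) <= U (x0 +i* y0)%C.
  by apply: Umax; rewrite !ReImE /= ?addr0; lra.
have u2 : U ((x0 +i* y0)%C + (- r +i* 0)%C) <= U (x0 +i* y0)%C.
  by apply: Umax; rewrite !ReImE /= ?addr0; lra.
have u3 : U ((x0 +i* y0)%C + (0 +i* r)%C) <= U (x0 +i* y0)%C.
  by apply: Umax; rewrite !ReImE /= ?addr0; lra.
have u4 : U ((x0 +i* y0)%C + (0 +i* (- r))%C) <= U (x0 +i* y0)%C.
  by apply: Umax; rewrite !ReImE /= ?addr0; lra.
rewrite -/(U _) -/(U _) -/(U _) -/(U _) -/(U _); lra.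
Qed.

(** At a zero of [f] both functions are first divided by the square of [w]; [h0] is then the
    quotient of the second coefficients. It is the value by which [F / f] has to be continued. *)
Lemma ratio_expand F f a :
  (exists P, peano f a 5 P) -> (exists P, peano F a 5 P) ->
  (f a = 0 -> exists P, [/\ peano f a 5 P, P`_1 = 0 & P`_2 != 0]) ->
  (f a = 0 -> exists P, [/\ peano F a 5 P, P`_0 = 0 & P`_1 = 0]) ->
  exists (h0 h1 h2 : C) (N d : R), [/\ 0 < d, 0 <= N, (f a != 0 -> h0 = F a / f a) &
    forall w, 0 < nC w <= d -> f (a + w) != 0 /\
      nC (F (a + w) / f (a + w) - (h0 + h1 * w + h2 * w ^+ 2)) <= N * nC w ^+ 3].
Proof.
move=> [P fP] [Q FQ] f0 F0.
have [fa0|fa0] := eqVneq (f a) 0.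
  have [{}P [{}fP P1 P2]] := f0 fa0; have [{}Q [{}FQ Q0 Q1]] := F0 fa0.
  have P0 := peano_coef0 fP; rewrite fa0 in P0.
  have [M M0 fM] := peano5 fP; have [N N0 FN] := peano5 FQ.
  have sc (g : C -> C) (b2 b3 b4 : C) (K : R) : K <= M + N ->
      (forall w, nC w <= 1 -> nC (g (a + w) - (0 + 0 * w + b2 * w ^+ 2 + b3 * w ^+ 3 + b4 * w ^+ 4)) <= K * nC w ^+ 5) ->
      forall w, 0 < nC w <= 1 -> nC (g (a + w) / w ^+ 2 - (b2 + b3 * w + b4 * w ^+ 2)) <= (M + N) * nC w ^+ 3.
    move=> KMN gK w /andP[w0 w1]; have wn0 : w != 0 by rewrite -nC_gt0.
    have -> : g (a + w) / w ^+ 2 - (b2 + b3 * w + b4 * w ^+ 2) =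
      (g (a + w) - (0 + 0 * w + b2 * w ^+ 2 + b3 * w ^+ 3 + b4 * w ^+ 4)) / w ^+ 2 by field.
    rewrite nCM nCV nCX ler_pdivrMr ?exprn_gt0//.
    apply: (le_trans (gK w w1)); rewrite -mulrA -exprD.
    by rewrite ler_wpM2r ?exprn_ge0 ?nC_ge0.
  rewrite P0 P1 in fM; rewrite Q0 Q1 in FN.
  have := @quot_expand R (fun w => F (a + w) / w ^+ 2) (fun w => f (a + w) / w ^+ 2)
    Q`_2 Q`_3 Q`_4 P`_2 P`_3 P`_4 (M + N) (addr_ge0 M0 N0) P2.
  have MN : M <= M + N by rewrite lerDl.
  have NN : N <= M + N by rewrite lerDr.
  move=> /(_ (sc F _ _ _ _ NN FN) (sc f _ _ _ _ MN fM)).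
  move=> [h1 [h2 [K [d [d0 K0 hd]]]]].
  exists (Q`_2 / P`_2), h1, h2, K, d; split => //.
  move=> w wd; have [fw hw] := hd w wd.
  have wn0 : w != 0 by rewrite -nC_gt0; case/andP: wd.
  have fw0 : f (a + w) != 0 by apply: contra fw => /eqP ->; rewrite mul0r.
  split => //; move: hw; rewrite [X in nC (X - _)](_ : _ = F (a + w) / f (a + w))//.
  by field; rewrite ?wn0 ?fw0.
have P0 := peano_coef0 fP; have Q0 := peano_coef0 FQ.
have [M M0 fM] := peano5 fP; have [N N0 FN] := peano5 FQ.
have sc (g : C -> C) (b0 b1 b2 b3 b4 : C) (K : R) : 0 <= K ->
    (forall w, nC w <= 1 -> nC (g (a + w) - (b0 + b1 * w + b2 * w ^+ 2 + b3 * w ^+ 3 + b4 * w ^+ 4)) <= K * nC w ^+ 5) ->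
    forall w, 0 < nC w <= 1 -> nC (g (a + w) - (b0 + b1 * w + b2 * w ^+ 2)) <= (K + nC b3 + nC b4) * nC w ^+ 3.
  move=> K0 gK w /andP[w0 w1].
  have -> : g (a + w) - (b0 + b1 * w + b2 * w ^+ 2) =
    (g (a + w) - (b0 + b1 * w + b2 * w ^+ 2 + b3 * w ^+ 3 + b4 * w ^+ 4)) + (b3 * w ^+ 3 + b4 * w ^+ 4) by ring.
  have n0 := nC_ge0 w.
  have i0 := nCD (b3 * w ^+ 3) (b4 * w ^+ 4).
  rewrite (nCM b3) (nCM b4) !nCX in i0.
  have i1 : nC w ^+ 5 <= nC w ^+ 3 by rewrite ler_wiXn2l.
  have i2 : nC w ^+ 4 <= nC w ^+ 3 by rewrite ler_wiXn2l.
  have i3 : K * nC w ^+ 5 <= K * nC w ^+ 3 by rewrite ler_wpM2l.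
  have i4 : nC b4 * nC w ^+ 4 <= nC b4 * nC w ^+ 3 by rewrite ler_wpM2l ?nC_ge0.
  apply: (le_trans (nCD _ _)); have := gK w w1; lra.
pose K1 := M + nC P`_3 + nC P`_4; pose K2 := N + nC Q`_3 + nC Q`_4.
have K10 : 0 <= K1 by rewrite !addr_ge0 ?nC_ge0.
have K20 : 0 <= K2 by rewrite !addr_ge0 ?nC_ge0.
have P00 : P`_0 != 0 by rewrite P0.
have := @quot_expand R (fun w => F (a + w)) (fun w => f (a + w))
    Q`_0 Q`_1 Q`_2 P`_0 P`_1 P`_2 (K1 + K2) (addr_ge0 K10 K20) P00.
have s1 w : 0 < nC w <= 1 -> nC (F (a + w) - (Q`_0 + Q`_1 * w + Q`_2 * w ^+ 2)) <= (K1 + K2) * nC w ^+ 3.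
  move=> w1; apply: (le_trans (sc F _ _ _ _ _ _ N0 FN w w1)).
  by rewrite ler_wpM2r ?exprn_ge0 ?nC_ge0// /K2 lerDr.
have s2 w : 0 < nC w <= 1 -> nC (f (a + w) - (P`_0 + P`_1 * w + P`_2 * w ^+ 2)) <= (K1 + K2) * nC w ^+ 3.
  move=> w1; apply: (le_trans (sc f _ _ _ _ _ _ M0 fM w w1)).
  by rewrite ler_wpM2r ?exprn_ge0 ?nC_ge0// /K1 lerDl.
move=> /(_ s1 s2) [h1 [h2 [K [d [d0 K0 hd]]]]].
exists (Q`_0 / P`_0), h1, h2, K, d; split => //.
by rewrite P0 Q0.
Qed.

(** Filling the zeros of [f] with the values [h0] turns [F / f] into a function [h] with an
    expansion everywhere. Each point lies in squares on whose boundary [h] is bounded by an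
    arbitrarily small [eta], hence [h = 0]. *)
Lemma ratio_zero F f :
  (forall a, exists P, peano f a 5 P) -> (forall a, exists P, peano F a 5 P) ->
  (forall a, f a = 0 -> exists P, [/\ peano f a 5 P, P`_1 = 0 & P`_2 != 0]) ->
  (forall a, f a = 0 -> exists P, [/\ peano F a 5 P, P`_0 = 0 & P`_1 = 0]) ->
  (forall eta K : R, 0 < eta -> exists L, [/\ K <= L, 0 < L & forall z, sq_bdry L z ->
     f z != 0 /\ nC (F z) <= eta * nC (f z)]) ->
  forall z, F z = 0.
Proof.
move=> fE FE f0 F0 bd.
have H a := ratio_expand (fE a) (FE a) (f0 a) (F0 a).
pose h0 a := sval (cid (H a)).
pose h z := if f z == 0 then h0 z else F z / f z.
have hE a : expand2 h a.
  have : h0 a = sval (cid (H a)) by [].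
  case: (cid (H a)) => /= c0 [h1 [h2 [N [d [d0 N0 c0E hd]]]]] h0a.
  exists h1, h2, N, d; split => // w wd.
  have ha : h a = c0.
    by rewrite /h; case: eqP => [//|/eqP fa]; rewrite c0E.
  have [->|w0] := eqVneq w 0.
    by rewrite addr0 expr0n !mulr0 !addr0 subrr nC0 mulr_ge0// exprn_ge0// nC0.
  have [|fw hw] := hd w; first by rewrite nC_gt0 w0 wd.
  by rewrite ha {1}/h (negbTE fw).
have h_le z eta : 0 < eta -> nC (h z) <= eta.
  move=> eta0; have [L [KL L0 Lb]] := bd eta (`|complex.Re z| + `|complex.Im z|) eta0.
  apply: (max_principle hE L0 (ltW eta0)).
  - move=> z' /Lb[fz Fz]; rewrite /h (negbTE fz) nCM nCV.
    by rewrite ler_pdivrMr// nC_gt0.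
  - by apply: le_trans KL; rewrite lerDl.
  - by apply: le_trans KL; rewrite lerDr.
move=> z; have [fz|fz] := eqVneq (f z) 0.
  have [P [FP P0 _]] := F0 z fz.
  by rewrite -(peano_coef0 FP).
have hz0 : h z = 0.
  apply/eqP; rewrite -nC_eq0 eq_le nC_ge0 andbT.
  by apply/ler_addgt0Pr => e e0; rewrite add0r h_le.
move/eqP: hz0; rewrite /h (negbTE fz) mulf_eq0 invr_eq0 (negbTE fz) orbF.
by move/eqP.
Qed.

End max_principle.

(** * Self-adjointness *)

Arguments Cmx : simpl never.

Lemma mder_trace (R : realType) (Y : R -> 'M[R[i]]_2) z D :
  mder Y z D -> cder (fun t => \tr (Y t)) z (\tr D).
Proof.
move=> YD; rewrite tr2E; under eq_fun do rewrite tr2E.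
by apply: cderD; exact: YD.
Qed.

Section self_adjoint.
Variable R : realType.
Notation C := R[i].
Notation J := (Jmx R).
Variables (Q : R -> 'M[C]_2) (p s : R -> R).
Hypothesis Q_canonical : Dirac_canonical_form Q p s.
Variable Y : C -> R -> 'M[C]_2.
Hypothesis Y_solution : forall l, Dirac_solution Q l (Y l).
Hypothesis Y_initial : forall l, Y l 0 = 1%:M.

Let symp l z := dirac_symp Q_canonical (Y_solution l) (Y_initial l) z.
Let Ydet l z : Y l z 0 0 * Y l z 1 1 - Y l z 0 1 * Y l z 1 0 = 1 := symp_det (symp l z).

(** Trace 2 and determinant 1 give a nonzero [V] fixed by [Y l b]. The Wronskian form of [Y V] with
    its conjugate takes equal values at 0 and [b], while the imaginary part of its trace has
    derivative [2 Im l] times the squared norm of [Y V], which never vanishes. *)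
Lemma trace2_real (l : C) (b : R) : 0 < b -> \tr (Y l b) = 2 -> complex.Im l = 0.
Proof.
move=> b0 tr2; have [V V0 YV] : exists2 V : 'M[C]_2, V != 0 & Y l b *m V = V.
  have [Y1|Y1] := eqVneq (Y l b) 1%:M.
    by exists 1%:M; [exact: oner_neq0|rewrite mulmx1].
  (* The adjugate of [Y l b - 1]: the product of the two is
     [det (Y l b - 1) = 2 - tr (Y l b) = 0]. *)
  exists (mx2 (Y l b 1 1 - 1) (- Y l b 0 1) (- Y l b 1 0) (Y l b 0 0 - 1)).
    apply: contra Y1 => /eqP V0; apply/eqP; move/matrixP: V0 => V0.
    have := V0 0 0; have := V0 0 1; have := V0 1 0; have := V0 1 1.
    rewrite !mx2_ij !mxE => /eqP; rewrite subr_eq0 => /eqP h1.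
    move=> /eqP; rewrite oppr_eq0 => /eqP h2 /eqP; rewrite oppr_eq0 => /eqP h3.
    move=> /eqP; rewrite subr_eq0 => /eqP h4.
    by apply: mx2P; rewrite !one2E.
  move: tr2; rewrite tr2E => tr2; have dt := Ydet l b.
  have E1 : Y l b 1 1 = 2 - Y l b 0 0 by rewrite -tr2; ring.
  rewrite E1 in dt.
  have dt0 : Y l b 0 0 * (2 - Y l b 0 0) - Y l b 0 1 * Y l b 1 0 - 1 = 0 by rewrite dt subrr.
  apply: mx2P; rewrite mul2E !mx2_ij ?E1; last 1 first.
  - by rewrite -[RHS]addr0 -dt0; ring.
  - by rewrite -[RHS]addr0 -dt0; ring.
  - by ring.
  - by ring.
pose cY z := map_mx conjc (Y l z); pose cV := map_mx conjc V.
pose A z := cV^T *m ((cY z)^T *m (J *m Y l z)) *m V.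
pose dA z := cV^T *m ((l - conjc l) *: ((cY z)^T *m Y l z)) *m V.
have Ad z : mder A z (dA z).
  by apply: mderMr; apply: mderMl; apply: (wronskian Q_canonical) => //; exact: dirac_conj.
have Ab : A b = A 0.
  have E z : A z = (map_mx conjc (Y l z *m V))^T *m (J *m (Y l z *m V)).
    by rewrite map_mxM trmx_mul /A !mulmxA.
  by rewrite !E YV Y_initial mul1mx.
have dtr z : rder (fun t => complex.Im (\tr (A t))) z (2 * complex.Im l * fro2 (Y l z *m V)).
  have [_] := mder_trace (Ad z); congr rder.
  have -> : dA z = (l - conjc l) *: ((map_mx conjc (Y l z *m V))^T *m (Y l z *m V)).
    by rewrite /dA -scalemxAr -scalemxAl map_mxM trmx_mul !mulmxA.
  move: (Y l z *m V) => X; rewrite tr2E !mxE !big_ord2 !mxE /fro2 !big_ord2 !nC_sqr !ReImE.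
  ring.
have [c _] := rder_mvt (ltW b0) (fun z _ => dtr z).
rewrite Ab subrr => /esym/eqP; rewrite subr0 !mulf_eq0 (gt_eqF b0) orbF.
rewrite (_ : (2 : R) == 0 = false) ?orFb; last by rewrite pnatr_eq0.
move=> /orP[/eqP //|/eqP /fro2_eq0 YcV].
case/eqP: V0; have := Y_inv Q_canonical Y_solution Y_initial l c.
by move=> /mulmx1C h; rewrite -[V]mul1mx -h -mulmxA YcV mulmx0.
Qed.

Section real_parameter.
Variables (a : C) (b : R).
Hypothesis b_gt0 : 0 < b.
Hypothesis a_real : complex.Im a = 0.

(* [Gmx z] is the integral of [(Y a)^T Y a] over [0, z]. *)
Definition Gmx z : 'M[C]_2 := - (J *m Cmx Y a 1 z).

Lemma Cmx1E z : Cmx Y a 1 z = J *m Gmx z.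
Proof. by rewrite /Gmx mulmxN mulmxA J2 mulNmx mul1mx opprK. Qed.

Lemma Gmx0 : Gmx 0 = 0.
Proof. by rewrite /Gmx (proj1 (CmxS Y_solution a 0)) mulmx0 oppr0. Qed.

Lemma Gmx0E i j : Gmx 0 i j = 0.
Proof. by rewrite Gmx0 [LHS]mxE. Qed.

Lemma Gmx_der z : mder Gmx z ((Y a z)^T *m Y a z).
Proof.
have := mderN (mderMl J (proj2 (CmxS Y_solution a 0) z)); congr mder.
by rewrite [Cmx Y a 0 z]/= mulmx1 /Kmx mulmxA J2 mulNmx mul1mx opprK.
Qed.

Let Yreal z i j : complex.Im (Y a z i j) = 0.
Proof.
have := dirac_symp_conj Q_canonical (Y_solution a) (Y_initial a) a_real z.
move=> /matrixP /(_ i j); rewrite mxE => /(congr1 (@complex.Im R)).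
by rewrite ImJ => h; lra.
Qed.

Lemma Gmx_sym z : Gmx z 1 0 = Gmx z 0 1.
Proof.
apply/eqP; rewrite -subr_eq0; apply/eqP.
have := cder0_cst (f := fun t => Gmx t 1 0 - Gmx t 0 1) _ z.
rewrite !Gmx0E subrr; apply => x.
have := cderB (Gmx_der x 1 0) (Gmx_der x 0 1); congr cder.
by rewrite !mul2E ![_^T _ _]mxE; ring.
Qed.

Lemma Gmx_real z i j : complex.Im (Gmx z i j) = 0.
Proof.
have := rder0_cst (f := fun t => complex.Im (Gmx t i j)) _ z.
rewrite Gmx0E /=; apply => x.
have [_] := Gmx_der x i j; congr rder.
by rewrite mul2E ![_^T _ _]mxE !ReImE !Yreal; ring.
Qed.

Let g1 := complex.Re (Gmx b 0 0).
Let g := complex.Re (Gmx b 0 1).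
Let g2 := complex.Re (Gmx b 1 1).

(** The derivative of this form in the upper limit is the squared length of [Y a t] applied to
    [(x, y)], positive since [Y a t] has determinant 1. *)
Lemma Gmx_posdef (x y : R) : (x != 0) || (y != 0) ->
  0 < x ^+ 2 * g1 + 2 * x * y * g + y ^+ 2 * g2.
Proof.
move=> xy.
pose phi t := x ^+ 2 * complex.Re (Gmx t 0 0) + 2 * x * y * complex.Re (Gmx t 0 1)
   + y ^+ 2 * complex.Re (Gmx t 1 1).
pose r t i j := complex.Re (Y a t i j).
pose dphi t := (r t 0 0 * x + r t 0 1 * y) ^+ 2 + (r t 1 0 * x + r t 1 1 * y) ^+ 2.
have dt t : r t 0 0 * r t 1 1 - r t 0 1 * r t 1 0 = 1.
  have := congr1 (@complex.Re R) (Ydet a t); rewrite !ReImE !Yreal /= => <-.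
  by rewrite /r; ring.
have phid t : rder phi t (dphi t).
  have h00 := (Gmx_der t 0 0).1; have h01 := (Gmx_der t 0 1).1; have h11 := (Gmx_der t 1 1).1.
  have := rderD (rderD (rderM (rder_cst (x ^+ 2) t) h00) (rderM (rder_cst (2 * x * y) t) h01))
    (rderM (rder_cst (y ^+ 2) t) h11).
  congr rder; rewrite !mul2E ![_^T _ _]mxE !ReImE !Yreal /dphi /r; ring.
have [c _] := rder_mvt (ltW b_gt0) (fun t _ => phid t).
rewrite {2}/phi !Gmx0E /= !mulr0 !addr0 !subr0 /phi -/g1 -/g -/g2 => ->.
apply: mulr_gt0 => //; rewrite lt_neqAle addr_ge0 ?sqr_ge0// andbT eq_sym.
apply: contraL xy; rewrite /dphi paddr_eq0 ?sqr_ge0// !sqrf_eq0 negb_or !negbK.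
move=> /andP[/eqP e1 /eqP e2]; apply/andP; split; apply/eqP.
  have : x = r c 1 1 * (r c 0 0 * x + r c 0 1 * y) - r c 0 1 * (r c 1 0 * x + r c 1 1 * y).
    by rewrite -[LHS]mul1r -(dt c); ring.
  by rewrite e1 e2 => ->; ring.
have : y = r c 0 0 * (r c 1 0 * x + r c 1 1 * y) - r c 1 0 * (r c 0 0 * x + r c 0 1 * y).
  by rewrite -[LHS]mul1r -(dt c); ring.
by rewrite e1 e2 => ->; ring.
Qed.

(** The derivative of the trace is a linear expression in [g1], [g], [g2]. Multiplied by [y01] and
    simplified with trace 2 and determinant 1, it becomes minus the form at [(y01, 1 - y00)];
    positivity forces [y01 = 0] and [y00 = 1], after which only [y10 * g2 = 0] is left. *)
Lemma double_monodromy : \tr (Y a b) = 2 -> \tr (Amx Y a 1 b) = 0 -> Y a b = 1%:M.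
Proof.
rewrite /Amx expr1 scaleN1r linearN/= Cmx1E => tr2 /eqP; rewrite oppr_eq0 => /eqP.
have Gr i j : Gmx b i j = (complex.Re (Gmx b i j))%:C.
  by apply: complexP => //=; rewrite Gmx_real.
have Yr i j : Y a b i j = (complex.Re (Y a b i j))%:C.
  by apply: complexP => //=; rewrite Yreal.
rewrite tr2E !mul2E !mx2_ij => /(congr1 (@complex.Re R)).
rewrite !ReImE !Gmx_real !Yreal /= Gmx_sym -/g -/g1 -/g2.
set y00 := complex.Re (Y a b 0 0); set y01 := complex.Re (Y a b 0 1).
set y10 := complex.Re (Y a b 1 0); set y11 := complex.Re (Y a b 1 1) => E.
have tr2' : y00 + y11 = 2.
  by move: tr2; rewrite tr2E => /(congr1 (@complex.Re R)); rewrite !ReImE.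
have dt : y00 * y11 - y01 * y10 = 1.
  have := congr1 (@complex.Re R) (Ydet a b); rewrite !ReImE !Yreal /= => <-.
  by rewrite -/y00 -/y01 -/y10 -/y11; ring.
have E' : y00 * g - y01 * g1 + y10 * g2 - y11 * g = 0 by rewrite -E; ring.
have y11E : y11 = 2 - y00 by lra.
have z01 : (y01 == 0) && (1 - y00 == 0).
  apply: contraT; rewrite negb_and => /Gmx_posdef.
  have : y01 * (y00 * g - y01 * g1 + y10 * g2 - y11 * g) = 0 by rewrite E' mulr0.
  have yy : y01 * y10 = y00 * (2 - y00) - 1 by rewrite y11E in dt; lra.
  have -> : y01 * (y00 * g - y01 * g1 + y10 * g2 - y11 * g) =
     y01 * y00 * g - y01 ^+ 2 * g1 + (y01 * y10) * g2 - y01 * y11 * g by ring.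
  rewrite yy y11E => E2.
  have -> : y01 ^+ 2 * g1 + 2 * y01 * (1 - y00) * g + (1 - y00) ^+ 2 * g2 =
    - (y01 * y00 * g - y01 ^+ 2 * g1 + (y00 * (2 - y00) - 1) * g2 - y01 * (2 - y00) * g) by ring.
  by rewrite E2 oppr0 ltxx.
have /andP[/eqP y010 /eqP y001] := z01.
have y00E : y00 = 1 by lra.
have y11E1 : y11 = 1 by lra.
have g20 : 0 < g2.
  by have := @Gmx_posdef 0 1; rewrite oner_eq0 orbT => /(_ isT); rewrite expr0n expr1n !mulr0 !mul0r !add0r mul1r.
have y100 : y10 = 0.
  move: E'; rewrite y00E y010 y11E1 mul0r mul1r subr0 addrAC subrr add0r => /eqP.
  by rewrite mulf_eq0 (gt_eqF g20) orbF => /eqP.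
by apply: mx2P; rewrite Yr !one2E -/y00 -/y01 -/y10 -/y11 ?y00E ?y010 ?y100 ?y11E1.
Qed.

(** The first coefficient is the trace of [- J G] with [G] symmetric. For the second, the trace of
    [Cmx Y a 2] and [- det G] have the same derivative and both vanish at 0; the determinant is
    nonzero because the form at [(g, - g1)] equals [g1 * det G]. *)
Lemma monodromy1_double : Y a b = 1%:M ->
  \tr (Amx Y a 1 b) = 0 /\ \tr (Amx Y a 2 b) != 0.
Proof.
move=> Y1; rewrite /Amx Y1 !mul1mx expr1 scaleN1r sqrrN expr1n scale1r; split.
  by rewrite linearN/= Cmx1E tr2E !mul2E !mx2_ij Gmx_sym; ring.
have E z : \tr (Cmx Y a 2 z) = - (Gmx z 0 0 * Gmx z 1 1 - Gmx z 0 1 * Gmx z 0 1).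
  apply/eqP; rewrite -subr_eq0 opprK; apply/eqP.
  have := cder0_cst (f := fun t => \tr (Cmx Y a 2 t) +
      (Gmx t 0 0 * Gmx t 1 1 - Gmx t 0 1 * Gmx t 0 1)) _ z.
  rewrite (proj1 (CmxS Y_solution a 1)) !Gmx0E mxtrace0 !mulr0 subrr addr0; apply => x.
  have := cderD (mder_trace (proj2 (CmxS Y_solution a 1) x))
    (cderB (cderM (Gmx_der x 0 0) (Gmx_der x 1 1)) (cderM (Gmx_der x 0 1) (Gmx_der x 0 1))).
  congr cder; rewrite Cmx1E /Kmx; have sy := Gmx_sym x.
  move: (Gmx x) sy => G sy.
  have symY : ((Y a x)^T *m Y a x) 1 0 = ((Y a x)^T *m Y a x) 0 1.
    by rewrite !mul2E ![_^T _ _]mxE; ring.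
  move: symY; move: ((Y a x)^T *m Y a x) => D.
  by rewrite tr2E !mul2E !mx2_ij sy => ->; ring.
rewrite E oppr_eq0; apply: contraTneq (isT : true) => dG.
have g10 : 0 < g1.
  by have := @Gmx_posdef 1 0; rewrite oner_eq0 => /(_ isT); rewrite expr0n expr1n !mulr0 !mul0r !addr0 mul1r.
have := @Gmx_posdef g (- g1); rewrite oppr_eq0 (gt_eqF g10) orbT => /(_ isT).
have : g1 * g2 - g * g = 0.
  have := congr1 (@complex.Re R) dG; rewrite !ReImE !Gmx_real /= => <-.
  by rewrite /g1 /g2 /g; ring.
have -> : g ^+ 2 * g1 + 2 * g * - g1 * g + (- g1) ^+ 2 * g2 = g1 * (g1 * g2 - g * g) by ring.
by move=> ->; rewrite mulr0 ltxx.
Qed.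

End real_parameter.
End self_adjoint.

(** * Comparison with the unperturbed solution *)

Section growth.
Variable R : realType.
Notation C := R[i].
Implicit Types (f g k F : C -> C) (l z : C).

Definition Eexp (l : C) : R := expR (`|complex.Im l| * (pi / 2)).

Lemma Eexp_gt0 l : 0 < Eexp l. Proof. exact: expR_gt0. Qed.

(* [o] and [O] of the n-th power of the growth [exp (|Im l| pi / 2)]. *)
Definition small n g := forall e : R, 0 < e -> exists L : R, forall l, L <= nC l ->
  nC (g l) <= e * Eexp l ^+ n.
Definition big_O n g := exists2 B : R, 0 < B & exists L : R, forall l, L <= nC l ->
  nC (g l) <= B * Eexp l ^+ n.

Lemma smallD n g k : small n g -> small n k -> small n (fun l => g l + k l).
Proof.
move=> gs ks e e0; have e20 : 0 < e / 2 by rewrite divr_gt0.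
have [L1 gL] := gs _ e20; have [L2 kL] := ks _ e20.
exists (Num.max L1 L2) => l; rewrite ge_max => /andP[l1 l2].
apply: (le_trans (nCD _ _)); rewrite [e]splitr mulrDl.
by apply: lerD; [exact: gL|exact: kL].
Qed.

Lemma smallN n g : small n g -> small n (fun l => - g l).
Proof. by move=> gs e /gs[L gL]; exists L => l; rewrite nCN; exact: gL. Qed.

Lemma smallB n g k : small n g -> small n k -> small n (fun l => g l - k l).
Proof. by move=> gs ks; apply: smallD => //; exact: smallN. Qed.

Lemma small_big_O n g : small n g -> big_O n g.
Proof. by move=> /(_ 1 ltr01)[L gL]; exists 1 => //; exists L. Qed.

Lemma big_OD n g k : big_O n g -> big_O n k -> big_O n (fun l => g l + k l).
Proof.
move=> [A A0 [L1 gL]] [B B0 [L2 kL]]; exists (A + B); first exact: addr_gt0.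
exists (Num.max L1 L2) => l; rewrite ge_max => /andP[l1 l2].
apply: (le_trans (nCD _ _)); rewrite mulrDl.
by apply: lerD; [exact: gL|exact: kL].
Qed.

Lemma big_ON n g : big_O n g -> big_O n (fun l => - g l).
Proof. by move=> [B B0 [L gL]]; exists B => //; exists L => l; rewrite nCN; exact: gL. Qed.

Lemma smallM n m g k : small n g -> big_O m k -> small (n + m) (fun l => g l * k l).
Proof.
move=> gs [B B0 [L2 kL]] e e0.
have [L1 gL] := gs _ (divr_gt0 e0 B0).
exists (Num.max L1 L2) => l; rewrite ge_max => /andP[l1 l2].
rewrite nCM exprD.
have -> : e * (Eexp l ^+ n * Eexp l ^+ m) = (e / B * Eexp l ^+ n) * (B * Eexp l ^+ m).
  by field; rewrite gt_eqF.
by apply: ler_pM; rewrite ?nC_ge0 ?gL ?kL.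
Qed.

Lemma small_ext n g k : g =1 k -> small n g -> small n k.
Proof. by move=> /funext ->. Qed.

Definition half_angle (l : C) : C := l * (pi / 2)%:C.

Lemma Im_half_angle l : complex.Im (half_angle l) = complex.Im l * (pi / 2).
Proof. by rewrite ReImE /= mulr0 add0r. Qed.

Lemma Re_half_angle l : complex.Re (half_angle l) = complex.Re l * (pi / 2).
Proof. by rewrite ReImE /= mulr0 subr0. Qed.

Let pih : 0 <= pi / 2 :> R. Proof. by rewrite divr_ge0// pi_ge0. Qed.

Lemma Eexp_half_angle l : Eexp l = expR `|complex.Im (half_angle l)|.
Proof. by rewrite Im_half_angle normrM (ger0_norm pih). Qed.

Lemma ccos_big_O : big_O 1 (fun l => ccos (half_angle l)).
Proof.
exists 1 => //; exists 0 => l _; rewrite mul1r expr1.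
rewrite -(@ler_pXn2r _ 2) ?nnegrE ?nC_ge0 ?(ltW (Eexp_gt0 _))//.
apply: (le_trans (nC_ccos_le _)).
by rewrite Eexp_half_angle -expRM_natl.
Qed.

Lemma csin_big_O : big_O 1 (fun l => csin (half_angle l)).
Proof.
exists 1 => //; exists 0 => l _; rewrite mul1r expr1.
rewrite -(@ler_pXn2r _ 2) ?nnegrE ?nC_ge0 ?(ltW (Eexp_gt0 _))//.
apply: (le_trans (nC_csin_le _)).
by rewrite Eexp_half_angle -expRM_natl.
Qed.

(** The half side [4 k + 1] makes the sine of the real part [1] or [-1] on the vertical sides, where
    the squared modulus of [csin] is therefore [ch^2]. On the horizontal sides the imaginary part
    [y] of the half angle has modulus at least 1/2, and [sh |y|] is at least a quarter of
    [exp |y|]. *)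
Lemma csin_lower (k : nat) l : sq_bdry (4 * k%:R + 1) l ->
  Eexp l <= 4 * nC (csin (half_angle l)).
Proof.
move=> bd; have E0 := Eexp_gt0 l.
rewrite -(@ler_pXn2r _ 2) ?nnegrE ?mulr_ge0 ?nC_ge0 ?(ltW E0)//.
rewrite exprMn nC_csin Eexp_half_angle.
case: bd => -[h1 h2]; last first.
  set y := complex.Im _.
  have y1 : 2^-1 <= `|y|.
    rewrite /y Im_half_angle normrM h1 (ger0_norm pih).
    have k0 : 0 <= k%:R * (pi / 2) :> R by rewrite mulr_ge0.
    by have := pi_ge2 R; lra.
  suff h : (expR `|y|) ^+ 2 <= 4 ^+ 2 * sh y ^+ 2.
    by apply: (le_trans h); rewrite ler_pM2l ?exprn_gt0// lerDr sqr_ge0.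
  have shy : sh y ^+ 2 = sh `|y| ^+ 2.
    have [//|_] := ger0P y.
    by rewrite /sh opprK -opprB mulNr sqrrN.
  rewrite shy -exprMn ler_pXn2r ?nnegrE ?expR_ge0//.
    rewrite /sh expRN.
    have h2e : 2 <= expR `|y| * expR `|y|.
      by rewrite -expRD; have := expR_ge1Dx (`|y| + `|y|); lra.
    have e0 := expR_gt0 `|y|.
    have : (expR `|y|)^-1 <= expR `|y| / 2.
      by rewrite -(ler_pM2l e0) divff ?gt_eqF//; lra.
    lra.
  apply: mulr_ge0 => //; apply: divr_ge0 => //; rewrite subr_ge0 ler_expR.
have s1 (j : nat) : sin ((4 * j%:R + 1) * (pi / 2)) = 1 :> R.
  elim: j => [|j IH]; first by rewrite mulr0 add0r mul1r sin_pihalf.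
  rewrite -[RHS]IH -[RHS]sinD2pi; congr sin.
  by rewrite -natr1 mulr2n; field.
have -> : sin (complex.Re (half_angle l)) ^+ 2 = 1.
  rewrite Re_half_angle; move: h1; have [_ ->|_ h1] := ger0P (complex.Re l).
    by rewrite s1 expr1n.
  by rewrite -[complex.Re l]opprK h1 mulNr sinN s1 sqrrN expr1n.
set y := complex.Im _; rewrite addrC (_ : sh y ^+ 2 + 1 = ch y ^+ 2); last first.
  by have := ch_sh y; lra.
rewrite -exprMn ler_pXn2r ?nnegrE ?expR_ge0 ?mulr_ge0 ?(ltW (ch_gt0 _))//.
have e1 := expR_gt0 y; have e2 := expR_gt0 (- y); rewrite /ch.
by have [_|_] := ger0P y; lra.
Qed.

Lemma small_ratio F f : small 2 F ->
  small 2 (fun l => f l + 4 * csin (half_angle l) ^+ 2) ->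
  forall eta K : R, 0 < eta -> exists L, [/\ K <= L, 0 < L & forall z, sq_bdry L z ->
     f z != 0 /\ nC (F z) <= eta * nC (f z)].
Proof.
move=> Fs fs eta K eta0.
(* On the boundary [4 |csin|^2] is at least a quarter of the squared growth. Allowing the error of
   [f] to take an eighth leaves an eighth as lower bound for [|f|], against which [F] is
   measured. *)
have e80 : 0 < eta / 8 by rewrite divr_gt0.
have e81 : 0 < 8^-1 :> R by rewrite invr_gt0.
have [L1 FL] := Fs _ e80; have [L2 fL] := fs _ e81.
pose M := `|K| + `|L1| + `|L2|.
pose k := Num.bound M.
have Mk : M < k%:R by apply: archi_boundP; rewrite !addr_ge0.
have Mge x : x = K \/ x = L1 \/ x = L2 -> x <= 4 * k%:R + 1.
  have k1 := ler_norm K; have k2 := ler_norm L1; have k3 := ler_norm L2.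
  have n1 : 0 <= `|K| by []; have n2 : 0 <= `|L1| by []; have n3 : 0 <= `|L2| by [].
  by rewrite /M in Mk => -[->|[->|->]]; lra.
have k0 : 0 <= k%:R :> R by [].
exists (4 * k%:R + 1); split; [by apply: Mge; left|lra|].
move=> z zb; have zL : 4 * k%:R + 1 <= nC z.
  by case: zb => -[<- _]; [exact: nC_Re|exact: nC_Im].
have Fz := FL z (le_trans (Mge _ (or_intror (or_introl erefl))) zL).
have fz := fL z (le_trans (Mge _ (or_intror (or_intror erefl))) zL).
have E0 := Eexp_gt0 z.
have sz : Eexp z ^+ 2 <= 16 * nC (csin (half_angle z)) ^+ 2.
  have -> : 16 * nC (csin (half_angle z)) ^+ 2 = (4 * nC (csin (half_angle z))) ^+ 2 by ring.
  by rewrite ler_pXn2r ?nnegrE ?mulr_ge0 ?nC_ge0 ?(ltW E0)// (csin_lower zb).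
have n4 : nC (4 : C) = 4.
  by rewrite (_ : (4 : C) = (4 : R)%:C) ?nC_real ?ger0_norm// rmorph_nat.
have fge : Eexp z ^+ 2 <= 8 * nC (f z).
  have := nC_dist (4 * csin (half_angle z) ^+ 2) (- f z).
  rewrite opprK [_ + f z]addrC nCN nCM nCX n4; lra.
have E20 : 0 < Eexp z ^+ 2 by rewrite exprn_gt0.
split; first by rewrite -nC_gt0; lra.
apply: (le_trans Fz).
have : eta * Eexp z ^+ 2 <= eta * (8 * nC (f z)) by rewrite ler_pM2l.
lra.
Qed.

End growth.

(** * Functions with Taylor expansions at every point *)

Section expansions.
Variable R : realType.
Notation C := R[i].
Implicit Types g k : C -> C.

Definition expandable g := forall a, exists P, peano g a 5 P.

Lemma expandableD g k : expandable g -> expandable k -> expandable (fun l => g l + k l).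
Proof. by move=> gE kE a; have [P gP] := gE a; have [Q kQ] := kE a; exists (P + Q); exact: peanoD. Qed.

Lemma expandableN g : expandable g -> expandable (fun l => - g l).
Proof. by move=> gE a; have [P gP] := gE a; exists (- P); exact: peanoN. Qed.

Lemma expandableB g k : expandable g -> expandable k -> expandable (fun l => g l - k l).
Proof. by move=> gE kE; apply: expandableD => //; exact: expandableN. Qed.

Lemma expandableM g k : expandable g -> expandable k -> expandable (fun l => g l * k l).
Proof. by move=> gE kE a; have [P gP] := gE a; have [Q kQ] := kE a; exists (P * Q); exact: peanoM. Qed.

Lemma expandable_ext g k : g =1 k -> expandable g -> expandable k.
Proof. by move=> /funext ->. Qed.

Lemma peano_sqr g a P : peano g a 5 P -> g a = 0 ->
  [/\ peano (fun l => g l * g l) a 5 (P * P), (P * P)`_0 = 0 & (P * P)`_1 = 0].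
Proof.
move=> gP ga; have P0 := peano_coef0 gP; rewrite ga in P0.
split; first exact: peanoM.
  by rewrite coefM big_ord1 P0 mul0r.
by rewrite coefM !big_ord_recr big_ord0 /= P0 !(mul0r, mulr0) !addr0.
Qed.

Lemma expandable_continuous g a : expandable g -> forall e : R, 0 < e ->
  exists2 d : R, 0 < d & forall w, nC w <= d -> nC (g (a + w) - g a) <= e.
Proof.
move=> gE e e0; have [P gP] := gE a; have [M M0 gM] := peano5 gP.
rewrite (peano_coef0 gP) in gM.
pose A := nC P`_1 + nC P`_2 + nC P`_3 + nC P`_4 + M + 1.
have A0 : 0 < A by rewrite /A ltr_wpDl// !addr_ge0 ?nC_ge0.
exists (Num.min 1 (e / A)); first by rewrite lt_min ltr01 divr_gt0.
move=> w; rewrite le_min => /andP[w1 we].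
have n0 := nC_ge0 w.
have le_w n : nC w ^+ n.+1 <= nC w by rewrite exprS ler_piMr// exprn_ile1.
have mono (c : R) n : 0 <= c -> c * nC w ^+ n.+1 <= c * nC w by move=> c0; rewrite ler_wpM2l.
have -> : g (a + w) - g a =
  (g (a + w) - (g a + P`_1 * w + P`_2 * w ^+ 2 + P`_3 * w ^+ 3 + P`_4 * w ^+ 4)) +
  (((P`_1 * w + P`_2 * w ^+ 2) + P`_3 * w ^+ 3) + P`_4 * w ^+ 4) by ring.
apply: (le_trans (nCD _ _)).
have i0 := gM w w1; have i1 := nCD ((P`_1 * w + P`_2 * w ^+ 2) + P`_3 * w ^+ 3) (P`_4 * w ^+ 4).
have i2 := nCD (P`_1 * w + P`_2 * w ^+ 2) (P`_3 * w ^+ 3).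
have i3 := nCD (P`_1 * w) (P`_2 * w ^+ 2).
rewrite (nCM P`_4) (nCX w 4) in i1; rewrite (nCM P`_3) (nCX w 3) in i2.
rewrite (nCM P`_1) (nCM P`_2) (nCX w 2) in i3.
have j0 := mono M 4 M0; have j4 := mono _ 3 (nC_ge0 P`_4).
have j3 := mono _ 2 (nC_ge0 P`_3); have j2 := mono _ 1 (nC_ge0 P`_2).
have : A * nC w <= e by rewrite mulrC -ler_pdivlMr.
by rewrite /A; lra.
Qed.

(** Squaring turns a zero of [g] into one of order at least two, and [small 1] into [small 2]; both
    are needed to compare with [f]. *)
Lemma square_zero (f g : C -> C) : expandable f -> expandable g ->
  (forall a, f a = 0 -> exists P, [/\ peano f a 5 P, P`_1 = 0 & P`_2 != 0]) ->
  (forall a, f a = 0 -> g a = 0) -> small 1 g ->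
  small 2 (fun l => f l + 4 * csin (half_angle l) ^+ 2) ->
  forall l, g l = 0.
Proof.
move=> fE gE f2 g0 gs fs l; apply/eqP; rewrite -sqrf_eq0; apply/eqP; rewrite expr2.
apply: (@ratio_zero R (fun l => g l * g l) f fE (expandableM gE gE) f2).
  move=> a fa; have [P gP] := gE a.
  by exists (P * P); exact: peano_sqr gP (g0 _ fa).
apply: small_ratio fs; exact: (smallM gs (small_big_O gs)).
Qed.

End expansions.

(** * The discriminant and the half-period identity *)

Section main.
Variable R : realType.
Notation C := R[i].
Notation J := (Jmx R).
Variables (Q : R -> 'M[C]_2) (p s : R -> R).
Hypothesis Q_canonical : Dirac_canonical_form Q p s.
Hypothesis p_integrable : Lebesgue_integrable `[0, pi[ p.
Hypothesis s_integrable : Lebesgue_integrable `[0, pi[ s.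
Variable Y : C -> R -> 'M[C]_2.
Hypothesis Y_solution : forall l, Dirac_solution Q l (Y l).
Hypothesis Y_initial : forall l, Y l 0 = 1%:M.

Let pi0 : 0 < pi :> R. Proof. exact: pi_gt0. Qed.
Let h : R := pi / 2.
Let h0 : 0 <= h. Proof. by rewrite divr_ge0// ltW. Qed.
Let hpi : h <= pi. Proof. by have := pi0; rewrite /h; lra. Qed.

Definition discr2 l : C := \tr (Y l pi) - 2.

(* [adjY l] is the inverse of [Y l (pi / 2)], so [Zmx l] is the transfer matrix from
   [pi / 2] to [pi]. *)
Definition adjY l : 'M[C]_2 :=
  mx2 (Y l h 1 1) (- Y l h 0 1) (- Y l h 1 0) (Y l h 0 0).
Definition Zmx l : 'M[C]_2 := Y l pi *m adjY l.

Let det_h l : Y l h 0 0 * Y l h 1 1 - Y l h 0 1 * Y l h 1 0 = 1.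
Proof. exact: symp_det (dirac_symp Q_canonical (Y_solution l) (Y_initial l) h). Qed.

Lemma Y_adj l : Y l h *m adjY l = 1%:M.
Proof.
have dt := det_h l.
by apply: mx2P; rewrite mul2E !mx2_ij one2E -?dt; ring.
Qed.

Lemma Zmx_Y l : Zmx l *m Y l h = Y l pi.
Proof. by rewrite /Zmx -mulmxA (mulmx1C (Y_adj l)) mulmx1. Qed.

Lemma Dirac_solution_mulr l (S : R -> 'M[C]_2) A : Dirac_solution Q l S ->
  Dirac_solution Q l (fun t => S t *m A).
Proof.
move=> [Sac SD]; split; first exact: (macM Sac (mac_cst A)).
apply: ae_imply_lebesgue SD => z [D SD E].
exists (D *m A); first exact: (mderMr A SD).
by rewrite !mulmxA -mulmxDl E scalemxAl.
Qed.

(** [Zmx l] is the value at [pi] of the solution normalized at [pi / 2]. Both intervals have length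
    [pi / 2], so both matrices have the same leading term. *)
Lemma entries_asymp i j :
  small 1 (fun l => Y l h i j - rot (half_angle l) i j) /\
  small 1 (fun l => Zmx l i j - rot (half_angle l) i j).
Proof.
have H e : 0 < e -> exists L : R, forall l, L <= nC l ->
    fro2 (Y l h - rot (half_angle l)) <= (e * Eexp l) ^+ 2 /\
    fro2 (Zmx l - rot (half_angle l)) <= (e * Eexp l) ^+ 2.
  move=> e0; have e20 : 0 < e ^+ 2 by rewrite exprn_gt0.
  have [L L0 HL] := Dirac_asymp Q_canonical pi0 p_integrable s_integrable e20.
  exists L => l lL.
  have EE : (e * Eexp l) ^+ 2 = e ^+ 2 * expR (2 * `|complex.Im l| * h).
    by rewrite exprMn /Eexp -expRM_natl mulrA.
  rewrite EE; split.
    have := HL l 0 h (Y l) lL (lexx _) h0 hpi (Y_solution l) (Y_initial l).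
    by rewrite !subr0.
  have := HL l h pi (fun t => Y l t *m adjY l) lL h0 hpi (lexx _)
    (Dirac_solution_mulr (adjY l) (Y_solution l)) (Y_adj l).
  by rewrite (_ : pi - h = h)//; rewrite /h; field.
have Ee e l : 0 < e -> 0 <= e * Eexp l by move=> e0; rewrite mulr_ge0 ?ltW ?Eexp_gt0.
split=> e e0; have [L HL] := H e e0; exists L => l /HL[h1 h2]; rewrite expr1.
  rewrite -(@ler_pXn2r _ 2) ?nnegrE ?nC_ge0 ?Ee//; apply: le_trans h1.
  by have := fro2_entry (Y l h - rot (half_angle l)) i j; rewrite mxE [X in _ + X]mxE.
rewrite -(@ler_pXn2r _ 2) ?nnegrE ?nC_ge0 ?Ee//; apply: le_trans h2.
by have := fro2_entry (Zmx l - rot (half_angle l)) i j; rewrite mxE [X in _ + X]mxE.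
Qed.

Lemma Y_expandable z i j : 0 <= z <= pi -> expandable (fun l => Y l z i j).
Proof.
move=> zpi a; exists (\poly_(k < 5) Amx Y a k z i j).
have [M M0 YM] := Y_taylor Q_canonical Y_solution Y_initial (nC a) 5 (ltW pi0).
exists M; first exact: ltW.
move=> w w1; have := YM a w z (lexx _) w1 zpi i j.
rewrite horner_poly; congr (nC (_ - _) <= _).
by apply: eq_bigr => k _; rewrite mulrC.
Qed.

Lemma Zmx_expandable i j : expandable (fun l => Zmx l i j).
Proof.
have pp : 0 <= (pi : R) <= (pi : R) by apply/andP; split; [exact: ltW|].
have hp : 0 <= h <= pi by rewrite h0.
have aE k : expandable (fun l => adjY l k j).
  by move: k j; apply: ord2_ind; apply: ord2_ind; under eq_fun do rewrite mx2_ij;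
    do ?apply: expandableN; exact: Y_expandable.
apply: (@expandable_ext _ (fun l => Y l pi i 0 * adjY l 0 j + Y l pi i 1 * adjY l 1 j)).
  by move=> l; rewrite mul2E.
by apply: expandableD; apply: expandableM => //; exact: Y_expandable.
Qed.

Let c1 a := \tr (Amx Y a 1 pi).
Let c2 a := \tr (Amx Y a 2 pi).

Lemma discr2_peano a : exists P, [/\ peano discr2 a 5 P, P`_1 = c1 a & P`_2 = c2 a].
Proof.
pose P i j := \poly_(k < 5) Amx Y a k pi i j.
have PP i j : peano (fun l => Y l pi i j) a 5 (P i j).
  have [M M0 YM] := Y_taylor Q_canonical Y_solution Y_initial (nC a) 5 (ltW pi0).
  exists M; first exact: ltW.
  move=> w w1; have := YM a w pi (lexx _) w1 _ i j; rewrite lexx ltW// => /(_ isT).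
  rewrite horner_poly; congr (nC (_ - _) <= _).
  by apply: eq_bigr => k _; rewrite mulrC.
exists (P 0 0 + P 1 1 - 2%:P); split.
- have -> : discr2 = (fun l => Y l pi 0 0 + Y l pi 1 1 - 2) by apply/funext => l; rewrite /discr2 tr2E.
  by apply: peanoB; [apply: peanoD|exact: peano_cst].
- by rewrite !(coefB, coefD) coefC !coef_poly /= subr0 /c1 tr2E.
- by rewrite !(coefB, coefD) coefC !coef_poly /= subr0 /c2 tr2E.
Qed.

(** Multiplicities are defined by iterated complex derivatives, the estimates use Taylor
    coefficients; this is the bridge between them. *)
Lemma discr2_derive a : derive1n 1 (discr2 : C -> C^o) a = c1 a /\
  derive1n 2 (discr2 : C -> C^o) a = 2 * c2 a.
Proof.
apply: derive1n_complex => rho.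
have [M M0 YM] := Y_taylor Q_canonical Y_solution Y_initial rho 3 (ltW pi0).
exists (M + M); first exact: addr_gt0.
move=> {}a w ar w1.
have pp : 0 <= (pi : R) <= (pi : R) by apply/andP; split; [exact: ltW|].
have e0 := YM a w pi ar w1 pp 0 0; have e1 := YM a w pi ar w1 pp 1 1.
rewrite !big_ord_recr !big_ord0 /= !Amx0 in e0 e1.
rewrite mulrDl; apply: le_trans (lerD e0 e1); apply: le_trans (nCD _ _).
rewrite le_eqVlt; apply/orP; left; apply/eqP; congr nC.
by rewrite /discr2 /c1 /c2 !tr2E; ring.
Qed.

Lemma discr2_zero_real a : discr2 a = 0 -> complex.Im a = 0.
Proof.
move=> /eqP; rewrite subr_eq0 => /eqP.
exact: (trace2_real Q_canonical Y_solution Y_initial pi0).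
Qed.

Lemma discr2_trace l : discr2 l = Zmx l 0 0 * Y l h 0 0 + Zmx l 0 1 * Y l h 1 0 +
  (Zmx l 1 0 * Y l h 0 1 + Zmx l 1 1 * Y l h 1 1) - 2.
Proof. by rewrite /discr2 -Zmx_Y tr2E !mul2E. Qed.

Lemma half_square_sufficient :
  (forall l, Y l pi = (sigma2 R *m Y l h) ^+ 2) -> only_double_zeros discr2.
Proof.
move=> Ysq a da; have ar := discr2_zero_real da.
have ii : 'i%C * 'i%C = -1 :> C by rewrite -expr2 sqr_i.
have dt := det_h a.
have Y1 : Y a pi = 1%:M.
  have sq i j : Y a pi i j = (sigma2 R *m Y a h) i 0 * (sigma2 R *m Y a h) 0 j +
     (sigma2 R *m Y a h) i 1 * (sigma2 R *m Y a h) 1 j by rewrite Ysq expr2 mul2E.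
  move: da; rewrite /discr2 tr2E !sq !mul2E !mx2_ij.
  set ya := Y a h 0 0 in dt sq *; set yb := Y a h 0 1 in dt sq *.
  set yc := Y a h 1 0 in dt sq *; set yd := Y a h 1 1 in dt sq *.
  set I := ('i%C : C) in ii *.
  move=> E.
  (* The trace of [M = sigma2 Y] is [i (yc - yb)], and at a zero of the discriminant its square is
     0. *)
  have bc : yb = yc.
    apply/eqP; rewrite -subr_eq0 -sqrf_eq0; apply/eqP.
    have E2 : (I * I) * (yc ^+ 2 - 2 * ya * yd + yb ^+ 2) - 2 = 0 by rewrite -[RHS]E; ring.
    rewrite ii in E2.
    rewrite [LHS](_ : _ = - (-1 * (yc ^+ 2 - 2 * ya * yd + yb ^+ 2) - 2) +
      2 * (ya * yd - yb * yc) - 2); last by ring.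
    by rewrite E2 dt; ring.
  have P00 : Y a pi 0 0 = ya * yd - yb * yc.
    rewrite sq !mul2E !mx2_ij -/I -/ya -/yb -/yc -/yd bc.
    have -> : (0 * ya + I * yc) * (0 * ya + I * yc) + (0 * yc + I * yd) * (- I * ya + 0 * yc) =
      (I * I) * (yc * yc - ya * yd) by ring.
    by rewrite ii; ring.
  have P11 : Y a pi 1 1 = ya * yd - yb * yc.
    rewrite sq !mul2E !mx2_ij -/I -/ya -/yb -/yc -/yd bc.
    have -> : (- I * ya + 0 * yc) * (0 * yc + I * yd) + (- I * yc + 0 * yd) * (- I * yc + 0 * yd) =
      (I * I) * (yc * yc - ya * yd) by ring.
    by rewrite ii; ring.
  apply: mx2P; rewrite ?P00 ?P11 ?dt ?one2E// sq !mul2E !mx2_ij -/I -/ya -/yb -/yc -/yd bc; ring.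
have [t1 t2] := monodromy1_double Q_canonical Y_solution Y_initial pi0 ar Y1.
have [d1 d2] := discr2_derive a.
split.
  move=> [|[|//]] _; first exact: da.
  by rewrite d1.
by rewrite d2 mulf_neq0// pnatr_eq0.
Qed.

Lemma double_zero_monodromy a : zero_multiplicity discr2 a 2 ->
  [/\ c1 a = 0, c2 a != 0 & Y a pi = 1%:M].
Proof.
move=> [dk d2]; have [D1 D2] := discr2_derive a.
have da : discr2 a = 0 by exact: (dk 0%N).
have c10 : c1 a = 0 by rewrite -D1; exact: (dk 1%N).
split => //; first by move: d2; rewrite D2; apply: contra => /eqP ->; rewrite mulr0.
apply: (double_monodromy Q_canonical Y_solution Y_initial pi0 (discr2_zero_real da)) => //.
by apply/eqP; rewrite -subr_eq0; apply/eqP.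
Qed.

Lemma discr2_asymp : small 2 (fun l => discr2 l + 4 * csin (half_angle l) ^+ 2).
Proof.
have aY i j := (entries_asymp i j).1; have aZ i j := (entries_asymp i j).2.
have cO := ccos_big_O R; have sO := csin_big_O R.
have YO i j : big_O 1 (fun l => Y l h i j).
  have rO : big_O 1 (fun l : C => rot (half_angle l) i j).
    rewrite /rot; move: i j; apply: ord2_ind; apply: ord2_ind; under eq_fun do rewrite mx2_ij; by [|apply: big_ON].
  have -> : (fun l => Y l h i j) = (fun l => (Y l h i j - rot (half_angle l) i j) + rot (half_angle l) i j).
    by apply/funext => l; rewrite subrK.
  by apply: big_OD => //; exact: small_big_O.
(* The difference between the products of entries of [Zmx] and [Y] and those of [rot], split so that
   each summand has one small factor and one bounded by the growth. *)
pose T i k j l := (Zmx l i k - rot (half_angle l) i k) * Y l h k j +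
   (Y l h k j - rot (half_angle l) k j) * rot (half_angle l) i k.
have Ts i k j : small 2 (T i k j).
  apply: smallD; first exact: (smallM (aZ i k) (YO k j)).
  apply: (smallM (aY k j)); rewrite /rot; move: i k; apply: ord2_ind; apply: ord2_ind;
    under eq_fun do rewrite mx2_ij; by [|apply: big_ON].
have := smallD (smallD (Ts 0 0 0) (Ts 0 1 0)) (smallD (Ts 1 0 1) (Ts 1 1 1)).
apply: small_ext => l; rewrite discr2_trace /T /rot !mx2_ij.
have := ccos_csin (half_angle l).
set c := ccos _; set S := csin _ => cs.
have -> : 4 * S ^+ 2 = 2 * (c ^+ 2 + S ^+ 2) - 2 * c ^+ 2 + 2 * S ^+ 2 by ring.
by rewrite cs; ring.
Qed.

Lemma half_square_necessary : only_double_zeros discr2 ->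
  forall l, Y l pi = (sigma2 R *m Y l h) ^+ 2.
Proof.
move=> dz.
have hp : 0 <= h <= pi by rewrite h0.
have dm a : discr2 a = 0 -> [/\ c1 a = 0, c2 a != 0 & Y a pi = 1%:M].
  by move=> da; apply: double_zero_monodromy; exact: dz.
have ddE : expandable discr2 by move=> a; have [P []] := discr2_peano a; exists P.
have dd2 a : discr2 a = 0 -> exists P, [/\ peano discr2 a 5 P, P`_1 = 0 & P`_2 != 0].
  move=> /dm[c10 c20 _]; have [P [dP P1 P2]] := discr2_peano a.
  by exists P; rewrite P1 P2.
have Zadj a : discr2 a = 0 -> Zmx a = adjY a.
  by move=> /dm[_ _ Y1]; rewrite /Zmx Y1 mul1mx.
have aY i j := (entries_asymp i j).1; have aZ i j := (entries_asymp i j).2.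
have YE i j := @Y_expandable h i j hp.
have e1 l : Zmx l 0 0 - Y l h 1 1 = 0.
  apply: (square_zero (f := discr2) (g := fun l => Zmx l 0 0 - Y l h 1 1) _ _ dd2 _ _ discr2_asymp) => //.
  - by apply: expandableB => //; exact: Zmx_expandable.
  - by move=> a /Zadj ->; rewrite mx2_ij subrr.
  - apply: small_ext (smallB (aZ 0 0) (aY 1 1)) => x; rewrite /rot !mx2_ij; ring.
have e2 l : Zmx l 1 1 - Y l h 0 0 = 0.
  apply: (square_zero (f := discr2) (g := fun l => Zmx l 1 1 - Y l h 0 0) _ _ dd2 _ _ discr2_asymp) => //.
  - by apply: expandableB => //; exact: Zmx_expandable.
  - by move=> a /Zadj ->; rewrite mx2_ij subrr.
  - apply: small_ext (smallB (aZ 1 1) (aY 0 0)) => x; rewrite /rot !mx2_ij; ring.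
pose u l := Zmx l 0 1 + Y l h 0 1; pose v l := Zmx l 1 0 + Y l h 1 0.
have uE : expandable u by apply: expandableD => //; exact: Zmx_expandable.
have vE : expandable v by apply: expandableD => //; exact: Zmx_expandable.
have u0 a : discr2 a = 0 -> u a = 0 by move=> /Zadj; rewrite /u => ->; rewrite mx2_ij addNr.
have v0 a : discr2 a = 0 -> v a = 0 by move=> /Zadj; rewrite /v => ->; rewrite mx2_ij addNr.
(* The entries [(0, 1)] and [(1, 0)] of [rot] have opposite signs, so [u] and [v] are not small
   themselves, but their sum is. *)
have us : small 1 (fun l => u l + 2 * csin (half_angle l)).
  by apply: small_ext (smallD (aZ 0 1) (aY 0 1)) => l; rewrite /u /rot !mx2_ij; ring.
have vs : small 1 (fun l => v l - 2 * csin (half_angle l)).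
  by apply: small_ext (smallD (aZ 1 0) (aY 1 0)) => l; rewrite /v /rot !mx2_ij; ring.
have uv l : u l + v l = 0.
  apply: (square_zero (f := discr2) (g := fun l => u l + v l) _ _ dd2 _ _ discr2_asymp) => //.
  - exact: expandableD.
  - by move=> a da; rewrite u0 ?v0 ?addr0.
  - by apply: small_ext (smallD us vs) => x; ring.
have uu l : u l * u l + discr2 l = 0.
  apply: (@ratio_zero R (fun l => u l * u l + discr2 l) discr2) => //.
  - by apply: expandableD => //; exact: expandableM.
  - move=> a da; have [P uP] := uE a; have [Q' [dQ Q1 Q2]] := dd2 a da.
    have [sP s0 s1] := peano_sqr uP (u0 a da).
    exists (P * P + Q'); split; first exact: peanoD.
      by rewrite coefD s0 (peano_coef0 dQ) da addr0.
    by rewrite coefD s1 Q1 addr0.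
  - apply: small_ratio discr2_asymp.
    (* [u^2 - 4 csin^2] factors into [u + 2 csin], which is small, and [u - 2 csin], which is only
       bounded by the growth; the remaining [4 csin^2] is absorbed by the asymptotics of the
       discriminant. *)
    have uO : big_O 1 (fun l => u l - 2 * csin (half_angle l)).
      have sO := csin_big_O R.
      have := big_OD (small_big_O us) (big_ON (big_OD (big_OD sO sO) (big_OD sO sO))).
      by congr big_O; apply/funext => x; ring.
    have := smallD (smallM us uO) discr2_asymp.
    by apply: small_ext => x; ring.
(* Once [Zmx] is expressed by [Y] and [u], the relation [u^2 + f = 0] becomes, by determinant 1, the
   product [u k = 0]; the identity to prove is [k = 0]. *)
pose k l := Y l h 1 0 - Y l h 0 1 + u l.
have kE : expandable k by apply: expandableD => //; exact: expandableB.
have uk l : u l * k l = 0.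
  have vl : Zmx l 1 0 = - u l - Y l h 1 0.
    have := uv l; rewrite /v => /eqP; rewrite addr_eq0 => /eqP ->.
    by rewrite opprK; ring.
  have := uu l; rewrite discr2_trace vl.
  have -> : Zmx l 0 0 = Y l h 1 1 by apply/eqP; rewrite -subr_eq0 e1.
  have -> : Zmx l 1 1 = Y l h 0 0 by apply/eqP; rewrite -subr_eq0 e2.
  have -> : Zmx l 0 1 = u l - Y l h 0 1 by rewrite /u addrK.
  move=> E.
  have E3 : u l * k l + 2 * (Y l h 0 0 * Y l h 1 1 - Y l h 0 1 * Y l h 1 0) - 2 = 0.
    by rewrite -[RHS]E /k; ring.
  by move: E3; rewrite det_h mulr1 addrK.
have k0 l : k l = 0.
  have [ul|ul] := eqVneq (u l) 0; last first.
    by have /eqP := uk l; rewrite mulf_eq0 (negbTE ul) => /eqP.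
  have dl : discr2 l = 0 by have := uu l; rewrite ul mul0r add0r.
  (* The quotient [f / f] serves only to extract that [f] has no other zero in a small disc around
     [l]. There [u] does not vanish, since [u^2 = - f], so [k] does; continuity settles the
     centre. *)
  have [c0 [b1 [b2 [N [d [d0 N0 _ hd]]]]]] := ratio_expand (ddE l) (ddE l) (dd2 l)
    (fun e => let: ex_intro P (And3 a b c) := dd2 l e in ex_intro _ P (And3 a (etrans (peano_coef0 a) e) b)).
  have kz w : 0 < nC w <= d -> k (l + w) = 0.
    move=> /hd[dw _]; have /eqP := uk (l + w); rewrite mulf_eq0 => /orP[/eqP uw|/eqP //].
    by case/eqP: dw; have := uu (l + w); rewrite uw mul0r add0r.
  apply/eqP; rewrite -nC_eq0 eq_le nC_ge0 andbT; apply/ler_addgt0Pr => e e0; rewrite add0r.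
  have [r r0 kr] := expandable_continuous l kE e0.
  pose w : C := (Num.min d r)%:C.
  have m0 : 0 < Num.min d r by rewrite lt_min d0.
  have nw : nC w = Num.min d r by rewrite nC_real ger0_norm// ltW.
  have := kr w; rewrite nw ge_min lexx orbT => /(_ isT).
  by rewrite kz ?sub0r ?nCN// nw m0 ge_min lexx.
move=> l.
have z00 : Zmx l 0 0 = Y l h 1 1 by apply/eqP; rewrite -subr_eq0 e1.
have z11 : Zmx l 1 1 = Y l h 0 0 by apply/eqP; rewrite -subr_eq0 e2.
have ul : u l = Y l h 0 1 - Y l h 1 0.
  by apply/eqP; rewrite -subr_eq0 -(k0 l) /k; apply/eqP; ring.
have z01 : Zmx l 0 1 = - Y l h 1 0.
  have -> : Zmx l 0 1 = u l - Y l h 0 1 by rewrite /u addrK.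
  by rewrite ul; ring.
have z10 : Zmx l 1 0 = - Y l h 0 1.
  have -> : Zmx l 1 0 = (u l + v l) - u l - Y l h 1 0 by rewrite /v; ring.
  by rewrite uv ul; ring.
have ii : 'i%C * 'i%C = -1 :> C by rewrite -expr2 sqr_i.
rewrite -Zmx_Y expr2; move: (Zmx l) z00 z01 z10 z11 => Z z00 z01 z10 z11.
apply: mx2P; rewrite !mul2E !mx2_ij ?z00 ?z01 ?z10 ?z11.
all: move: ii; move: ('i%C : C) => I ii.
- rewrite [RHS](_ : _ = (I * I) * (Y l h 1 0 * Y l h 1 0 - Y l h 1 1 * Y l h 0 0)); last by ring.
  by rewrite ii; ring.
- rewrite [RHS](_ : _ = (I * I) * (Y l h 1 0 * Y l h 1 1 - Y l h 1 1 * Y l h 0 1)); last by ring.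
  by rewrite ii; ring.
- rewrite [RHS](_ : _ = (I * I) * (Y l h 0 0 * Y l h 0 1 - Y l h 0 0 * Y l h 1 0)); last by ring.
  by rewrite ii; ring.
- rewrite [RHS](_ : _ = (I * I) * (Y l h 0 1 * Y l h 0 1 - Y l h 0 0 * Y l h 1 1)); last by ring.
  by rewrite ii; ring.
Qed.

End main.

Unset Implicit Arguments.

Theorem lemma4p3 (R : realType) (Q : R -> 'M[R[i]]_2) (p s : R -> R)
    (Q_canonical : Dirac_canonical_form Q p s)
    (Q_periodic : forall z, Q (z + pi) = Q z)
    (p_integrable : Lebesgue_integrable `[0, pi[ p)
    (s_integrable : Lebesgue_integrable `[0, pi[ s)
    (Y : R[i] -> R -> 'M[R[i]]_2)
    (Y_solution : forall lambda, Dirac_solution Q lambda (Y lambda))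
    (Y_initial : forall lambda, Y lambda 0 = 1%:M)
    (Delta : R[i] -> R[i])
    (Delta_def : forall lambda, Delta lambda = \tr (Y lambda pi)) :
  only_double_zeros (fun lambda => Delta lambda - 2) <->
  (forall lambda, Y lambda pi = (sigma2 R *m Y lambda (pi / 2)) ^+ 2).
Proof.
have -> : (fun lambda => Delta lambda - 2) = discr2 Y.
  by apply/funext => l; rewrite Delta_def.
split.
  exact (half_square_necessary Q_canonical p_integrable s_integrable Y_solution Y_initial).
exact (half_square_sufficient Q_canonical Y_solution Y_initial).
Qed.
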